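(* Suppose $\omega_0=(\pi\varepsilon^2)^{-1}(\chi_{D_1}+\chi_{D_2})$ is a corotating vortex pair with angular velocity $\Omega$, i.e. a solution of the elliptic system stated in the context, with $\varepsilon>0$. (i) Then $\Omega\in\big(0,\frac1{2\pi\varepsilon^2}\big]$. (ii) Moreover, there is an absolute constant $C$ such that if $\varepsilon\le l/10$ then $|\Omega|\le C|l|^{-2}$, where $l$ denotes the distance of the center of the patch $D_1$ to the $y$-axis.
   Context: Identify $\mathbb R^2$ with $\mathbb C$. $D_1$ is a bounded simply connected domain, $D_2:=-D_1$, and $D_1\cap D_2=\emptyset$. The elliptic system is: for some function $\Psi$ and constants $c_1,c_2$, $\Delta\Psi=\frac1{\pi\varepsilon^2}\chi_{D_1}+\frac1{\pi\varepsilon^2}\chi_{D_2}-2\Omega$ in $\mathbb C$; $\nabla(\Psi+\frac12\Omega|z|^2)\to0$ as $|z|\to\infty$; $\Psi\in C^1(\mathbb C)$; $\Psi=c_m$ on $\partial D_m$, $m=1,2$. Standing normalization: $D_1=l+\varepsilon D$ with center $(l,0)$, where $D$ is such that the conformal map $\Phi$ from the exterior of the closed unit disk onto $\mathbb C\setminus\overline D$ satisfies $\Phi(\infty)=\infty$, $\Phi'(\infty)=1$, and its trace on the unit circle $\mathbb T$ has the form $\phi(w)=w+\varepsilon f(w)$, $f(w)=\sum_{n\ge1}a_nw^{-n}$, $a_n\in\mathbb R$ (so $D$ is symmetric about the $x$-axis), with $\phi$ a $C^{k+\alpha}(\mathbb T)$ parametrization of $\partial D$ for some integer $k\ge0$ and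 $\alpha\in(0,1)$. *)

(* Defs.v *)
From HB Require Import structures.
From mathcomp Require Import all_boot all_order all_algebra.
From mathcomp Require Import all_classical all_reals all_analysis.
From mathcomp Require Import complex.
Import Order.TTheory GRing.Theory Num.Theory.
Import numFieldNormedType.Exports.
Set Implicit Arguments.
Unset Strict Implicit.
Unset Printing Implicit Defensive.
Local Open Scope classical_set_scope.
Local Open Scope ring_scope.
Local Open Scope complex_scope.

(* The norm topology on R[i], a normed module over itself. *)
HB.instance Definition _ (R : realType) :=
  NormedModule.copy R[i] (R[i] : numClosedFieldType)^o.

(* Real calculus and integration take place on R * R, complex analysis on R[i];
   [plane_of_C] is the identification of the two. *)
Definition plane_of_C (R : realType) (z : R[i]) : R * R := (complex.Re z, complex.Im z).

(* Neighbourhoods of infinity. Over R[i] the condition 0 < M forces M to be a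
   positive real. *)
Definition infty_nbhs (K : numFieldType) (V : normedModType K) : set_system V :=
  filter_from [set M : K | 0 < M] (fun M => [set z | M < `|z|]).
Arguments infty_nbhs {K} V.

Definition boundary (T : topologicalType) (A : set T) : set T :=
  closure A `\` interior A.

(* Every loop in A is freely null-homotopic in A; the first homotopy variable
   is the parameter of the loop. *)
Definition loops_contract (R : realType) (T : topologicalType) (A : set T) :=
  forall gamma : R -> T,
    {within `[0, 1], continuous gamma} ->
    gamma @` `[0, 1] `<=` A -> gamma 0 = gamma 1 ->
    exists (H : R * R -> T) (a : T),
      [/\ {within `[0, 1] `*` `[0, 1], continuous H},
          H @` (`[0, 1] `*` `[0, 1]) `<=` A,
          (forall s, s \in `[0, 1] -> H (s, 0) = gamma s),
          (forall s, s \in `[0, 1] -> H (s, 1) = a) &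
          (forall t, t \in `[0, 1] -> H (0, t) = H (1, t))].

(* For open sets connected means path-connected. *)
Definition simply_connected_domain (R : realType) (A : set (R * R)) :=
  [/\ A !=set0, open A, connected A & loops_contract R A].

Section PlaneCalculus.
Context {R : realType}.
Implicit Types (g : R * R -> R) (p : R * R).

Definition dx g p : R := derive g p (1, 0).
Definition dy g p : R := derive g p (0, 1).
Definition grad g p : R * R := (dx g p, dy g p).
Definition laplacian g p : R := dx (dx g) p + dy (dy g) p.

Fixpoint Ck (n : nat) g : Prop :=
  if n is m.+1 then
    [/\ continuous g,
        (forall p, derivable g p (1, 0) /\ derivable g p (0, 1)),
        Ck m (dx g) & Ck m (dy g)]
  else continuous g.

Definition test_function g : Prop :=
  (forall n, Ck n g) /\ compact (closure [set p | g p != 0]).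

Definition plane_measure :=
  (@lebesgue_measure R \x @lebesgue_measure R)%E.

Definition weak_laplacian (u v : R * R -> R) : Prop :=
  forall g, test_function g ->
    (\int[plane_measure]_p (u p * laplacian g p)%:E
     = \int[plane_measure]_p (v p * g p)%:E)%E.

End PlaneCalculus.

(* omega_0 = (pi eps^2)^-1 (1_D1 + 1_D2) rotates with angular velocity Omega. *)
Definition corotating (R : realType) (eps Omega : R) (D1 D2 : set (R * R)) :=
  exists (Psi : R * R -> R) (c1 c2 : R),
    [/\ weak_laplacian Psi (fun p =>
          (pi * eps ^+ 2)^-1 * \1_D1 p + (pi * eps ^+ 2)^-1 * \1_D2 p
          - 2 * Omega),
        grad (fun p => Psi p + 2^-1 * Omega * (p.1 ^+ 2 + p.2 ^+ 2)) q
          @[q --> infty_nbhs (R * R)%type] --> ((0, 0) : R * R),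
        Ck 1 Psi,
        (forall p, boundary D1 p -> Psi p = c1) &
        (forall p, boundary D2 p -> Psi p = c2)].

Section Normalization.
Context {R : realType}.
Implicit Types (D : set (R * R)) (Phi f phi : R[i] -> R[i]).

Definition expi (t : R) : R[i] := cos t +i* sin t.

Definition exterior_disk : set R[i] := [set w | 1 < `|w|].

Definition circle : set R[i] := [set w | `|w| = 1].

(* Phi'(oo) is the limit of Phi(w) / w. *)
Definition exterior_conformal_map D Phi :=
  [/\ set_bij exterior_disk [set z | ~ closure D (plane_of_C z)] Phi,
      (forall w, exterior_disk w -> derivable Phi w 1),
      Phi w @[w --> infty_nbhs R[i]] --> infty_nbhs R[i] &
      Phi w / w @[w --> infty_nbhs R[i]] --> (1 : R[i])].

Definition has_trace Phi phi :=
  forall w, circle w -> Phi z @[z --> within exterior_disk (nbhs w)] --> phi w.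

Definition negative_power_series (a : nat -> R) f :=
  forall w, circle w ->
    \sum_(1 <= n < N) (a n)%:C * w ^- n @[N --> \oo] --> f w.

Definition holder_on_line (k : nat) (alpha : R) (g : R -> R) :=
  (forall i t, (i < k)%N -> derivable (derive1n i g) t 1) /\
  exists K : R, forall s t,
    `|derive1n k g s - derive1n k g t| <= K * `|s - t| `^ alpha.

(* phi is of class C^(k+alpha) on the unit circle; by periodicity the seminorm
   bound on the whole line is the one over a period. *)
Definition holder_on_circle (k : nat) (alpha : R) phi :=
  holder_on_line k alpha (fun t => complex.Re (phi (expi t))) /\
  holder_on_line k alpha (fun t => complex.Im (phi (expi t))).

Definition normalized_shape (eps : R) D :=
  exists (Phi f : R[i] -> R[i]) (a : nat -> R) (k : nat) (alpha : R),
    let phi w := w + eps%:C * f w in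
    [/\ exterior_conformal_map D Phi, has_trace Phi phi,
        negative_power_series a f,
        0 < alpha < 1 /\ holder_on_circle k alpha phi &
        [set plane_of_C (phi w) | w in circle] = boundary D].

Definition vortex_patch (l eps : R) D : set (R * R) :=
  [set (l + eps * p.1, eps * p.2) | p in D].

Definition opp_set D : set (R * R) := [set - p | p in D].

Definition admissible_pair (l eps : R) D :=
  let D1 := vortex_patch l eps D in
  [/\ bounded_set D1, simply_connected_domain D1,
      D1 `&` opp_set D1 = set0 & normalized_shape eps D].

End Normalization.

(* Main.v *)
(* Put s = 1/(pi eps^2) and Theta = Psi + Omega |x|^2 / 2. The far field condition makes
   grad Theta the Newtonian field s int_{D1 u D2} k(x - y) dy with k(z) = z / (2 pi |z|^2).
   The shape D is invariant under reflection in the x-axis, so D1 and D2 = -D1 are mirror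
   images in the y-axis and lie in opposite half-planes.

   (i) Psi is constant on the boundary of D1, so the integral of d_1 Psi over D1 vanishes.
   The self-interaction of D1 cancels by antisymmetry, which leaves
   s int_{D1} int_{D2} k_1(x - y) = Omega int_{D1} x_1, where both integrals have the same
   sign. For the upper bound, integration by parts over D1 u D2 of area B gives, with
   U = int (Psi - c), the identities int x . grad Psi = -2 U and
   int |grad Psi|^2 = (2 Omega - s) U, while int x . grad Theta <= s B^2 / (4 pi). If
   2 Omega > s these force the second moment of D1 u D2 below B^2 / (2 pi), that of a disc.

   (ii) By the same torque identity it is enough to confine D to an absolute distance from
   the origin. Diameter: for z in D the function w / (Phi w - z) has a holomorphic square
   root tending to 1 at infinity, hence mean value 1 along a square contour; averaging it
   over points z at equidistributed distances from one point of D contradicts this when D is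
   long, because r^(-1/2) is integrable. Position: by Riemann's theorem on trigonometric
   series without constant term, Re f takes both signs (in the weak sense) on the circle, so
   the boundary of D has points with Re <= 1 and with Re >= -1. *)

From HB Require Import structures.
Require Import Defs.
From mathcomp Require Import all_boot all_order all_algebra.
From mathcomp Require Import all_classical all_reals all_analysis.
From mathcomp Require Import measurable_realfun complex ring lra.
Import Order.TTheory GRing.Theory Num.Theory.
Import numFieldNormedType.Exports.
Set Implicit Arguments.
Unset Strict Implicit.
Unset Printing Implicit Defensive.
Local Open Scope classical_set_scope.
Local Open Scope ring_scope.

(** [Psi] is only C^1, its Laplacian is a distribution and the patch boundaries carry no normal
    field. Hence boundary integrals never occur: a C^1 function vanishing on the boundary of a
    bounded open set has partial derivatives of integral zero, line by line. The singular kernel is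
    never integrated either. It is replaced by [kern], that is z / (2 pi (|z|^2 + d^2)), whose
    divergence [eta] is a rational approximate identity; every identity is proved for d > 0 and
    passed to the limit along d = 1/(n+1). The dominating bound, uniform in d, comes out of the
    equation for [Psi] itself. In the upper bound, the strict inequality has its source in the
    centroid of D1 being off the y-axis. In the diameter bound, the distance from the contour to D
    is positive but has no absolute lower bound. For w / (Phi w - z) itself the average over z would
    have a logarithmic term tied to this distance; for the square root the distance enters only
    through a term that tends to 0 as the number of points z grows. *)

Section RealIntegral.
Context d (T : measurableType d) (R : realType) (m : {measure set T -> \bar R}).
Implicit Types f g : T -> R.
Local Notation itg f := (m.-integrable [set: T] (EFin \o f)).

Lemma itg_dom f g : measurable_fun setT f -> itg g ->
  (forall x, `|f x| <= g x) -> itg f.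
Proof.
move=> mf ig fg; apply: (le_integrable measurableT _ _ ig).
  exact/measurable_EFinP.
by move=> x _ /=; rewrite lee_fin (le_trans (fg x))// ler_norm.
Qed.

Lemma itg_indic (A : set T) : measurable A -> (m A < +oo)%E ->
  m.-integrable [set: T] (EFin \o \1_A).
Proof.
move=> mA Aoo; apply/integrableP; split.
  by apply/measurable_EFinP; exact: measurable_indic.
rewrite (_ : (fun x => _) = EFin \o \1_A).
  by rewrite integral_indic// setIT.
by apply/funext => x /=; rewrite ger0_norm.
Qed.

Lemma itg_meas f : itg f -> measurable_fun setT f.
Proof. by move=> /measurable_int/measurable_EFinP. Qed.

Lemma itgD f g : itg f -> itg g -> itg (fun x => f x + g x).
Proof. by move=> hf hg; have := integrableD measurableT hf hg. Qed.

Lemma itgB f g : itg f -> itg g -> itg (fun x => f x - g x).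
Proof. by move=> hf hg; have := integrableB measurableT hf hg. Qed.

Lemma itgZ (k : R) f : itg f -> itg (fun x => k * f x).
Proof. by move=> hf; have := integrableZl measurableT k hf. Qed.

Lemma itg_abs f : itg f -> itg (fun x => `|f x|).
Proof. by move=> hf; have := integrable_norm hf. Qed.

Lemma RI_D f g : itg f -> itg g ->
  \int[m]_x (f x + g x) = \int[m]_x f x + \int[m]_x g x.
Proof. by move=> *; rewrite RintegralD. Qed.

Lemma RI_B f g : itg f -> itg g ->
  \int[m]_x (f x - g x) = \int[m]_x f x - \int[m]_x g x.
Proof. by move=> *; rewrite RintegralB. Qed.

Lemma RI_Z (k : R) f : itg f -> \int[m]_x (k * f x) = k * \int[m]_x f x.
Proof. by move=> *; rewrite RintegralZl. Qed.

Lemma RI_le f g : itg f -> itg g -> (forall x, f x <= g x) ->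
  \int[m]_x f x <= \int[m]_x g x.
Proof. by move=> *; apply: le_Rintegral => //. Qed.

Lemma RI_abs f g : itg f -> itg g -> (forall x, `|f x| <= g x) ->
  `|\int[m]_x f x| <= \int[m]_x g x.
Proof.
move=> hf hg fg; apply: (le_trans (le_normr_Rintegral measurableT hf)).
exact: RI_le (itg_abs hf) hg fg.
Qed.

Lemma RI_EFin f : itg f -> (\int[m]_x (f x)%:E)%E = (\int[m]_x f x)%:E.
Proof. by move=> hf; rewrite /Rintegral fineK//; exact: integrable_fin_num. Qed.

Lemma RI_cvg (f_ : nat -> T -> R) f g : (forall n, measurable_fun setT (f_ n)) ->
  itg g -> (forall n x, `|f_ n x| <= g x) ->
  (forall x, f_ ^~ x @ \oo --> f x) ->
  itg f /\ (\int[m]_x f_ n x) @[n --> \oo] --> \int[m]_x f x.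
Proof.
move=> mf ig fg cf.
have mlim : measurable_fun setT f by exact: (measurable_fun_cvg mf (fun x _ => cf x)).
have mE (h : T -> R) : measurable_fun setT h -> measurable_fun setT (EFin \o h) by move=> ?; exact/measurable_EFinP.
have h := @dominated_convergence _ T R m setT measurableT (fun n => EFin \o f_ n) (EFin \o f) (EFin \o g).
have [|||||h1 _ h3] := h; first by move=> n; exact: mE.
- exact: mE.
- by apply: aeW => x _; apply: cvg_EFin; [exact: nearW|exact: cf].
- exact: ig.
- by apply: aeW => x n _; rewrite /= lee_fin.
split=> //.
apply: (fine_cvg (f := fun n => (\int[m]_x (f_ n x)%:E)%E)).
by rewrite -(RI_EFin h1); exact: h3.
Qed.
End RealIntegral.

(** * Lebesgue measure of the plane, measurability and Fubini's theorem *)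

Section PlaneMeasure.
Context {R : realType}.
Local Notation mu := (@lebesgue_measure R).
Local Notation mu2 := (@plane_measure R).
Local Notation plane := (measurableTypeR R * measurableTypeR R)%type.

HB.instance Definition _ := Measure.copy mu2 (mu \x mu)%E.

Lemma lebesgue_itvcc (a b : R) : a <= b -> mu `[a, b]%classic = (b - a)%:E.
Proof.
rewrite le_eqVlt => /predU1P[->|ab]; rewrite lebesgue_measure_itv/= lte_fin.
  by rewrite ltxx subrr.
by rewrite ab -EFinB.
Qed.

Lemma plane_box (a b c d : R) : a <= b -> c <= d ->
  mu2 (`[a, b] `*` `[c, d]) = ((b - a) * (d - c))%:E.
Proof.
move=> ab cdiff; rewrite /plane_measure product_measure1E//.
by rewrite EFinM; congr (_ * _)%E; exact: lebesgue_itvcc.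
Qed.

Let box (n : nat) : set (R * R) := `[- n%:R, n%:R] `*` `[- n%:R, n%:R].

Let boxP (p : R * R) n : `|p| <= n%:R -> box n p.
Proof.
by rewrite prod_normE/= ge_max /box/= !in_itv/= -!ler_norml => /andP[].
Qed.

Let mbox n : measurable (box n : set plane).
Proof. exact: measurableX. Qed.

Let mu_box n : (mu2 (box n) < +oo)%E.
Proof. by rewrite /box plane_box ?ltry// -subr_ge0 opprK addr_ge0. Qed.

Lemma plane_sigma_finite : sigma_finite setT mu2.
Proof.
exists box; last by move=> n; split; [exact: mbox|exact: mu_box].
apply/seteqP; split=> // p _.
exists (Num.Def.archi_bound `|(p : R * R)|) => //; apply: boxP.
by apply/ltW/archi_boundP.
Qed.

HB.instance Definition _ := Measure_isSigmaFinite.Build _ _ _ mu2 plane_sigma_finite.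

(** Balls of the plane are balls of the maximum norm, hence products of intervals, and an open set
    is the countable union of those with rational centre and radius 1/(n+1) that it contains.
    Indices whose ball sticks out of [U] contribute the empty set, so that the union can run over
    the whole countable index type. *)
Lemma open_measurable2 (U : set (R * R)) : open U -> measurable U.
Proof.
move=> oU.
pose V (t : rat * rat * nat) : set (R * R) := ball (ratr t.1.1 : R, ratr t.1.2 : R) (t.2.+1%:R^-1).
pose W t := if `[< V t `<=` U >] then V t else set0.
have -> : U = \bigcup_t W t.
  apply/seteqP; split=> [p Up|p [t _]]; last first.
    by rewrite /W; case: asboolP => // tU /tU.
  have /nbhs_ballP[e /= e0 eU] : nbhs p U by exact: open_nbhs_nbhs.
  have e2 : 0 < e / 2 by rewrite divr_gt0.
  have [n _ /(_ n (leqnn n)) /= ne] := near_infty_natSinv_lt (PosNum e2).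
  have n0 : 0 < n.+1%:R^-1 :> R by rewrite invr_gt0.
  have near_rat (x : R) : exists a : rat, `|x - ratr a| < n.+1%:R^-1.
    have xn : x < x + n.+1%:R^-1 by rewrite ltrDl.
    have [a] := rat_in_itvoo xn.
    rewrite in_itv/= => /andP[xa ax]; exists a.
    rewrite ltr_norml; move: xa ax n0; move: (n.+1%:R^-1 : R) (ratr a : R) => c q *.
    by apply/andP; split; lra.
  have [a aP] := near_rat p.1; have [b bP] := near_rat p.2.
  have Vp : V (a, b, n) p by split; rewrite /ball/= distrC.
  exists (a, b, n) => //; rewrite /W; case: asboolP => // -[] q [/= q1 q2].
  apply: eU; split; rewrite /ball/=.
    have -> : p.1 - q.1 = (p.1 - ratr a) + (ratr a - q.1) by ring.
    by apply: (le_lt_trans (ler_normD _ _)); rewrite (splitr e) ltrD//; [exact: lt_trans aP _|exact: lt_trans q1 _].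
  have -> : p.2 - q.2 = (p.2 - ratr b) + (ratr b - q.2) by ring.
  by apply: (le_lt_trans (ler_normD _ _)); rewrite (splitr e) ltrD//; [exact: lt_trans bP _|exact: lt_trans q2 _].
apply: countable_bigcupT_measurable; first exact: countableP.
move=> t; rewrite /W; case: asboolP => // _.
have -> : V t = ball (ratr t.1.1 : R) (t.2.+1%:R^-1) `*` ball (ratr t.1.2 : R) (t.2.+1%:R^-1) by [].
by apply: measurableX; exact: measurable_ball.
Qed.

Definition mf2 (f : R * R -> R) := measurable_fun (T := plane) setT f.
Definition itg2 (f : R * R -> R) : Prop := mu2.-integrable setT (EFin \o f).
Definition I2 (f : R * R -> R) : R := \int[mu2]_p f p.

Lemma mf2_cont f : continuous f -> mf2 f.
Proof.
move=> cf; apply: (measurability _ (RGenOpens.measurableE R)) => _ [_ [a [b ->]] <-].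
rewrite setTI; apply: open_measurable2; apply: open_comp => //; exact: interval_open.
Qed.

Lemma mf2_indic (A : set (R * R)) : open A -> mf2 (\1_A).
Proof. by move=> /open_measurable2 mA; apply: measurable_indic. Qed.

Lemma mf2D f g : mf2 f -> mf2 g -> mf2 (fun p => f p + g p).
Proof. exact: measurable_funD. Qed.
Lemma mf2M f g : mf2 f -> mf2 g -> mf2 (fun p => f p * g p).
Proof. exact: measurable_funM. Qed.
Lemma mf2_cst (c : R) : mf2 (fun=> c). Proof. exact: measurable_cst. Qed.
Lemma mf2Z k f : mf2 f -> mf2 (fun p => k * f p).
Proof. exact: mf2M (mf2_cst k). Qed.

Lemma itg2_mf f : itg2 f -> mf2 f. Proof. exact: itg_meas. Qed.
Lemma itg2_dom f g : mf2 f -> itg2 g -> (forall p, `|f p| <= g p) -> itg2 f.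
Proof. exact: itg_dom. Qed.
Lemma itg2D f g : itg2 f -> itg2 g -> itg2 (fun p => f p + g p).
Proof. exact: itgD. Qed.
Lemma itg2B f g : itg2 f -> itg2 g -> itg2 (fun p => f p - g p).
Proof. exact: itgB. Qed.
Lemma itg2Z k f : itg2 f -> itg2 (fun p => k * f p).
Proof. exact: itgZ. Qed.
Lemma itg2_abs f : itg2 f -> itg2 (fun p => `|f p|).
Proof. exact: itg_abs. Qed.
Lemma itg2_ext f g : (forall p, f p = g p) -> itg2 f -> itg2 g.
Proof. by move=> /funext ->. Qed.
Lemma I2D f g : itg2 f -> itg2 g -> I2 (fun p => f p + g p) = I2 f + I2 g.
Proof. exact: RI_D. Qed.
Lemma I2B f g : itg2 f -> itg2 g -> I2 (fun p => f p - g p) = I2 f - I2 g.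
Proof. exact: RI_B. Qed.
Lemma I2Z k f : itg2 f -> I2 (fun p => k * f p) = k * I2 f.
Proof. exact: RI_Z. Qed.
Lemma I2_ext f g : (forall p, f p = g p) -> I2 f = I2 g.
Proof. by move=> /funext ->. Qed.
Lemma I2_le f g : itg2 f -> itg2 g -> (forall p, f p <= g p) -> I2 f <= I2 g.
Proof. exact: RI_le. Qed.
Lemma I2_abs f g : itg2 f -> itg2 g -> (forall p, `|f p| <= g p) -> `|I2 f| <= I2 g.
Proof. exact: RI_abs. Qed.
Lemma I2_ge0 f : (forall p, 0 <= f p) -> 0 <= I2 f.
Proof. by move=> f0; apply: Rintegral_ge0. Qed.

Lemma I2_cvg (f_ : nat -> R * R -> R) f g : (forall n, mf2 (f_ n)) ->
  itg2 g -> (forall n p, `|f_ n p| <= g p) ->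
  (forall p, f_ ^~ p @ \oo --> f p) ->
  itg2 f /\ I2 (f_ n) @[n --> \oo] --> I2 f.
Proof. exact: RI_cvg. Qed.

(** One constant [M] bounds both the values and the support, so that domination by a multiple of the
    indicator of a box is a single comparison. The same convention returns for kernels and in
    [bdd_supp]. *)
Lemma itg2_bdd f M : mf2 f -> (forall p, `|f p| <= M) ->
  (forall p, M < `|p| -> f p = 0) -> itg2 f.
Proof.
move=> mf fM f0.
pose N := Num.Def.archi_bound M.
have M0 : 0 <= M by exact: le_trans (fM 0).
have MN : M < N%:R by exact: archi_boundP.
have : itg2 (fun p => M * \1_(box N) p).
  by apply: itg2Z; apply: itg_indic; [exact: mbox|exact: mu_box].
move=> h; apply: itg2_dom h _ => // p; rewrite indicE.
have [/boxP pN|pN] := leP `|p| N%:R; first by rewrite mem_set// mulr1.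
by rewrite f0 ?normr0 ?mulr_ge0//; exact: lt_trans MN pN.
Qed.

Lemma I2_iter1 f h : itg2 f ->
  (forall x, (\int[mu]_y (f (x, y))%:E)%E = (h x)%:E) -> I2 f = \int[mu]_x h x.
Proof.
move=> itf fh; rewrite /I2 /Rintegral.
have := integral12_prod_meas1 (m1 := mu) (m2 := mu) itf.
rewrite -[X in _ = X -> _]/(\int[mu2]_p (f p)%:E)%E => <-.
by congr fine; apply: eq_integral => x _; rewrite /fubini_F -fh.
Qed.

Lemma I2_iter2 f h : itg2 f ->
  (forall y, (\int[mu]_x (f (x, y))%:E)%E = (h y)%:E) -> I2 f = \int[mu]_y h y.
Proof.
move=> itf fh; rewrite /I2 /Rintegral.
have := integral21_prod_meas1 (m1 := mu) (m2 := mu) itf.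
rewrite -[X in _ = X -> _]/(\int[mu2]_p (f p)%:E)%E => <-.
by congr fine; apply: eq_integral => x _; rewrite /fubini_G -fh.
Qed.

Definition mf4 (k : R * R -> R * R -> R) :=
  measurable_fun (T := (plane * plane)%type) setT (fun z => k z.1 z.2).

Lemma mf4_diff f : mf2 f -> mf4 (fun x y => f (x.1 - y.1, x.2 - y.2)).
Proof.
move=> mf; rewrite /mf4.
apply: (measurableT_comp (f := f) (g := fun z : plane * plane => (z.1.1 - z.2.1, z.1.2 - z.2.2) : plane)) => //.
apply/measurable_fun_pairP; split; apply: measurable_funB.
- exact: (measurableT_comp measurable_fst measurable_fst).
- exact: (measurableT_comp measurable_fst measurable_snd).
- exact: (measurableT_comp measurable_snd measurable_fst).
- exact: (measurableT_comp measurable_snd measurable_snd).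
Qed.
Lemma mf4_1 f : mf2 f -> mf4 (fun x y => f x).
Proof. by move=> mf; apply: (measurableT_comp mf); exact: measurable_fst. Qed.
Lemma mf4_2 f : mf2 f -> mf4 (fun x y => f y).
Proof. by move=> mf; apply: (measurableT_comp mf); exact: measurable_snd. Qed.
Lemma mf4M f g : mf4 f -> mf4 g -> mf4 (fun x y => f x y * g x y).
Proof. exact: measurable_funM. Qed.
Lemma mf4D f g : mf4 f -> mf4 g -> mf4 (fun x y => f x y + g x y).
Proof. exact: measurable_funD. Qed.

Lemma mf4_slice1 k x : mf4 k -> mf2 (k x).
Proof. by move=> mk; have := measurableT_comp mk (measurable_pair1 (x : plane)). Qed.
Lemma mf4_slice2 k y : mf4 k -> mf2 (k ^~ y).
Proof. by move=> mk; have := measurableT_comp mk (measurable_pair2 (y : plane)). Qed.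

Lemma kernel_itg k M : mf4 k -> (forall x y, `|k x y| <= M) ->
  (forall x y, M < `|x| \/ M < `|y| -> k x y = 0) ->
  (mu2 \x mu2)%E.-integrable setT (fun z => (k z.1 z.2)%:E).
Proof.
move=> mk kM k0.
pose N := Num.Def.archi_bound M.
have M0 : 0 <= M by exact: le_trans (kM 0 0).
have MN : M < N%:R by exact: archi_boundP.
have h : (mu2 \x mu2)%E.-integrable setT (EFin \o (fun z => M * \1_(box N `*` box N) z : R)).
  apply: itgZ; apply: itg_indic.
    by apply: measurableX; exact: mbox.
  rewrite -[X in (X < _)%E]/((mu2 \x mu2)%E (box N `*` box N)).
  rewrite (product_measure1E mu2 mu2 (mbox N) (mbox N)).
  apply: lte_mul_pinfty => //; last exact: mu_box.
  by rewrite ge0_fin_numE//; exact: mu_box.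
apply: (@itg_dom _ (plane * plane)%type R _ (fun z => k z.1 z.2) _ mk h) => z; rewrite indicE.
have [/boxP pN|pN] := leP `|z.1| N%:R; last first.
  by rewrite k0 ?normr0 ?mulr_ge0//; left; exact: lt_trans MN pN.
have [/boxP qN|qN] := leP `|z.2| N%:R; last first.
  by rewrite k0 ?normr0 ?mulr_ge0//; right; exact: lt_trans MN qN.
by rewrite mem_set ?mulr1.
Qed.

Lemma kernel_slice1 k M x : mf4 k -> (forall x y, `|k x y| <= M) ->
  (forall x y, M < `|x| \/ M < `|y| -> k x y = 0) -> itg2 (k x).
Proof.
by move=> mk kM k0; apply: (itg2_bdd (M := M)) => [||p pM]; [exact: mf4_slice1|exact: kM|apply: k0; right].
Qed.

Lemma kernel_slice2 k M y : mf4 k -> (forall x y, `|k x y| <= M) ->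
  (forall x y, M < `|x| \/ M < `|y| -> k x y = 0) -> itg2 (k ^~ y).
Proof.
by move=> mk kM k0; apply: (itg2_bdd (M := M)) => [||p pM]; [exact: mf4_slice2|move=> p; exact: kM|apply: k0; left].
Qed.

Lemma kernel_itg1 k M : mf4 k -> (forall x y, `|k x y| <= M) ->
  (forall x y, M < `|x| \/ M < `|y| -> k x y = 0) -> itg2 (fun x => I2 (k x)).
Proof.
move=> mk kM k0; have := integrable_fubini_F (m1 := mu2) (m2 := mu2) (kernel_itg mk kM k0).
apply: eq_integrable => // x _; rewrite /fubini_F /=.
by rewrite -RI_EFin//; exact: kernel_slice1 mk kM k0.
Qed.

(** Only bounded kernels of bounded support are ever exchanged, so Fubini never meets a
    singularity. *)
Lemma I2_swap k M : mf4 k -> (forall x y, `|k x y| <= M) ->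
  (forall x y, M < `|x| \/ M < `|y| -> k x y = 0) ->
  I2 (fun x => I2 (k x)) = I2 (fun y => I2 (k ^~ y)).
Proof.
move=> mk kM k0; have := Fubini (m1 := mu2) (m2 := mu2) (kernel_itg mk kM k0).
move=> /(congr1 fine) h.
rewrite /I2 {1 3}/Rintegral.
transitivity (fine (\int[mu2]_x \int[mu2]_y (k x y)%:E)%E).
  by congr fine; apply: eq_integral => x _; rewrite (RI_EFin (kernel_slice1 x mk kM k0)).
rewrite -[LHS]/(fine _) h.
by congr fine; apply: eq_integral => x _; rewrite (RI_EFin (kernel_slice2 x mk kM k0)).
Qed.

End PlaneMeasure.

(** * The fundamental theorem of calculus on the line and on open sets *)

Section Line.
Context {R : realType}.
Local Notation mu := (@lebesgue_measure R).

(** The theorem for a half-line is applied twice: to [f] on [0, +oo[ and, after the substitution x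
    -> -x, to the primitive x -> -F(-x) for the other half. *)
Lemma ge0_FTC_line (f F : R -> R) (l l' : R) : (forall x, 0 <= f x) -> continuous f ->
  (forall x : R, is_derive x 1 F (f x)) ->
  F x @[x --> +oo] --> l -> F x @[x --> -oo] --> l' ->
  (\int[mu]_x (f x)%:E)%E = (l - l')%:E.
Proof.
move=> f0 cf dF Fl Fl'.
have cF : continuous F.
  by move=> x; apply/differentiable_continuous/derivable1_diffP; have [] := dF x.
have mf : measurable_fun [set: R] f by exact: measurable_realfun.continuous_measurable_fun.
have posint : (\int[mu]_(x in `[0%R, +oo[) (f x)%:E = (l - F 0)%:E)%E.
  rewrite (ge0_continuous_FTC2y (F := F) (l := l)) ?EFinB//.
  - exact: continuous_subspaceT.
  - exact: cvg_at_right_filter (cF 0).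
  - by move=> x _; rewrite derive1E; exact: derive_val.
have dG (x : R) : is_derive x 1 (fun x => - F (- x)) (f (- x)).
  have := is_deriveN (is_derive1_comp (dF (- x)) (is_deriveN (is_derive_id x (1 : R)))).
  by move=> /is_derive_eq; apply; rewrite mulrN1 opprK.
have negint : (\int[mu]_(x in `]-oo, 0%R]) (f x)%:E = (F 0 - l')%:E)%E.
  rewrite -[X in `]-oo, X]]oppr0 ge0_integration_by_substitutionNy; last 2 first.
  - exact: continuous_subspaceT.
  - by move=> x _.
  rewrite (ge0_continuous_FTC2y (F := fun x => - F (- x)) (l := - l')).
  - by rewrite oppr0 -EFinB opprK addrC.
  - by move=> x _; exact: f0.
  - apply: continuous_subspaceT => x; apply: continuous_comp; [exact: oppr_continuous|exact: cf].
  - by apply: cvgN; apply/cvgNy_compNP.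
  - by move=> x _; have [] := dG x.
  - apply: cvg_at_right_filter; apply: cvgN; apply: (continuous_comp (f := -%R)); [exact: oppr_continuous|exact: cF].
  - by move=> x _; rewrite derive1E; have [] := dG x.
rewrite -(setUv `]-oo, 0%R]%classic) integral_setU//; last 3 first.
- exact: measurableC.
- by rewrite setUv; exact/measurable_EFinP.
- by apply/disj_setPS => x [].
rewrite setCitvl integral_itv_obnd_cbnd; last by apply/measurable_EFinP; exact: measurable_funTS.
by rewrite posint negint -EFinD; congr EFin; lra.
Qed.

(* Each component ]a, b[ of O contributes g b - g a = 0. *)
Lemma open_FTC (O : set R) (g g' : R -> R) : open O -> bounded_set O ->
  (forall x : R, is_derive x 1 g (g' x)) -> continuous g' ->
  (forall x, closure O x -> ~ O x -> g x = 0) ->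
  (\int[mu]_(x in O) (g' x)%:E = 0)%E.
Proof.
move=> oO [M [Mr bO]] dg cg' g0.
have {}bO x : O x -> `|x| <= M + 1 by apply: bO; rewrite ltrDl.
have mg' : measurable_fun [set: R] g' by exact: measurable_realfun.continuous_measurable_fun.
have cg : continuous g.
  by move=> x; apply/differentiable_continuous/derivable1_diffP; have [] := dg x.
have int : mu.-integrable `[- (M + 1), M + 1] (EFin \o g').
  apply: continuous_compact_integrable; first exact: segment_compact.
  exact: continuous_subspaceT.
have intO : mu.-integrable O (EFin \o g').
  apply: integrableS int => //; first exact: open_measurable.
  by move=> x /bO; rewrite /= in_itv/= ler_norml.
rewrite (open_disjoint_itv_bigcup oO) integral_bigcup; last 3 first.
- exact: open_disjoint_itv_trivIset.
- by move=> k; apply: open_measurable; exact: open_disjoint_itv_open.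
- by rewrite -open_disjoint_itv_bigcup.
apply: eseries0 => i _ _.
set I := open_disjoint_itv oO i.
have IO : I `<=` O.
  by move=> x Ix; rewrite (open_disjoint_itv_bigcup oO); exists i.
have oI : open I by exact: open_disjoint_itv_open.
have iI : is_interval I by exact: open_disjoint_itv_is_interval.
have [->|I0] := eqVneq I set0; first by rewrite integral_set0.
have lI : has_lbound I by exists (- (M + 1)) => x /IO/bO; rewrite ler_norml => /andP[].
have uI : has_ubound I by exists (M + 1) => x /IO/bO; rewrite ler_norml => /andP[].
have IE : I = `](inf I), (sup I)[%classic.
  rewrite set_itvoo -(interval_bounded_interior iI lI uI).
  exact/esym/interior_id.
set a := inf I in IE *; set b := sup I in IE *.
have ab : a < b.
  move/set0P : I0 => [x]; rewrite IE /= in_itv/= => /andP[]; exact: lt_trans.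
(* An endpoint of a component lies in no other component, since these are open and disjoint; so it
   lies outside [O], where [g] vanishes. *)
have endpt c : closure I c -> ~ I c -> g c = 0.
  move=> cI nI; apply: g0; first exact: closure_subset cI.
  rewrite (open_disjoint_itv_bigcup oO) => -[j _ Ijc].
  have [y [Iy Jy]] := cI _ (open_nbhs_nbhs (conj (open_disjoint_itv_open (i := j)) Ijc)).
  have ij : i = j by apply: (open_disjoint_itv_trivIset (oU := oO)) => //; exists y.
  by apply: nI; rewrite /I ij.
have ga : g a = 0.
  apply: endpt; last by rewrite IE /= in_itv/= ltxx.
  rewrite IE => B /nbhs_ballP[e /= e0 eB].
  pose m := Num.min (e / 2) ((b - a) / 2).
  have m0 : 0 < m by rewrite lt_min !divr_gt0// subr_gt0.
  have [me mb] : m <= e / 2 /\ m <= (b - a) / 2 by rewrite /m !ge_min !lexx orbT.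
  exists (a + m); split; first by rewrite /= in_itv/=; apply/andP; split; lra.
  by apply: eB; rewrite /ball/= opprD addrA subrr sub0r normrN gtr0_norm//; lra.
have gb : g b = 0.
  apply: endpt; last by rewrite IE /= in_itv/= ltxx andbF.
  rewrite IE => B /nbhs_ballP[e /= e0 eB].
  pose m := Num.min (e / 2) ((b - a) / 2).
  have m0 : 0 < m by rewrite lt_min !divr_gt0// subr_gt0.
  have [me mb] : m <= e / 2 /\ m <= (b - a) / 2 by rewrite /m !ge_min !lexx orbT.
  exists (b - m); split; first by rewrite /= in_itv/=; apply/andP; split; lra.
  by apply: eB; rewrite /ball/= opprB addrC subrK gtr0_norm//; lra.
have mI B : measurable_fun B (EFin \o g') by apply/measurable_EFinP; exact: measurable_funTS.
rewrite IE integral_itv_bndo_bndc// integral_itv_obnd_cbnd//.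
rewrite (continuous_FTC2 (F := g))//.
- by rewrite ga gb subee.
- exact: continuous_subspaceT.
- split.
  + by move=> x _; have [] := dg x.
  + exact: cvg_at_right_filter (cg a).
  + exact: cvg_at_left_filter (cg b).
- by move=> x _; rewrite derive1E; have [] := dg x.
Qed.

End Line.

(** * Partial derivatives, C^k functions and integration by parts in the plane *)

Section PlaneCalc.
Context {R : realType}.
Local Notation mu := (@lebesgue_measure R).
Local Notation mu2 := (@plane_measure R).

(** Reduction to one variable: it yields the chain rule [is_derive_comp1] from the chain rule on the
    line, without differentials. *)
Lemma is_derive_line (V : normedModType R) (g : V -> R) (p v : V) (d : R) :
  is_derive p v g d <-> is_derive (0 : R) (1 : R) (fun t : R => g (t *: v + p)) d.
Proof.
have E : (fun h : R => h^-1 *: (g (h *: v + p) - g p)) =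
         (fun h : R => h^-1 *: (g ((h *: (1 : R) + 0) *: v + p) - g (0 *: v + p))).
  by apply/funext => h; rewrite scale0r add0r /GRing.scale/= mulr1 addr0.
split=> -[dg dE]; split; move: dg dE; rewrite /derivable /derive /= /shift/=;
  by rewrite /comp/= E.
Qed.

Lemma is_derive_comp1 (V : normedModType R) (F : R -> R) (h : V -> R) p v d F' :
  is_derive (h p) (1 : R) F F' -> is_derive p v h d -> is_derive p v (fun x => F (h x)) (F' * d).
Proof.
move=> dF /is_derive_line dh; apply/is_derive_line.
apply: (is_derive1_comp (f := F) (g := fun t => h (t *: v + p))) => //.
by rewrite scale0r add0r.
Qed.

Lemma is_dx_slice (g : R * R -> R) x y d :
  is_derive (x, y) ((1, 0) : R * R) g d <-> is_derive x (1 : R) (fun t => g (t, y)) d.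
Proof.
have E : (fun h : R => h^-1 *: (g (h *: ((1, 0) : R * R) + (x, y)) - g (x, y))) =
         (fun h : R => h^-1 *: (g (h *: (1 : R) + x, y) - g (x, y))).
  apply/funext => h; congr (_ *: (g _ - _)).
  by apply: injective_projections; rewrite /= ?scaler0 ?add0r.
by split=> -[dg dE]; split; move: dg dE; rewrite /derivable /derive /= /shift/= /comp/= E.
Qed.

Lemma is_dy_slice (g : R * R -> R) x y d :
  is_derive (x, y) ((0, 1) : R * R) g d <-> is_derive y (1 : R) (fun t => g (x, t)) d.
Proof.
have E : (fun h : R => h^-1 *: (g (h *: ((0, 1) : R * R) + (x, y)) - g (x, y))) =
         (fun h : R => h^-1 *: (g (x, h *: (1 : R) + y) - g (x, y))).
  apply/funext => h; congr (_ *: (g _ - _)).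
  by apply: injective_projections; rewrite /= ?scaler0 ?add0r.
by split=> -[dg dE]; split; move: dg dE; rewrite /derivable /derive /= /shift/= /comp/= E.
Qed.

Implicit Types (f g h : R * R -> R) (D : set (R * R)) (p : R * R).

Definition is_dx (g : R * R -> R) p d := is_derive p ((1, 0) : R * R) g d.
Definition is_dy (g : R * R -> R) p d := is_derive p ((0, 1) : R * R) g d.

Lemma dx_eq g p d : is_dx g p d -> dx g p = d. Proof. by case. Qed.
Lemma dy_eq g p d : is_dy g p d -> dy g p = d. Proof. by case. Qed.

Lemma is_dx_fst p : is_dx (fun q => q.1) p 1.
Proof. by case: p => x y; apply/is_dx_slice; exact: is_derive_id. Qed.
Lemma is_dx_snd p : is_dx (fun q => q.2) p 0.
Proof. by case: p => x y; apply/is_dx_slice; exact: is_derive_cst. Qed.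
Lemma is_dy_fst p : is_dy (fun q => q.1) p 0.
Proof. by case: p => x y; apply/is_dy_slice; exact: is_derive_cst. Qed.
Lemma is_dy_snd p : is_dy (fun q => q.2) p 1.
Proof. by case: p => x y; apply/is_dy_slice; exact: is_derive_id. Qed.
Lemma is_dx_cst c p : is_dx (fun=> c) p 0. Proof. exact: is_derive_cst. Qed.
Lemma is_dy_cst c p : is_dy (fun=> c) p 0. Proof. exact: is_derive_cst. Qed.
Lemma is_dxD f g p a b : is_dx f p a -> is_dx g p b -> is_dx (fun q => f q + g q) p (a + b).
Proof. exact: is_deriveD. Qed.
Lemma is_dyD f g p a b : is_dy f p a -> is_dy g p b -> is_dy (fun q => f q + g q) p (a + b).
Proof. exact: is_deriveD. Qed.
Lemma is_dxM f g p a b : is_dx f p a -> is_dx g p b ->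
  is_dx (fun q => f q * g q) p (a * g p + f p * b).
Proof. by move=> hf hg; apply: (is_derive_eq (is_deriveM hf hg)); rewrite /GRing.scale/= addrC mulrC (mulrC a). Qed.
Lemma is_dyM f g p a b : is_dy f p a -> is_dy g p b ->
  is_dy (fun q => f q * g q) p (a * g p + f p * b).
Proof. by move=> hf hg; apply: (is_derive_eq (is_deriveM hf hg)); rewrite /GRing.scale/= addrC mulrC (mulrC a). Qed.

Lemma Ck1_isdx g p : Ck 1 g -> is_dx g p (dx g p).
Proof. by move=> [_ /(_ p)[h _] _ _]; exact: derivableP. Qed.
Lemma Ck1_isdy g p : Ck 1 g -> is_dy g p (dy g p).
Proof. by move=> [_ /(_ p)[_ h] _ _]; exact: derivableP. Qed.

Lemma Ck_cont n g : Ck n g -> continuous g.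
Proof. by case: n => // n []. Qed.

Lemma Ck_intro n (g gx gy : R * R -> R) : continuous g ->
  (forall p, is_dx g p (gx p)) -> (forall p, is_dy g p (gy p)) ->
  Ck n gx -> Ck n gy -> Ck n.+1 g.
Proof.
move=> cg hx hy cx cy; split => //.
- by move=> p; split; [case: (hx p) => hd _; exact: hd|case: (hy p) => hd _; exact: hd].
- by rewrite (_ : dx g = gx)//; apply/funext => p; exact: dx_eq.
- by rewrite (_ : dy g = gy)//; apply/funext => p; exact: dy_eq.
Qed.

Lemma CkS n g : Ck n.+1 g -> Ck n g.
Proof.
elim: n g => [|n IH] g; first by case.
by case=> cg dg cx cy; refine (And4 cg dg (IH _ cx) (IH _ cy)).
Qed.

Lemma CkD n f g : Ck n f -> Ck n g -> Ck n (fun p => f p + g p).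
Proof.
elim: n f g => [|n IH] f g hf hg; first by move=> p; apply: cvgD; [exact: hf|exact: hg].
have c1 h : Ck n.+1 h -> Ck 1 h by elim: n h {IH hf hg} => // n IH h /CkS/IH.
apply: (@Ck_intro _ _ (fun p => dx f p + dx g p) (fun p => dy f p + dy g p)).
- by move=> p; apply: cvgD; [exact: (Ck_cont hf)|exact: (Ck_cont hg)].
- by move=> p; apply: is_dxD; exact: Ck1_isdx (c1 _ _).
- by move=> p; apply: is_dyD; exact: Ck1_isdy (c1 _ _).
- by case: hf hg => ? ? ? ? [? ? ? ?]; exact: IH.
- by case: hf hg => ? ? ? ? [? ? ? ?]; exact: IH.
Qed.

Lemma CkSn1 n h : Ck n.+1 h -> Ck 1 h.
Proof. by elim: n h => // n IH h /CkS/IH. Qed.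

Lemma CkM n f g : Ck n f -> Ck n g -> Ck n (fun p => f p * g p).
Proof.
elim: n f g => [|n IH] f g hf hg; first by move=> p; apply: cvgM; [exact: hf|exact: hg].
apply: (@Ck_intro _ _ (fun p => dx f p * g p + f p * dx g p)
   (fun p => dy f p * g p + f p * dy g p)).
- by move=> p; apply: cvgM; [exact: (Ck_cont hf)|exact: (Ck_cont hg)].
- by move=> p; apply: is_dxM; [exact: Ck1_isdx (CkSn1 hf)|exact: Ck1_isdx (CkSn1 hg)].
- by move=> p; apply: is_dyM; [exact: Ck1_isdy (CkSn1 hf)|exact: Ck1_isdy (CkSn1 hg)].
- have [_ _ ? _] := hf; have [_ _ ? _] := hg.
  by apply: CkD; apply: IH => //; exact: CkS.
- have [_ _ _ ?] := hf; have [_ _ _ ?] := hg.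
  by apply: CkD; apply: IH => //; exact: CkS.
Qed.

Lemma Ck_cst n (c : R) : Ck n (fun=> c).
Proof.
elim: n c => [|n IH] c; first by move=> p; exact: cvg_cst.
apply: (@Ck_intro _ _ (fun=> 0) (fun=> 0)) => //.
- by move=> p; exact: cvg_cst.
- by move=> p; exact: is_dx_cst.
- by move=> p; exact: is_dy_cst.
Qed.

Lemma Ck_fst n : Ck n (fun p : R * R => p.1).
Proof.
case: n => [|n]; first by move=> p; exact: cvg_fst.
apply: (@Ck_intro _ _ (fun=> 1) (fun=> 0)); [by move=> p; exact: cvg_fst|exact: is_dx_fst|exact: is_dy_fst|exact: Ck_cst|exact: Ck_cst].
Qed.

Lemma Ck_snd n : Ck n (fun p : R * R => p.2).
Proof.
case: n => [|n]; first by move=> p; exact: cvg_snd.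
apply: (@Ck_intro _ _ (fun=> 0) (fun=> 1)); [by move=> p; exact: cvg_snd|exact: is_dx_snd|exact: is_dy_snd|exact: Ck_cst|exact: Ck_cst].
Qed.

(** [F k] is meant as the k-th derivative of [F 0]. Quantifying over the whole sequence keeps the
    induction closed, since a derivative of [F k (h p)] brings in [F k.+1]. The predicate [P] is a
    domain that the values of [h] never leave, such as the nonzero reals. *)
Lemma Ck_comp n k (F : nat -> R -> R) (P : R -> Prop) h :
  (forall k t, P t -> is_derive t (1 : R) (F k) (F k.+1 t)) ->
  (forall p, P (h p)) -> Ck n h -> Ck n (fun p => F k (h p)).
Proof.
move=> dF Ph; elim: n k => [|n IH] k hh.
  move=> p; apply: continuous_comp; first exact: hh.
  by apply/differentiable_continuous/derivable1_diffP; have [] := dF k _ (Ph p).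
apply: (@Ck_intro _ _ (fun p => F k.+1 (h p) * dx h p) (fun p => F k.+1 (h p) * dy h p)).
- move=> p; apply: continuous_comp; first exact: (Ck_cont hh).
  by apply/differentiable_continuous/derivable1_diffP; have [] := dF k _ (Ph p).
- by move=> p; apply: is_derive_comp1; [exact: dF|exact: Ck1_isdx (CkSn1 hh)].
- by move=> p; apply: is_derive_comp1; [exact: dF|exact: Ck1_isdy (CkSn1 hh)].
- by have [_ _ ? _] := hh; apply: CkM => //; exact/IH/CkS.
- by have [_ _ _ ?] := hh; apply: CkM => //; exact/IH/CkS.
Qed.

Lemma is_derive_invX k (t : R) : t != 0 ->
  is_derive t (1 : R) (fun t => (t ^+ k)^-1) (- k%:R * (t ^+ k.+1)^-1).
Proof.
move=> t0; have tk : t ^+ k != 0 by rewrite expf_neq0.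
have dX : is_derive t (1 : R) (fun t : R => t ^+ k) (k%:R * t ^+ k.-1).
  have -> : (fun t : R => t ^+ k) = (id : R -> R) ^+ k.
    by apply/funext => z; rewrite exprfctE.
  by apply: (is_derive_eq (is_deriveX k (is_derive_id t (1 : R)))); rewrite /GRing.scale/= mulr1.
have := @is_deriveV R (fun t => t ^+ k) t _ 1 tk dX.
move=> /is_derive_eq; apply; rewrite /GRing.scale/=.
case: k tk {dX} => [|k] tk; first by rewrite !mul0r mulr0 oppr0 mul0r.
rewrite !exprS in tk *; field; rewrite t0 /= andbT.
by move: tk; rewrite mulf_eq0 negb_or => /andP[].
Qed.

Lemma Ck_inv n h : (forall p, h p != 0) -> Ck n h -> Ck n (fun p => (h p)^-1).
Proof.
move=> h0 hh.
(* This is the k-th derivative of 1/t. *)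
pose F (k : nat) (t : R) := (-1) ^+ k * (k`!)%:R * (t ^+ k.+1)^-1.
have dF k t : t != 0 -> is_derive t (1 : R) (F k) (F k.+1 t).
  move=> t0; have := is_deriveZ ((-1) ^+ k * (k`!)%:R : R) (is_derive_invX k.+1 t0).
  move=> /is_derive_eq; apply; rewrite /F factS natrM [(-1) ^+ _.+1]exprS /GRing.scale/=; ring.
have := @Ck_comp n 0 F (fun t => t != 0) h dF h0 hh.
by rewrite (_ : (fun p => F 0 (h p)) = (fun p => (h p)^-1))//; apply/funext => p; rewrite /F expr0 expr1 !mul1r.
Qed.

Lemma continuous_bddP (f : R * R -> R) (N : R) : continuous f ->
  exists2 M, 0 <= M & forall p, `|p| <= N -> `|f p| <= M.
Proof.
move=> cf.
have cK : compact (`[- N, N] `*` `[- N, N] : set (R * R)).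
  by apply: compact_setX; exact: segment_compact.
have /compact_bounded[M [Mr hM]] : compact (f @` (`[- N, N] `*` `[- N, N])).
  by apply: continuous_compact => //; exact: continuous_subspaceT.
exists (`|M| + 1); first by rewrite addr_ge0.
move=> p pN; apply: (hM (`|M| + 1)); first by rewrite (le_lt_trans (ler_norm M))// ltrDl.
exists p => //=; rewrite !in_itv/= -!ler_norml.
by move: pN; rewrite prod_normE/= ge_max => /andP[].
Qed.

Lemma bounded_setP (D : set (R * R)) : bounded_set D -> exists2 N : R, 0 <= N & forall p, D p -> `|p| <= N.
Proof.
move=> [N [Nr hN]]; exists (`|N| + 1); first by rewrite addr_ge0.
by move=> p Dp; apply: (hN (`|N| + 1)) Dp; rewrite (le_lt_trans (ler_norm N))// ltrDl.
Qed.

Lemma itg2_cont_indic D f : open D -> bounded_set D -> continuous f ->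
  itg2 (fun p => f p * \1_D p).
Proof.
move=> oD /bounded_setP[N N0 hN] cf; have [M M0 hM] := continuous_bddP N cf.
apply: (itg2_bdd (M := M + N)).
- by apply: mf2M; [exact: mf2_cont|exact: mf2_indic].
- move=> p; rewrite indicE; have [/set_mem Dp|_] := boolP (p \in D); last by rewrite mulr0 normr0 addr_ge0.
  by rewrite mulr1 (le_trans (hM p (hN p Dp)))// lerDl.
- move=> p Mp; rewrite indicE memNset ?mulr0// => /hN; apply/negP; rewrite -ltNge.
  by rewrite (le_lt_trans _ Mp)// lerDr.
Qed.

Lemma pair_cvg1 (x y : R) : (fun z : R => (z, y)) z @[z --> x] --> (x, y).
Proof.
move=> B /nbhs_ballP[e e0 eB]; apply/nbhs_ballP; exists e => // z xz.
by apply: eB; split => //; exact: ballxx.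
Qed.
Lemma pair_cvg2 (x y : R) : (fun z : R => (x, z)) z @[z --> y] --> (x, y).
Proof.
move=> B /nbhs_ballP[e e0 eB]; apply/nbhs_ballP; exists e => // z xz.
by apply: eB; split => //; exact: ballxx.
Qed.

Lemma slice_open1 (D : set (R * R)) y : open D -> open [set x | D (x, y)].
Proof.
move=> oD; apply: (open_comp (f := fun x : R => (x, y))) => // x _.
exact: pair_cvg1.
Qed.
Lemma slice_open2 (D : set (R * R)) x : open D -> open [set y | D (x, y)].
Proof.
move=> oD; apply: (open_comp (f := fun y : R => (x, y))) => // y _.
exact: pair_cvg2.
Qed.

(** Fubini and [open_FTC] on every horizontal slice. A limit point of a slice outside the slice is a
    limit point of [D] outside [D], so [f] vanishes there whatever the boundary looks like. *)
Lemma div0_dx D f : open D -> bounded_set D -> Ck 1 f ->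
  (forall p, closure D p -> ~ D p -> f p = 0) -> I2 (fun p => dx f p * \1_D p) = 0.
Proof.
move=> oD bD cf f0; have [c0 _ c1 c2] := cf.
rewrite (@I2_iter2 _ _ (fun=> 0)); first by rewrite Rintegral_cst// mul0r.
  exact: itg2_cont_indic.
move=> y; pose O := [set x | D (x, y)].
transitivity (\int[mu]_(x in O) (dx f (x, y))%:E)%E.
  rewrite [RHS]integral_mkcond; apply: eq_integral => x _.
  rewrite /patch indicE (_ : ((x, y) \in D) = (x \in O)).
    by case: ifP; rewrite ?mulr1 ?mulr0.
  by apply/idP/idP => /set_mem ?; apply/mem_set.
apply: (open_FTC (g := fun x => f (x, y))).
- exact: slice_open1.
- have [N N0 hN] := bounded_setP bD.
  exists N; split; first exact: num_real.
  move=> M NM x Ox; apply: le_trans (ltW NM); apply: le_trans (hN _ Ox).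
  by rewrite prod_normE/= le_max lexx.
- by move=> x; apply/is_dx_slice; exact: Ck1_isdx.
- move=> x; apply: (continuous_comp (f := fun x : R => (x, y))); last exact: c1.
  exact: pair_cvg1.
- move=> x clx nOx; apply: f0 => // B nB.
  have /clx[z [Oz Bz]] : nbhs x [set x | B (x, y)].
    exact: (pair_cvg1 (x := x) (y := y)).
  by exists (z, y).
Qed.

Lemma div0_dy D f : open D -> bounded_set D -> Ck 1 f ->
  (forall p, closure D p -> ~ D p -> f p = 0) -> I2 (fun p => dy f p * \1_D p) = 0.
Proof.
move=> oD bD cf f0; have [c0 _ c1 c2] := cf.
rewrite (@I2_iter1 _ _ (fun=> 0)); first by rewrite Rintegral_cst// mul0r.
  exact: itg2_cont_indic.
move=> y; pose O := [set x | D (y, x)].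
transitivity (\int[mu]_(x in O) (dy f (y, x))%:E)%E.
  rewrite [RHS]integral_mkcond; apply: eq_integral => x _.
  rewrite /patch indicE (_ : ((y, x) \in D) = (x \in O)).
    by case: ifP; rewrite ?mulr1 ?mulr0.
  by apply/idP/idP => /set_mem ?; apply/mem_set.
apply: (open_FTC (g := fun x => f (y, x))).
- exact: slice_open2.
- have [N N0 hN] := bounded_setP bD.
  exists N; split; first exact: num_real.
  move=> M NM x Ox; apply: le_trans (ltW NM); apply: le_trans (hN _ Ox).
  by rewrite prod_normE/= le_max lexx orbT.
- by move=> x; apply/is_dy_slice; exact: Ck1_isdy.
- move=> x; apply: (continuous_comp (f := fun x : R => (y, x))); last exact: c2.
  exact: pair_cvg2.
- move=> x clx nOx; apply: f0 => // B nB.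
  have /clx[z [Oz Bz]] : nbhs x [set x | B (y, x)].
    exact: (pair_cvg2 (x := y) (y := x)).
  by exists (y, z).
Qed.

End PlaneCalc.

(** * A rational approximate identity *)

Section Eta.
Context {R : realType}.
Local Notation mu := (@lebesgue_measure R).
Local Notation mu2 := (@plane_measure R).
Implicit Types (f g h : R * R -> R) (p x y : R * R).

Lemma cvgy_atan_affine (a b : R) : 0 < b -> atan ((t - a) / b) @[t --> +oo] --> pi / 2.
Proof.
move=> b0; have h : ((t - a) / b) @[t --> +oo] --> +oo.
  apply/cvgryPge => M; near=> t.
  by rewrite ler_pdivlMr// lerBrDr; near: t; apply: nbhs_pinfty_ge; exact: num_real.
exact: (cvg_comp _ _ h (@cvgy_atan R)).
Unshelve. all: by end_near. Qed.

Lemma cvgNy_atan_affine (a b : R) : 0 < b -> atan ((t - a) / b) @[t --> -oo] --> - (pi / 2).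
Proof.
move=> b0; apply/cvgNy_compNP.
have -> : (fun t => atan ((t - a) / b)) \o -%R = (fun t => - atan ((t - (- a)) / b)).
  by apply/funext => t /=; rewrite -atanN -mulNr; congr (atan (_ / b)); ring.
by apply: cvgN; exact: cvgy_atan_affine.
Qed.

Lemma is_derive_atan_affine (a b t : R) : 0 < b ->
  is_derive t (1 : R) (fun t => atan ((t - a) / b)) (b / (b ^+ 2 + (t - a) ^+ 2)).
Proof.
move=> b0.
have h : is_derive t (1 : R) (fun t => (t - a) / b) b^-1.
  have -> : (fun t => (t - a) / b) = b^-1 \*: ((id : R -> R) - cst a).
    by apply/funext => z; rewrite /= mulrC.
  by apply: is_derive_eq; rewrite subr0 /GRing.scale/= mulr1.
refine (is_derive_eq (@is_derive1_comp R atan (fun t => (t - a) / b) t _ _ (is_derive1_atan _) h) _).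
have : 0 < b ^+ 2 + (t - a) ^+ 2 by rewrite ltr_wpDr ?sqr_ge0// exprn_gt0.
move=> /lt0r_neq0 h0.
have h1 : 1 + ((t - a) / b) ^+ 2 = (b ^+ 2 + (t - a) ^+ 2) / b ^+ 2.
  by rewrite exprMn exprVn mulrDl divff// expf_neq0// lt0r_neq0.
by rewrite h1; field; rewrite h0 lt0r_neq0.
Qed.

Lemma cos2_atan_affine (a b t : R) : 0 < b ->
  cos (atan ((t - a) / b)) = b / Num.sqrt (b ^+ 2 + (t - a) ^+ 2).
Proof.
move=> b0; rewrite cos_atan.
have -> : 1 + ((t - a) / b) ^+ 2 = (b ^+ 2 + (t - a) ^+ 2) / b ^+ 2.
  by rewrite exprMn exprVn mulrDl divff// expf_neq0// lt0r_neq0.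
rewrite sqrtrM ?addr_ge0 ?sqr_ge0// sqrtrV ?sqr_ge0// sqrtr_sqr gtr0_norm//.
by rewrite invfM invrK mulrC.
Qed.

(** The substitution t = a + b tan A gives the primitive (sin A cos A + A) / (2 b^3), whose
    trigonometric part vanishes at both ends. *)
Lemma int_inv_sqr (a b : R) : 0 < b ->
  (\int[mu]_t ((b ^+ 2 + (t - a) ^+ 2) ^- 2)%:E)%E = (pi / (2 * b ^+ 3))%:E.
Proof.
move=> b0; pose A t := atan ((t - a) / b).
have pos t : 0 < b ^+ 2 + (t - a) ^+ 2 by rewrite ltr_wpDr ?sqr_ge0// exprn_gt0.
pose F t := (2 * b ^+ 3)^-1 * (sin (A t) * cos (A t) + A t).
have f0 t : 0 <= (b ^+ 2 + (t - a) ^+ 2) ^- 2 by rewrite invr_ge0 exprn_ge0// ltW.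
have cf : continuous (fun t => (b ^+ 2 + (t - a) ^+ 2) ^- 2).
  move=> t; apply: cvgV; first by rewrite expf_neq0// lt0r_neq0.
  apply: (cvg_comp _ (fun z : R => z ^+ 2)); last exact: exprn_continuous.
  apply: cvgD; first exact: cvg_cst.
  apply: (cvg_comp (fun t => t - a) (fun z : R => z ^+ 2)); last exact: exprn_continuous.
  by apply: cvgB; [exact: cvg_id|exact: cvg_cst].
have dF (t : R) : is_derive t (1 : R) F ((b ^+ 2 + (t - a) ^+ 2) ^- 2).
  have dA := is_derive_atan_affine a t b0.
  have ds := is_derive1_comp (is_derive_sin (A t)) dA.
  have dc := is_derive1_comp (is_derive_cos (A t)) dA.
  refine (is_derive_eq (is_deriveZ _ (is_deriveD (is_deriveM ds dc) dA)) _).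
  rewrite /GRing.scale/=.
  have := cos2Dsin2 (A t); have := cos2_atan_affine a t b0; rewrite -/(A t).
  set c := cos _; set s := sin _ => cE cs.
  have c2 : c ^+ 2 = b ^+ 2 / (b ^+ 2 + (t - a) ^+ 2).
    by rewrite cE exprMn exprVn sqr_sqrtr// ltW.
  set w := b / _.
  transitivity ((2 * b ^+ 3)^-1 * ((c ^+ 2 - (c ^+ 2 + s ^+ 2 - c ^+ 2) + 1) * w)); first by ring.
  rewrite cs c2 /w; field; rewrite lt0r_neq0// lt0r_neq0//.
have cvF (X : set_system R) (l : R) : Filter X -> A t @[t --> X] --> l ->
    F t @[t --> X] --> (2 * b ^+ 3)^-1 * (sin l * cos l + l).
  move=> FX c; apply: cvgM; first exact: cvg_cst.
  apply: cvgD => //; apply: cvgM.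
  + by apply: (cvg_comp _ _ c); exact: continuous_sin.
  + by apply: (cvg_comp _ _ c); exact: continuous_cos.
rewrite (ge0_FTC_line f0 cf dF (cvF _ _ _ (cvgy_atan_affine a b0)) (cvF _ _ _ (cvgNy_atan_affine a b0))).
congr EFin; rewrite sinN cosN cos_pihalf !mulr0; field.
by rewrite lt0r_neq0.
Qed.

(** With t = a + d tan A the integrand is the derivative of (pi / 2) sin A. The integrand has this
    form because it is the result of integrating over vertical lines by [int_inv_sqr] with b^2 = d^2
    + (t - a)^2. *)
Lemma int_inv_cube (a d : R) : 0 < d ->
  (\int[mu]_t (d ^+ 2 * (pi / (2 * Num.sqrt (d ^+ 2 + (t - a) ^+ 2) ^+ 3)))%:E)%E = pi%:E.
Proof.
move=> d0; pose A t := atan ((t - a) / d).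
have pos t : 0 < d ^+ 2 + (t - a) ^+ 2 by rewrite ltr_wpDr ?sqr_ge0// exprn_gt0.
have spos t : 0 < Num.sqrt (d ^+ 2 + (t - a) ^+ 2) by rewrite sqrtr_gt0.
pose F t := pi / 2 * sin (A t).
pose f t := d ^+ 2 * (pi / (2 * Num.sqrt (d ^+ 2 + (t - a) ^+ 2) ^+ 3)).
have f0 t : 0 <= f t.
  by rewrite mulr_ge0 ?sqr_ge0// divr_ge0 ?pi_ge0// mulr_ge0// exprn_ge0// sqrtr_ge0.
have cf : continuous f.
  move=> t; apply: cvgM; first exact: cvg_cst.
  apply: cvgM; first exact: cvg_cst.
  apply: cvgV; first by rewrite mulf_neq0// expf_neq0// lt0r_neq0.
  apply: cvgM; first exact: cvg_cst.
  apply: (cvg_comp _ (fun z : R => z ^+ 3)); last exact: exprn_continuous.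
  apply: (cvg_comp _ Num.sqrt); last exact: sqrt_continuous.
  apply: cvgD; first exact: cvg_cst.
  apply: (cvg_comp (fun t => t - a) (fun z : R => z ^+ 2)); last exact: exprn_continuous.
  by apply: cvgB; [exact: cvg_id|exact: cvg_cst].
have dF (t : R) : is_derive t (1 : R) F (f t).
  have dA := is_derive_atan_affine a t d0.
  refine (is_derive_eq (is_deriveZ _ (is_derive1_comp (is_derive_sin (A t)) dA)) _).
  rewrite /GRing.scale/= /A cos2_atan_affine// /f.
  have s0 : Num.sqrt (d ^+ 2 + (t - a) ^+ 2) != 0 by rewrite lt0r_neq0.
  have -> : d / (d ^+ 2 + (t - a) ^+ 2) = d / Num.sqrt (d ^+ 2 + (t - a) ^+ 2) ^+ 2.
    by rewrite sqr_sqrtr// ltW.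
  by field.
have cvF (X : set_system R) (l : R) : Filter X -> A t @[t --> X] --> l ->
    F t @[t --> X] --> pi / 2 * sin l.
  move=> FX c; apply: cvgM; first exact: cvg_cst.
  by apply: (cvg_comp _ _ c); exact: continuous_sin.
rewrite (ge0_FTC_line f0 cf dF (cvF _ _ _ (cvgy_atan_affine a d0)) (cvF _ _ _ (cvgNy_atan_affine a d0))).
by congr EFin; rewrite sinN sin_pihalf; field.
Qed.

Lemma I2_tonelli f (h : R -> R) (c : R) : mf2 f -> (forall p, 0 <= f p) ->
  (forall x : R, (\int[mu]_y (f (x, y))%:E)%E = (h x)%:E) ->
  (\int[mu]_x (h x)%:E)%E = c%:E -> itg2 f /\ I2 f = c.
Proof.
move=> mf f0 fh hc.
have mfE : measurable_fun setT (EFin \o f) by apply/measurable_EFinP.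
have itf : itg2 f.
  apply/(integrable12ltyP mu mu mfE).
  rewrite (_ : (\int[mu]_x _)%E = c%:E) ?ltry// -hc.
  apply: eq_integral => x _; rewrite -fh; apply: eq_integral => y _.
  by rewrite /= ger0_norm.
split=> //; rewrite (I2_iter1 itf fh) /Rintegral.
by rewrite hc.
Qed.

Definition nsq p : R := p.1 ^+ 2 + p.2 ^+ 2.

Lemma nsq_ge0 p : 0 <= nsq p. Proof. by rewrite addr_ge0 ?sqr_ge0. Qed.

Lemma nsq_norm p : `|p| ^+ 2 <= nsq p.
Proof.
rewrite prod_normE/= /nsq; have [_|_] := leP `|p.2| `|p.1|.
  by rewrite real_normK ?num_real// lerDl sqr_ge0.
by rewrite real_normK ?num_real// lerDr sqr_ge0.
Qed.

Lemma nsq_cont : continuous nsq.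
Proof.
move=> p; apply: cvgD.
  by apply: (cvg_comp _ (fun z : R => z ^+ 2)); [exact: cvg_fst|exact: exprn_continuous].
by apply: (cvg_comp _ (fun z : R => z ^+ 2)); [exact: cvg_snd|exact: exprn_continuous].
Qed.

(** This is the Laplacian of log(|x|^2 + d^2) / (4 pi): it has mass 1 and approximates the Dirac
    mass as d tends to 0. *)
Definition eta (d : R) x : R := pi^-1 * (d ^+ 2 / (nsq x + d ^+ 2) ^+ 2).

Lemma nsqd_gt0 (d : R) x : 0 < d -> 0 < nsq x + d ^+ 2.
Proof. by move=> d0; rewrite ltr_wpDl ?nsq_ge0// exprn_gt0. Qed.

Lemma eta_ge0 d x : 0 <= eta d x.
Proof. by rewrite mulr_ge0 ?invr_ge0 ?pi_ge0// divr_ge0 ?sqr_ge0. Qed.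

Lemma eta_cont d : 0 < d -> continuous (eta d).
Proof.
move=> d0 x; apply: cvgM; first exact: cvg_cst.
apply: cvgM; first exact: cvg_cst.
apply: cvgV; first by rewrite expf_neq0// lt0r_neq0// nsqd_gt0.
apply: (cvg_comp _ (fun z : R => z ^+ 2)); last exact: exprn_continuous.
by apply: cvgD; [exact: nsq_cont|exact: cvg_cst].
Qed.

Lemma sub_cont2 x : continuous (fun y : R * R => y - x).
Proof. by move=> y; apply: cvgB; [exact: cvg_id|exact: cvg_cst]. Qed.

Lemma mf2_eta d x : 0 < d -> mf2 (fun y => eta d (y - x)).
Proof.
move=> d0; apply: mf2_cont => y; apply: (continuous_comp (@sub_cont2 x _)); exact: eta_cont.
Qed.

Lemma eta_int d x : 0 < d ->
  itg2 (fun y => eta d (y - x)) /\ I2 (fun y => eta d (y - x)) = 1.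
Proof.
move=> d0.
have pos t : 0 < d ^+ 2 + (t - x.1) ^+ 2 by rewrite ltr_wpDr ?sqr_ge0// exprn_gt0.
have [||||h1 h2] := @I2_tonelli (fun y => d ^+ 2 * (nsq (y - x) + d ^+ 2) ^- 2)
  (fun t => d ^+ 2 * (pi / (2 * Num.sqrt (d ^+ 2 + (t - x.1) ^+ 2) ^+ 3))) pi.
- apply: mf2_cont => y; apply: cvgM; first exact: cvg_cst.
  apply: cvgV; first by rewrite expf_neq0// lt0r_neq0// nsqd_gt0.
  apply: (cvg_comp _ (fun z : R => z ^+ 2)); last exact: exprn_continuous.
  apply: cvgD; last exact: cvg_cst.
  by apply: (continuous_comp (@sub_cont2 x _)); exact: nsq_cont.
- by move=> p; rewrite mulr_ge0 ?sqr_ge0// invr_ge0 sqr_ge0.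
- move=> t.
  under eq_integral do rewrite EFinM.
  have sp : 0 < Num.sqrt (d ^+ 2 + (t - x.1) ^+ 2) by rewrite sqrtr_gt0.
  have := int_inv_sqr x.2 sp; rewrite sqr_sqrtr ?ltW// => E.
  rewrite ge0_integralZl//.
  + rewrite [RHS]EFinM -E; congr (_ * _)%E; apply: eq_integral => s _.
    by rewrite /nsq /=; congr ((_ ^- 2)%:E); ring.
  + apply/measurable_EFinP; apply: measurable_realfun.continuous_measurable_fun => s.
    apply: cvgV; first by rewrite expf_neq0// lt0r_neq0// nsqd_gt0.
    apply: (cvg_comp _ (fun z : R => z ^+ 2)); last exact: exprn_continuous.
    apply: cvgD; last exact: cvg_cst.
    rewrite /nsq /=; apply: cvgD; first exact: cvg_cst.
    apply: (cvg_comp (fun t => t - x.2) (fun z : R => z ^+ 2)); last exact: exprn_continuous.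
    by apply: cvgB; [exact: cvg_id|exact: cvg_cst].
  + by move=> s _; rewrite lee_fin invr_ge0 sqr_ge0.
  + by rewrite lee_fin sqr_ge0.
- exact: int_inv_cube.
split; first exact: itg2Z.
by rewrite I2Z// h2 mulVf// lt0r_neq0// pi_gt0.
Qed.

(** Comparing the tail with [eta 1], whose integral is 1, avoids computing an integral over the
    exterior of a disc. *)
Lemma eta_tail d r x : 0 < d -> d <= 1 -> 0 < r -> r ^+ 2 <= nsq x ->
  eta d x <= d ^+ 2 * ((1 + r ^+ 2) / r ^+ 2) ^+ 2 * eta 1 x.
Proof.
move=> d0 d1 r0 rx; rewrite /eta expr1n.
have T0 : 0 < nsq x by apply: lt_le_trans rx; rewrite exprn_gt0.
set T := nsq x in rx T0 *; set q := r ^+ 2 in rx *.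
have q0 : 0 < q by rewrite exprn_gt0.
have h1 : 0 < T + d ^+ 2 by rewrite addr_gt0// exprn_gt0.
have h2 : 0 < T + 1 by rewrite addr_gt0.
have -> : d ^+ 2 * ((1 + q) / q) ^+ 2 * (pi^-1 * (1 / (T + 1) ^+ 2)) =
   pi^-1 * (d ^+ 2 * ((1 + q) / q * (T + 1)^-1) ^+ 2).
  by rewrite div1r [in RHS]exprMn [in RHS]exprVn; ring.
rewrite ler_pM2l ?invr_gt0 ?pi_gt0// ler_pM2l ?exprn_gt0// -exprVn.
have c0 : 0 < (1 + q) / q by rewrite divr_gt0// addr_gt0.
rewrite ler_pXn2r ?nnegrE ?mulr_ge0 ?invr_ge0 ?(ltW h1) ?(ltW h2) ?(ltW c0)//.
apply: (@le_trans _ _ T^-1); first by rewrite lef_pV2 ?posrE// lerDl sqr_ge0.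
rewrite ler_pdivlMr// mulrC ler_pdivrMr// mulrAC ler_pdivlMr//.
all: by lra.
Qed.

(** Within distance [r] of [x] continuity costs e/2 against [eta d]; outside, [eta_tail] trades
    [eta d] for d^2 times a multiple of [eta 1], which costs the other e/2 once d is small. *)
Lemma mollify h x M e : mf2 h -> (forall y, `|h y| <= M) -> {for x, continuous h} -> 0 < e ->
  exists2 d0, 0 < d0 & forall d, 0 < d -> d < d0 ->
    `|I2 (fun y => h y * eta d (y - x)) - h x| <= e.
Proof.
move=> mh hM ch e0.
have M0 : 0 <= M by exact: le_trans (hM 0).
have e2 : 0 < e / 2 by rewrite divr_gt0.
have /cvgrPdist_le/(_ _ e2)/nbhs_ballP[r /= r0 hr] := ch.
pose K := 2 * M * ((1 + r ^+ 2) / r ^+ 2) ^+ 2.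
have K0 : 0 <= K by rewrite mulr_ge0 ?sqr_ge0// mulr_ge0.
pose d0 := Num.min 1 (e / 2 / (K + 1)).
have K1 : 0 < K + 1 by rewrite ltr_wpDl.
exists d0; first by rewrite lt_min ltr01 divr_gt0.
move=> d dp; rewrite lt_min => /andP[d1 dK].
have [i1 I1] := eta_int x dp; have [j1 J1] := eta_int x (@ltr01 R).
have ih : itg2 (fun y => h y * eta d (y - x)).
  apply: itg2_dom (itg2Z M i1) _; first by apply: mf2M => //; exact: mf2_eta.
  by move=> y; rewrite normrM (ger0_norm (eta_ge0 _ _)) ler_wpM2r ?eta_ge0.
have -> : h x = I2 (fun y => h x * eta d (y - x)) by rewrite I2Z// I1 mulr1.
rewrite -I2B//; last exact: itg2Z.
have -> : e = I2 (fun y => e / 2 * eta d (y - x) + e / 2 * eta 1 (y - x)).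
  rewrite I2D; [|exact: itg2Z|exact: itg2Z].
  by rewrite (I2Z _ i1) (I2Z _ j1) I1 J1 !mulr1 -splitr.
apply: I2_abs; [by apply: itg2B => //; exact: itg2Z|by apply: itg2D; exact: itg2Z|].
move=> y; rewrite -mulrBl normrM (ger0_norm (eta_ge0 _ _)).
have [yr|yr] := ltP `|y - x| r.
  apply: (@le_trans _ _ (e / 2 * eta d (y - x))); last first.
    by rewrite lerDl mulr_ge0 ?eta_ge0// ltW.
  apply: ler_wpM2r; first exact: eta_ge0.
  by rewrite distrC; apply: hr; rewrite -ball_normE /= distrC.
apply: (@le_trans _ _ (2 * M * eta d (y - x))).
  apply: ler_wpM2r; first exact: eta_ge0.
  apply: (le_trans (ler_normB _ _)).
  by rewrite mulrDl mul1r lerD.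
have rn : r ^+ 2 <= nsq (y - x).
  by apply: le_trans (nsq_norm _); rewrite ler_pXn2r ?nnegrE// ltW.
apply: (le_trans (ler_wpM2l _ (eta_tail dp (ltW d1) r0 rn))); first by rewrite mulr_ge0.
apply: (@le_trans _ _ (e / 2 * eta 1 (y - x))); last first.
  by rewrite lerDr mulr_ge0 ?eta_ge0// ltW.
rewrite mulrA; apply: ler_wpM2r; first exact: eta_ge0.
have -> : 2 * M * (d ^+ 2 * ((1 + r ^+ 2) / r ^+ 2) ^+ 2) = K * d ^+ 2 by rewrite /K; ring.
apply: (@le_trans _ _ ((K + 1) * d)).
  apply: ler_pM => //; rewrite ?sqr_ge0 ?lerDl// expr2 -[leRHS]mulr1 ler_wpM2l// ltW//.
by move: dK; rewrite ltr_pdivlMr// mulrC => /ltW.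
Qed.
End Eta.

(** * Smooth cutoff functions *)

Section Bump.
Context {R : realType}.

(** One term of the exponential series suffices: exp(y) >= y^(k+1) / (k+1)!. *)
Lemma pow_expRN_bound k : forall y : R, 0 <= y -> y ^+ k.+1 * expR (- y) <= (k.+1)`!%:R.
Proof.
move=> y y0; rewrite expRN ler_pdivrMr ?expR_gt0//.
have h := expR_ge1Dxn k y0.
have f0 : (0 : R) < (k.+1)`!%:R by rewrite ltr0n fact_gt0.
rewrite -ler_pdivrMl//; apply: le_trans h.
by rewrite mulrC lerDr.
Qed.

Lemma horner_expRN_bound (p : {poly R}) : exists2 K : R, 0 <= K &
  forall y : R, 0 <= y -> `|p.[y]| * expR (- y) <= K.
Proof.
exists (\sum_(i < size p) `|p`_i| * i`!%:R); first by apply: sumr_ge0 => i _; rewrite mulr_ge0.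
move=> y y0; rewrite horner_coef.
apply: (@le_trans _ _ ((\sum_(i < size p) `|p`_i| * y ^+ i) * expR (- y))).
  rewrite ler_pM2r ?expR_gt0//; apply: (le_trans (ler_norm_sum _ _ _)).
  by apply: ler_sum => i _; rewrite normrM normrX (ger0_norm y0).
rewrite mulr_suml; apply: ler_sum => i _; rewrite -mulrA ler_wpM2l//.
case: (nat_of_ord i) => [|k]; last exact: pow_expRN_bound.
by rewrite expr0 mul1r fact0 expR_le1 oppr_le0.
Qed.

(* The n-th derivative of exp(-1/x) is P_n(1/x) exp(-1/x) with P_(n+1) = X^2 (P_n - P_n'). *)
Fixpoint flatP (n : nat) : {poly R} :=
  if n is m.+1 then 'X^2 * (flatP m - (flatP m)^`()) else 1.

Definition flat (n : nat) (x : R) : R :=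
  if 0 < x then (flatP n).[x^-1] * expR (- x^-1) else 0.

Lemma flat_derive n (x : R) : is_derive x (1 : R) (flat n) (flat n.+1 x).
Proof.
have [x0|x0|->] := ltgtP x 0.
- rewrite [flat n.+1 x]/flat ltNge (ltW x0) /=.
  apply: (near_eq_is_derive _ (is_derive_cst (0 : R) x (1 : R))).
  near=> y; rewrite /flat ifF//; apply/negbTE; rewrite -leNgt ltW//.
  by near: y; exact: lt_nbhsl.
- have xn : x != 0 by rewrite gt_eqF.
  have dV : is_derive x (1 : R) (fun y : R => y^-1) (- x ^- 2).
    by refine (is_derive_eq (is_deriveV xn (is_derive_id x (1 : R))) _); rewrite /GRing.scale/= mulr1.
  have d1 := @is_derive1_comp R _ _ x _ _ (is_derive_poly (flatP n) x^-1) dV.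
  have dN := is_deriveN dV.
  have d2 := @is_derive1_comp R _ _ x _ _ (is_derive_expR (- x^-1)) dN.
  apply: (near_eq_is_derive _ (is_derive_eq (is_deriveM d1 d2) _)).
    near=> y; rewrite /flat ifT//.
    by near: y; exact: lt_nbhsr.
  rewrite /flat x0 /= !hornerE /GRing.scale/= -exprVn; ring.
- rewrite [flat n.+1 0]/flat ltxx.
  (* At 0 the difference quotient for h > 0 is h times y^2 P_n(y) exp(-y) with y = 1/h; [K] bounds
     the second factor, so the quotient tends to 0. *)
  have [K K0 hK] := horner_expRN_bound ('X^2 * flatP n).
  have lim : (fun h : R => h^-1 *: (flat n (h *: (1 : R) + 0) - flat n 0)) h @[h --> 0^'] --> (0 : R).
    apply/cvgr0Pnorm_le => e e0; near=> h.
    rewrite {2}/flat ltxx subr0 /GRing.scale/= mulr1 addr0 /flat.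
    case: ifPn => [h0|_]; last by rewrite mulr0 normr0 ltW.
    have y0 : 0 <= h^-1 by rewrite invr_ge0 ltW.
    have := hK _ y0; rewrite !hornerE => hh.
    have E : h^-1 * (flatP n).[h^-1] * expR (- h^-1) =
       h * (h^-1 ^+ 2 * (flatP n).[h^-1] * expR (- h^-1)).
      by field; rewrite gt_eqF.
    rewrite -[X in `|X|]/(h^-1 * (flatP n).[h^-1] * expR (- h^-1)) E.
    rewrite normrM (gtr0_norm h0) normrM (ger0_norm (expR_ge0 _)).
    apply: (le_trans (ler_wpM2l (ltW h0) hh)).
    apply: (@le_trans _ _ (h * (K + 1))); first by rewrite ler_wpM2l ?ltW// ltrDl.
    rewrite -ler_pdivlMr ?ltr_wpDl//.
    apply: (le_trans (ler_norm h)); near: h.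
    apply: dnbhs0_le; by rewrite divr_gt0 ?ltr_wpDl.
  by split; [apply/cvg_ex; exists 0|exact/cvg_lim].
Unshelve. all: by end_near. Qed.

Lemma flat_cont n : continuous (flat n).
Proof.
by move=> x; apply/differentiable_continuous/derivable1_diffP; have [] := flat_derive n x.
Qed.

Lemma flat0E (x : R) : flat 0 x = if 0 < x then expR (- x^-1) else 0.
Proof. by rewrite /flat /= hornerC mul1r. Qed.

Lemma flat0_ge0 x : 0 <= flat 0 x.
Proof. by rewrite flat0E; case: ifP => // _; exact: expR_ge0. Qed.

Lemma flat0_mono : {homo flat 0 : x y / x <= y}.
Proof.
move=> x y xy; rewrite !flat0E; case: ifPn => x0; last by case: ifP => // _; exact: expR_ge0.
by rewrite (lt_le_trans x0 xy) ler_expR lerN2 lef_pV2// posrE// (lt_le_trans x0 xy).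
Qed.

Lemma flat_le0 n x : x <= 0 -> flat n x = 0.
Proof. by move=> x0; rewrite /flat ltNge x0. Qed.

Lemma flat0_gt0 x : 0 < x -> 0 < flat 0 x.
Proof. by move=> x0; rewrite flat0E x0 expR_gt0. Qed.

(** A composition in place of the usual quotient of two flat functions: [flat 0] vanishes on the
    nonpositive reals and is nondecreasing, so the inner difference equals [flat 0 1] up to t = 1
    and is nonpositive from t = 2 on. The denominator is a constant, which keeps derivatives
    simple. *)
Definition cutoff (t : R) : R := flat 0 (flat 0 1 - flat 0 (t - 1)) / flat 0 (flat 0 1).
Definition cutoff' (t : R) : R :=
  - (flat 1 (flat 0 1 - flat 0 (t - 1)) * flat 1 (t - 1)) / flat 0 (flat 0 1).

Lemma cutoff_le1 t : t <= 1 -> cutoff t = 1.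
Proof.
move=> t1; rewrite /cutoff (@flat_le0 _ (t - 1)) ?subr_le0// subr0 divff// gt_eqF//.
by rewrite !flat0_gt0.
Qed.

Lemma cutoff_ge2 t : 2 <= t -> cutoff t = 0.
Proof.
move=> t2; rewrite /cutoff flat_le0 ?mul0r// subr_le0; apply: flat0_mono; lra.
Qed.

Lemma cutoff_ge0 t : 0 <= cutoff t.
Proof. by rewrite divr_ge0 ?flat0_ge0. Qed.

Lemma cutoff_le t : cutoff t <= 1.
Proof.
by rewrite ler_pdivrMr ?mul1r ?flat0_gt0 ?flat0_gt0//; apply: flat0_mono; rewrite gerBl flat0_ge0.
Qed.

Lemma is_derive_shift1 (t : R) : is_derive t (1 : R) (fun t : R => t - 1) 1.
Proof. by apply: is_derive_eq; rewrite subr0. Qed.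

Lemma cutoff_derive t : is_derive t (1 : R) cutoff (cutoff' t).
Proof.
have d1 := @is_derive1_comp R _ _ t _ _ (flat_derive 0 (t - 1)) (is_derive_shift1 t).
have d2 := is_deriveB (is_derive_cst (flat 0 1) t (1 : R)) d1.
have d3 := @is_derive1_comp R _ _ t _ _ (flat_derive 0 _) d2.
have -> : cutoff = (flat 0 (flat 0 1))^-1 \*: (flat 0 \o (cst (flat 0 1) - (flat 0 \o (fun t => t - 1)))).
  by apply/funext => s; rewrite /cutoff /= mulrC.
by refine (is_derive_eq (is_deriveZ _ d3) _); rewrite /GRing.scale/= /cutoff' sub0r; ring.
Qed.

Lemma cutoff'_cont : continuous cutoff'.
Proof.
move=> t; apply: cvgM; last exact: cvg_cst.
have c : (s - 1 : R) @[s --> t] --> t - 1 by apply: cvgB; [exact: cvg_id|exact: cvg_cst].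
apply: cvgN; apply: cvgM; last by apply: (cvg_comp _ _ c); exact: flat_cont.
apply: (cvg_comp (fun s => flat 0 1 - flat 0 (s - 1))); last exact: flat_cont.
by apply: cvgB; [exact: cvg_cst|apply: (cvg_comp _ _ c); exact: flat_cont].
Qed.

Lemma cutoff'_out t : (t <= 1) || (2 <= t) -> cutoff' t = 0.
Proof.
case/orP => h; rewrite /cutoff'.
  by rewrite (@flat_le0 1 (t - 1)) ?subr_le0// mulr0 oppr0 mul0r.
rewrite (@flat_le0 1 (_ - _)) ?mul0r ?oppr0 ?mul0r// subr_le0; apply: flat0_mono; lra.
Qed.

Lemma cutoff'_bdd : exists2 K : R, 0 <= K & forall t, `|cutoff' t| <= K.
Proof.
have /compact_bounded[M [Mr hM]] : compact (cutoff' @` `[1, 2]).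
  apply: continuous_compact; last exact: segment_compact.
  by apply: continuous_subspaceT; exact: cutoff'_cont.
exists (`|M| + 1); first by rewrite addr_ge0.
move=> t; have [|] := boolP ((t <= 1) || (2 <= t)).
  by move=> /cutoff'_out ->; rewrite normr0 addr_ge0.
rewrite negb_or -!ltNge => /andP[t1 t2].
apply: (hM (`|M| + 1)); first by rewrite (le_lt_trans (ler_norm M))// ltrDl.
by exists t => //=; rewrite in_itv/= !ltW.
Qed.

End Bump.

(** * Partial derivatives indexed by direction, compact supports and radial fields *)

Section Dir.
Context {R : realType}.
Implicit Types (f g h : R * R -> R) (p x y : R * R) (b j : bool).

(* Coordinates and partial derivatives are indexed by bool: false is x_1, true is x_2. *)
Definition coor b p : R := if b then p.2 else p.1.
Definition partial b g p : R := if b then dy g p else dx g p.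
Definition is_partial b g p (v : R) := if b then is_dy g p v else is_dx g p v.

Lemma partial_eq b g p v : is_partial b g p v -> partial b g p = v.
Proof. by case: b; [exact: dy_eq|exact: dx_eq]. Qed.
Lemma is_partial_cst b (c : R) p : is_partial b (fun=> c) p 0.
Proof. by case: b; [exact: is_dy_cst|exact: is_dx_cst]. Qed.
Lemma is_partialD b f g p u v : is_partial b f p u -> is_partial b g p v -> is_partial b (fun q => f q + g q) p (u + v).
Proof. by case: b; [exact: is_dyD|exact: is_dxD]. Qed.
Lemma is_partialM b f g p u v : is_partial b f p u -> is_partial b g p v ->
  is_partial b (fun q => f q * g q) p (u * g p + f p * v).
Proof. by case: b; [exact: is_dyM|exact: is_dxM]. Qed.
Lemma is_partialZ b (k : R) g p v : is_partial b g p v -> is_partial b (fun q => k * g q) p (k * v).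
Proof. by move=> h; have := is_partialM (is_partial_cst b k p) h; rewrite mul0r add0r. Qed.
Lemma is_partial_eq b g p u v : is_partial b g p u -> u = v -> is_partial b g p v.
Proof. by move=> h <-. Qed.
Lemma is_partial_co b j p : is_partial b (coor j) p (b == j)%:R.
Proof. by case: b; case: j; [exact: is_dy_snd|exact: is_dy_fst|exact: is_dx_snd|exact: is_dx_fst]. Qed.
Lemma is_partial_comp b (F : R -> R) h p F' v :
  is_derive (h p) (1 : R) F F' -> is_partial b h p v -> is_partial b (fun q => F (h q)) p (F' * v).
Proof. by case: b => dF dh; exact: is_derive_comp1. Qed.
Lemma is_partial_Ck b g p : Ck 1 g -> is_partial b g p (partial b g p).
Proof. by case: b; [exact: Ck1_isdy|exact: Ck1_isdx]. Qed.
Lemma partial_cont b g : Ck 1 g -> continuous (partial b g).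
Proof. by case: b => -[_ _ hx hy]; [exact: hy|exact: hx]. Qed.
Lemma Ck_co n j : Ck n (coor j : R * R -> R).
Proof. by case: j; [exact: Ck_snd|exact: Ck_fst]. Qed.

Lemma partial_div0 b D f : open D -> bounded_set D -> Ck 1 f ->
  (forall p, closure D p -> ~ D p -> f p = 0) -> I2 (fun p => partial b f p * \1_D p) = 0.
Proof. by case: b; [exact: div0_dy|exact: div0_dx]. Qed.

Lemma partial_out b f (N : R) p : (forall q, N < `|q| -> f q = 0) -> N < `|p| -> partial b f p = 0.
Proof.
move=> f0 Np; apply: partial_eq.
have nr : \forall q \near p, 0 = f q.
  apply: (filterS (P := [set q | N < `|q|])) => [q /= /f0//|].
  have : (fun q : R * R => `|q|) q @[q --> p] --> `|p| by exact: norm_continuous.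
  by move=> /(_ [set t | N < t]); apply; exact: lt_nbhsr.
by rewrite /is_partial; case: b; rewrite /is_dx /is_dy; apply: (near_eq_is_derive nr); exact: is_derive_cst.
Qed.

Lemma ball_open_bdd (N : R) : open [set p : R * R | `|p| < N] /\ bounded_set [set p : R * R | `|p| < N].
Proof.
split.
  have := @open_comp _ _ (fun q : R * R => `|q|) [set t | t < N].
  apply; last exact: open_lt.
  by move=> q _; exact: norm_continuous.
exists N; split; first exact: num_real.
by move=> M NM p /= pN; rewrite ltW// (lt_trans pN).
Qed.

Lemma div0_cpt b f (N : R) : Ck 1 f -> (forall q, N < `|q| -> f q = 0) -> I2 (partial b f) = 0.
Proof.
move=> cf f0; pose D := [set p : R * R | `|p| < N + 1].
have [oD bD] := ball_open_bdd (N + 1).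
rewrite -(@partial_div0 b D f oD bD cf).
  apply: I2_ext => p; rewrite indicE; have [_|] := boolP (p \in D); first by rewrite mulr1.
  rewrite mulr0 => /negP pD; apply: (partial_out _ f0).
  rewrite ltNge; apply/negP => pN; apply: pD; apply/mem_set.
  by rewrite /D /= (le_lt_trans pN)// ltrDl.
move=> p _ pD; apply: f0; rewrite ltNge; apply/negP => pN; apply: pD.
by rewrite /D /= (le_lt_trans pN)// ltrDl.
Qed.

Lemma itg2_cpt f (N : R) : continuous f -> (forall q, N < `|q| -> f q = 0) -> itg2 f.
Proof.
move=> cf f0; have [M M0 hM] := continuous_bddP `|N| cf.
apply: (itg2_bdd (M := M + `|N|)); first exact: mf2_cont.
- move=> p; have [pN|pN] := leP `|p| `|N|; first by rewrite (le_trans (hM p pN))// lerDl.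
  by rewrite f0 ?normr0 ?addr_ge0// (le_lt_trans (ler_norm N)).
- by move=> p pN; apply: f0; rewrite (le_lt_trans (ler_norm N))// (le_lt_trans _ pN)// lerDr.
Qed.

Lemma test_functionI g (N : R) : (forall n, Ck n g) -> (forall q, N < `|q| -> g q = 0) -> test_function g.
Proof.
move=> cg g0; split=> //.
have cK : compact (`[- N, N] `*` `[- N, N] : set (R * R)).
  by apply: compact_setX; exact: segment_compact.
apply: (subclosed_compact _ cK); first exact: closed_closure.
have clK : closed (`[- N, N] `*` `[- N, N] : set (R * R)).
  by apply: compact_closed => //; exact: norm_hausdorff.
rewrite (_ : (`[- N, N] `*` `[- N, N] : set (R * R)) = closure (`[- N, N] `*` `[- N, N])); last first.
  by rewrite -(closure_id _).1.
apply: closureS => p /= /eqP gp; rewrite !in_itv/= -!ler_norml.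
have pN : `|p| <= N by rewrite leNgt; apply/negP => /g0.
by move: pN; rewrite prod_normE/= ge_max => /andP[].
Qed.

Lemma is_partial_shift b j x p : is_partial b (fun y => coor j (y - x)) p (b == j)%:R.
Proof.
have -> : (fun y => coor j (y - x)) = (fun y => coor j y + (- coor j x)).
  by apply/funext => y; case: j.
by apply: is_partial_eq; [apply: is_partialD; [exact: is_partial_co|exact: is_partial_cst]|rewrite addr0].
Qed.

Lemma Ck_shift n j x : Ck n (fun y => coor j (y - x)).
Proof.
have -> : (fun y => coor j (y - x)) = (fun y => coor j y + (- coor j x)).
  by apply/funext => y; case: j.
by apply: CkD; [exact: Ck_co|exact: Ck_cst].
Qed.

Lemma nsqE x : nsq x = coor false x * coor false x + coor true x * coor true x.
Proof. by rewrite /nsq !expr2. Qed.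

Lemma is_partial_nsq b x p : is_partial b (fun y => nsq (y - x)) p (2 * coor b (p - x)).
Proof.
under eq_fun do rewrite nsqE.
apply: is_partial_eq; first by apply: is_partialD; apply: is_partialM; exact: is_partial_shift.
by case: b => /=; ring.
Qed.

Lemma Ck_nsq n x : Ck n (fun y => nsq (y - x)).
Proof.
under eq_fun do rewrite nsqE.
by apply: CkD; apply: CkM; exact: Ck_shift.
Qed.

(* The field z q(|z|^2) is a gradient, so its Laplacian is the gradient of its divergence. *)
Lemma lap_radial b x (q q1 q2 : R * R -> R) :
  (forall j p, is_partial j q p (2 * coor j (p - x) * q1 p)) ->
  (forall j p, is_partial j q1 p (2 * coor j (p - x) * q2 p)) ->
  forall p, laplacian (fun y => coor b (y - x) * q y) p =
    partial b (fun y => 2 * q y + 2 * (nsq (y - x) * q1 y)) p.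
Proof.
move=> hq hq1 p.
have d1 j r : is_partial j (fun y => coor b (y - x) * q y) r
    ((j == b)%:R * q r + coor b (r - x) * (2 * coor j (r - x) * q1 r)).
  by apply: is_partialM; [exact: is_partial_shift|exact: hq].
have d2 j : is_partial j (fun r => (j == b)%:R * q r + coor b (r - x) * (2 * coor j (r - x) * q1 r)) p
   ((j == b)%:R * (2 * coor j (p - x) * q1 p) + ((j == b)%:R * (2 * coor j (p - x) * q1 p)
     + coor b (p - x) * (2 * 1 * q1 p + 2 * coor j (p - x) * (2 * coor j (p - x) * q2 p)))).
  apply: is_partialD; first by apply: is_partialZ; exact: hq.
  apply: is_partialM; first exact: is_partial_shift.
  apply: is_partialM; last exact: hq1.
  by apply: is_partialZ; apply: is_partial_eq (is_partial_shift _ _ _ _) _; rewrite eqxx.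
rewrite /laplacian.
rewrite (_ : dx (fun y => coor b (y - x) * q y) =
  (fun r => (false == b)%:R * q r + coor b (r - x) * (2 * coor false (r - x) * q1 r))); last first.
  by apply/funext => r; exact: (partial_eq (d1 false r)).
rewrite (_ : dy (fun y => coor b (y - x) * q y) =
  (fun r => (true == b)%:R * q r + coor b (r - x) * (2 * coor true (r - x) * q1 r))); last first.
  by apply/funext => r; exact: (partial_eq (d1 true r)).
rewrite (dx_eq (d2 false)) (dy_eq (d2 true)).
symmetry; apply: partial_eq; apply: is_partial_eq.
  apply: is_partialD; apply: is_partialZ; first exact: hq.
  by apply: is_partialM; [exact: is_partial_nsq|exact: hq1].
by rewrite /= nsqE; case: b {d1 d2} => /=; ring.
Qed.

(** * Truncated radial fields as test functions *)

Section Mollifier.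
Variables (d L : R) (d0 : 0 < d) (L0 : 0 < L) (x : R * R).

Let T y := nsq (y - x).
Let I y := (T y + d ^+ 2)^-1.
Let c y := cutoff (T y / L ^+ 2).
Let c1 y := cutoff' (T y / L ^+ 2).
Let c2 y := 'D_1 cutoff' (T y / L ^+ 2).

Lemma derivable_cutoff' (t : R) : is_derive t (1 : R) cutoff' ('D_1 cutoff' t).
Proof.
apply: derivableP.
have d1 := @is_derive1_comp R _ _ t _ _ (flat_derive 0 (t - 1)) (is_derive_shift1 t).
have e1 := @is_derive1_comp R _ _ t _ _ (flat_derive 1 (t - 1)) (is_derive_shift1 t).
have d2 := is_deriveB (is_derive_cst (flat 0 1) t (1 : R)) d1.
have d3 := @is_derive1_comp R _ _ t _ _ (flat_derive 1 _) d2.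
have d4 := is_deriveZ (- (flat 0 (flat 0 1))^-1) (is_deriveM d3 e1).
have -> : cutoff' = - (flat 0 (flat 0 (1 : R)))^-1 \*: ((flat 1 \o (cst (flat 0 1) - (flat 0 \o (fun t => t - 1)))) * (flat 1 \o (fun t => t - 1))).
  by apply/funext => s; rewrite /cutoff' mulNr mulrC -mulNr.
by case: d4.
Qed.

Let T0 y : 0 < T y + d ^+ 2. Proof. exact: nsqd_gt0. Qed.

Let CkT n : Ck n T. Proof. exact: Ck_nsq. Qed.
Let CkI n : Ck n I.
Proof.
by apply: Ck_inv; [move=> p; rewrite gt_eqF//; exact: T0|apply: CkD; [exact: CkT|exact: Ck_cst]].
Qed.
Let CkTL n : Ck n (fun y => T y / L ^+ 2). Proof. by apply: CkM; [exact: CkT|exact: Ck_cst]. Qed.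

Lemma Ck_flat n k h : Ck n h -> Ck n (fun p => flat k (h p)).
Proof. by apply: (@Ck_comp _ n k (@flat R) (fun _ => True)) => // m t _; exact: flat_derive. Qed.

Let Ckm n : Ck n (fun y => flat 0 1 - flat 0 (T y / L ^+ 2 - 1)).
Proof.
have -> : (fun y => flat 0 1 - flat 0 (T y / L ^+ 2 - 1)) =
   (fun y => flat 0 1 + (-1) * flat 0 (T y / L ^+ 2 + - 1)).
  by apply/funext => y; rewrite mulN1r.
apply: CkD; [exact: Ck_cst|apply: CkM; first exact: Ck_cst].
by apply: Ck_flat; apply: CkD; [exact: CkTL|exact: Ck_cst].
Qed.
Let Ckc n : Ck n c.
Proof. by apply: CkM; [apply: Ck_flat; exact: Ckm|exact: Ck_cst]. Qed.
Let Ckc1 n : Ck n c1.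
Proof.
have -> : c1 = (fun y => (flat 1 (flat 0 1 - flat 0 (T y / L ^+ 2 - 1)) * flat 1 (T y / L ^+ 2 + - 1)) *
   - (flat 0 (flat 0 1))^-1).
  by apply/funext => y; rewrite /c1 /cutoff' mulNr mulrN.
apply: CkM; last exact: Ck_cst.
apply: CkM; first by apply: Ck_flat; exact: Ckm.
by apply: Ck_flat; apply: CkD; [exact: CkTL|exact: Ck_cst].
Qed.

Let is_partialT j p : is_partial j T p (2 * coor j (p - x)). Proof. exact: is_partial_nsq. Qed.
Let is_partialI j p : is_partial j I p (- I p ^+ 2 * (2 * coor j (p - x))).
Proof.
apply: (is_partial_comp (F := fun t => t^-1) (h := fun y => T y + d ^+ 2)).
  have tn : T p + d ^+ 2 != 0 by rewrite gt_eqF.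
  refine (is_derive_eq (@is_deriveV R id (T p + d ^+ 2) _ 1 tn (is_derive_id _ (1 : R))) _).
  by rewrite /GRing.scale/= mulr1 /I exprVn.
by apply: is_partial_eq; [apply: is_partialD; [exact: is_partialT|exact: is_partial_cst]|rewrite addr0].
Qed.
Let is_partialTL j p : is_partial j (fun y => T y / L ^+ 2) p (2 * coor j (p - x) / L ^+ 2).
Proof.
by apply: is_partial_eq; [apply: is_partialM; [exact: is_partialT|exact: is_partial_cst]|rewrite mulr0 addr0].
Qed.
Let isdc j p : is_partial j c p (c1 p * (2 * coor j (p - x) / L ^+ 2)).
Proof. by apply: (is_partial_comp (F := cutoff)); [exact: cutoff_derive|exact: is_partialTL]. Qed.
Let isdc1 j p : is_partial j c1 p (c2 p * (2 * coor j (p - x) / L ^+ 2)).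
Proof. by apply: (is_partial_comp (F := cutoff')); [exact: derivable_cutoff'|exact: is_partialTL]. Qed.

(** Where |y - x| <= L in the Euclidean norm, [coor b (y - x) * mq y] is 2 pi times the smoothed
    Newtonian kernel; the cutoff makes it a test function. [q1] and [q2] below are the first and
    second derivatives of this profile with respect to the squared distance. *)
Definition mq y := c y * I y.
Let q1 y := L ^- 2 * (c1 y * I y) + (-1) * (c y * (I y * I y)).
Let q2 y := L ^- 2 * (c2 y / L ^+ 2 * I y - c1 y * I y ^+ 2)
   - (c1 y / L ^+ 2 * I y ^+ 2 - 2 * c y * I y ^+ 3).

Let isdq j p : is_partial j mq p (2 * coor j (p - x) * q1 p).
Proof. by apply: is_partial_eq; [apply: is_partialM; [exact: isdc|exact: is_partialI]|rewrite /q1; ring]. Qed.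
Let isdq1 j p : is_partial j q1 p (2 * coor j (p - x) * q2 p).
Proof.
apply: is_partial_eq.
  apply: is_partialD; apply: is_partialZ; apply: is_partialM; [exact: isdc1|exact: is_partialI|exact: isdc|].
  by apply: is_partialM; exact: is_partialI.
by rewrite /q2; ring.
Qed.

(** The divergence of the field (y - x) [mq] y: a radial profile q(T), with T the squared distance,
    gives 2 q + 2 T q'. *)
Definition mH y := 2 * mq y + 2 * (T y * q1 y).

(** The first summand is 2 pi times the cutoff times [eta d]. The second lives on the annulus L^2 <
    T < 2 L^2 and has size L^-2, so its integral against a function small at infinity is small. *)
Lemma mHE y : mH y = 2 * (c y * (d ^+ 2 / (T y + d ^+ 2) ^+ 2)) +
   2 * (L ^- 2 * (c1 y * (T y / (T y + d ^+ 2)))).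
Proof.
rewrite /mH /mq /q1 /I; have := T0 y; move: (T y) (c y) (c1 y) => t a b /lt0r_neq0 t0.
by field; rewrite t0 lt0r_neq0.
Qed.

Lemma mq_out y : 2 * L ^+ 2 <= T y -> mq y = 0 /\ mH y = 0.
Proof.
move=> Ty; have h : 2 <= T y / L ^+ 2 by rewrite ler_pdivlMr// exprn_gt0.
have cy : c y = 0 by exact: cutoff_ge2.
have c1y : c1 y = 0 by apply: cutoff'_out; rewrite h orbT.
by rewrite /mH /mq /q1 cy c1y !(mul0r, mulr0, addr0).
Qed.

Let N := `|x| + 2 * L.
Let far y : N < `|y| -> 2 * L ^+ 2 <= T y.
Proof.
move=> yN; apply: le_trans (nsq_norm _).
have h : 2 * L <= `|y - x|.
  have := ler_normD (y - x) x; rewrite subrK; move: yN; rewrite /N; lra.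
apply: (@le_trans _ _ ((2 * L) ^+ 2)).
  by rewrite exprMn ler_wpM2r ?sqr_ge0// expr2; lra.
by rewrite ler_pXn2r ?nnegrE// mulr_ge0// ltW.
Qed.

Let q_out y : N < `|y| -> mq y = 0. Proof. by move=> /far/mq_out[]. Qed.
Lemma mH_out y : N < `|y| -> mH y = 0. Proof. by move=> /far/mq_out[]. Qed.

Let Ckq n : Ck n mq. Proof. exact: CkM. Qed.
Let Ckq1 n : Ck n q1.
Proof.
by apply: CkD; apply: CkM; try exact: Ck_cst; apply: CkM => //; apply: CkM.
Qed.
Let CkH n : Ck n mH.
Proof.
apply: CkD; apply: CkM; try exact: Ck_cst; first exact: Ckq.
by apply: CkM; [exact: CkT|exact: Ckq1].
Qed.
Let Ckg n b : Ck n (fun y => coor b (y - x) * mq y).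
Proof. by apply: CkM; [exact: Ck_shift|exact: Ckq]. Qed.

Lemma mH_itg : itg2 mH.
Proof. by apply: (itg2_cpt (N := N)); [exact: Ck_cont (CkH 0)|exact: mH_out]. Qed.

Let g b y := coor b (y - x) * mq y.
Let isdg j b p : is_partial j (g b) p ((j == b)%:R * mq p + coor b (p - x) * (2 * coor j (p - x) * q1 p)).
Proof. by apply: is_partialM; [exact: is_partial_shift|exact: isdq]. Qed.
Let g_out b y : N < `|y| -> g b y = 0. Proof. by move=> /q_out; rewrite /g => ->; rewrite mulr0. Qed.

Let I2H0 : I2 mH = 0.
Proof.
have -> : mH = (fun y => partial false (g false) y + partial true (g true) y).
  apply/funext => y; rewrite (partial_eq (isdg _ _ _)) (partial_eq (isdg _ _ _)) /mH /T nsqE /=; ring.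
rewrite I2D.
- by rewrite (div0_cpt false (Ckg 1 false) (@g_out false)) (div0_cpt true (Ckg 1 true) (@g_out true)) addr0.
- by apply: (itg2_cpt (N := N)) => [|y yN]; [apply: partial_cont; exact: Ckg|apply: partial_out yN; exact: g_out].
- by apply: (itg2_cpt (N := N)) => [|y yN]; [apply: partial_cont; exact: Ckg|apply: partial_out yN; exact: g_out].
Qed.

Let zH b y := coor b (y - x) * mH y.
Let zH_itg b : itg2 (zH b).
Proof.
apply: (itg2_cpt (N := N)); last by move=> y /mH_out; rewrite /zH => ->; rewrite mulr0.
by apply: (@Ck_cont _ 0); apply: CkM; [exact: Ck_shift|exact: CkH].
Qed.

(** The moment is itself a partial derivative of a function of compact support: d_b (T q) = 2 z_b q
    + 2 z_b T q' with z = y - x. *)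
Let I2zH0 b : I2 (zH b) = 0.
Proof.
have -> : zH b = partial b (fun y => T y * mq y).
  apply/funext => y; symmetry; apply: partial_eq; apply: is_partial_eq.
    by apply: is_partialM; [exact: is_partialT|exact: isdq].
  by rewrite /zH /mH; ring.
apply: (@div0_cpt _ _ N); first by apply: CkM; [exact: CkT|exact: Ckq].
by move=> y /q_out ->; rewrite mulr0.
Qed.

Let g_itg b : itg2 (g b).
Proof. by apply: (itg2_cpt (N := N)); [exact: Ck_cont (Ckg 0 b)|exact: g_out]. Qed.

(** The integrand is odd about [x]. In place of a change of variables, [zH b + g b] is recognized as
    the divergence of the field z_b z q, and [zH b] integrates to 0. *)
Let I2g0 b : I2 (g b) = 0.
Proof.
suff : I2 (fun y => zH b y + g b y) = 0 by rewrite I2D// I2zH0 add0r.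
pose k j y := coor b (y - x) * g j y.
have Ckk n j : Ck n (k j) by apply: CkM; [exact: Ck_shift|exact: Ckg].
have k_out j y : N < `|y| -> k j y = 0 by move=> /g_out; rewrite /k => ->; rewrite mulr0.
have -> : (fun y => zH b y + g b y) = (fun y => partial false (k false) y + partial true (k true) y).
  apply/funext => y.
  have isdk j : is_partial j (k j) y ((j == b)%:R * g j y + coor b (y - x) * ((j == j)%:R * mq y + coor j (y - x) * (2 * coor j (y - x) * q1 y))).
    by apply: is_partialM; [exact: is_partial_shift|exact: isdg].
  rewrite (partial_eq (isdk false)) (partial_eq (isdk true)) /zH /mH /T nsqE /g /=.
  by case: b {Ckk k_out isdk k} => /=; ring.
rewrite I2D.
- by rewrite (div0_cpt false (Ckk 1 false) (@k_out false)) (div0_cpt true (Ckk 1 true) (@k_out true)) addr0.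
- by apply: (itg2_cpt (N := N)) => [|y yN]; [apply: partial_cont; exact: Ckk|apply: partial_out yN; exact: k_out].
- by apply: (itg2_cpt (N := N)) => [|y yN]; [apply: partial_cont; exact: Ckk|apply: partial_out yN; exact: k_out].
Qed.

(** The equation is tested with [coor b (y - x) * mq y], whose Laplacian is a partial derivative of
    [mH]; one integration by parts puts this derivative on [Psi], the only one that a C^1 function
    affords. The constant 2 Omega integrates to 0 against the odd test function and [Omega * coor b]
    integrates to 0 against [mH], so [Psi] may be completed to Theta. *)
Lemma weak_mollified b (Psi : R * R -> R) (D1 D2 : set (R * R)) (s Omega : R) :
  open D1 -> open D2 -> Ck 1 Psi ->
  weak_laplacian Psi (fun p => s * \1_D1 p + s * \1_D2 p - 2 * Omega) ->
  I2 (fun y => (partial b Psi y + Omega * coor b y) * mH y) =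
  - I2 (fun y => (s * \1_D1 y + s * \1_D2 y) * (coor b (y - x) * mq y)).
Proof.
move=> oD1 oD2 cPsi wl.
pose chi y := s * \1_D1 y + s * \1_D2 y.
have mchi : mf2 chi.
  by apply: mf2D; apply: mf2Z; exact: mf2_indic.
have chig : itg2 (fun y => chi y * g b y).
  apply: (itg2_dom (g := fun y => 2 * `|s| * `|g b y|)).
  - by apply: mf2M => //; exact: itg2_mf (g_itg b).
  - by apply: itg2Z; apply: itg2_abs; exact: g_itg.
  - move=> p; rewrite normrM ler_wpM2r// /chi !indicE.
    by case: (p \in D1); case: (p \in D2); rewrite ?(mulr1, mulr0, addr0, add0r, normr0) ?mulr_ge0//;
      rewrite ?(le_trans (ler_normD _ _)) ?mulr_natl// ?mulr2n// lerDl.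
have := wl _ (test_functionI (fun n => Ckg n b) (g_out b)).
move=> /(congr1 fine).
rewrite -[LHS]/(I2 (fun p => Psi p * laplacian (g b) p)).
rewrite -[RHS]/(I2 (fun p => (chi p - 2 * Omega) * g b p)).
have -> : (fun p => Psi p * laplacian (g b) p) = (fun p => Psi p * partial b mH p).
  by apply/funext => p; rewrite (lap_radial b isdq isdq1).
have -> : (fun p => (chi p - 2 * Omega) * g b p) = (fun p => chi p * g b p - 2 * Omega * g b p).
  by apply/funext => p; rewrite mulrBl.
rewrite I2B//; last exact: itg2Z.
rewrite I2Z// I2g0 mulr0 subr0 => <-.
have dH_out j y : N < `|y| -> partial j mH y = 0 by apply: partial_out; exact: mH_out.
have i1 : itg2 (fun p => Psi p * partial b mH p).
  apply: (itg2_cpt (N := N)); last by move=> y /dH_out ->; rewrite mulr0.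
  by move=> y; apply: cvgM; [exact: (Ck_cont cPsi)|exact: (partial_cont (CkH 1))].
have i2 : itg2 (fun p => partial b Psi p * mH p).
  apply: (itg2_cpt (N := N)); last by move=> y /mH_out ->; rewrite mulr0.
  by move=> y; apply: cvgM; [exact: (partial_cont cPsi)|exact: (Ck_cont (CkH 1))].
have ibp : I2 (fun p => partial b Psi p * mH p) + I2 (fun p => Psi p * partial b mH p) = 0.
  rewrite -I2D//.
  have -> : (fun p => partial b Psi p * mH p + Psi p * partial b mH p) = partial b (fun p => Psi p * mH p).
    apply/funext => p; symmetry; apply: partial_eq; apply: is_partialM; first exact: is_partial_Ck.
    exact: is_partial_Ck (CkH 1).
  apply: (@div0_cpt _ _ N); first by apply: CkM.
  by move=> y /mH_out ->; rewrite mulr0.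
have -> : (fun y => (partial b Psi y + Omega * coor b y) * mH y) =
   (fun y => partial b Psi y * mH y + (Omega * zH b y + Omega * coor b x * mH y)).
  apply/funext => y; rewrite /zH.
  have -> : coor b (y - x) = coor b y - coor b x by case: (b).
  by ring.
rewrite I2D//; last by apply: itg2D; apply: itg2Z => //; exact: mH_itg.
rewrite I2D//; [|exact: itg2Z|by apply: itg2Z; exact: mH_itg].
rewrite !I2Z//; [|exact: mH_itg].
rewrite I2zH0 I2H0 !mulr0 !addr0.
by apply/eqP; rewrite -addr_eq0 ibp.
Qed.

End Mollifier.
End Dir.

(** * The Newtonian representation of grad Theta *)

Section Repr.
Context {R : realType}.
Implicit Types (f g h : R * R -> R) (p x y : R * R) (b j : bool).

Lemma nsq_norm2 p : nsq p <= 2 * `|p| ^+ 2.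
Proof.
have h1 : `|p.1| <= `|p| by rewrite prod_normE/= le_max lexx.
have h2 : `|p.2| <= `|p| by rewrite prod_normE/= le_max lexx orbT.
rewrite /nsq -(real_normK (num_real p.1)) -(real_normK (num_real p.2)) mulr_natl mulr2n.
by apply: lerD; rewrite ler_pXn2r ?nnegrE.
Qed.

Lemma nsqC x y : nsq (x - y) = nsq (y - x).
Proof. by rewrite /nsq /=; ring. Qed.

(** A component of the gradient of log(|z|^2 + d^2) / (4 pi): the Newtonian kernel smoothed at scale
    d, odd and bounded. *)
Definition kern b (d : R) z : R := (2 * pi)^-1 * (coor b z / (nsq z + d ^+ 2)).

Lemma coor_norm b p : `|coor b p| <= `|p|.
Proof. by case: b; rewrite prod_normE/= le_max lexx ?orbT. Qed.

Lemma coor_cont b : continuous (coor b : R * R -> R).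
Proof. exact: (Ck_cont (Ck_co 0 b)). Qed.

Lemma kern_cont b d : 0 < d -> continuous (kern b d).
Proof.
move=> d0 z; apply: cvgM; first exact: cvg_cst.
apply: cvgM; first exact: coor_cont.
apply: cvgV; first by rewrite gt_eqF// nsqd_gt0.
by apply: cvgD; [exact: nsq_cont|exact: cvg_cst].
Qed.

Lemma kern_bdd b d z : 0 < d -> `|kern b d z| <= (2 * pi)^-1 * (1 + d ^- 2).
Proof.
move=> d0; have p0 : 0 < 2 * pi :> R by rewrite mulr_gt0// pi_gt0.
rewrite /kern normrM gtr0_norm ?invr_gt0// ler_pM2l ?invr_gt0//.
have t0 := nsqd_gt0 z d0.
rewrite normrM normfV (gtr0_norm t0) ler_pdivrMr//.
have zn := coor_norm b z; have n1 := nsq_norm z.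
have d2 : 0 < d ^+ 2 by rewrite exprn_gt0.
have -> : (1 + d ^- 2) * (nsq z + d ^+ 2) = nsq z + d ^+ 2 + nsq z / d ^+ 2 + 1.
  by field; rewrite lt0r_neq0.
have q0 : 0 <= nsq z / d ^+ 2 by rewrite divr_ge0 ?nsq_ge0// ltW.
have : `|z| <= `|z| ^+ 2 + 1 by have := sqr_ge0 (`|z| - 1); have := sqr_ge0 `|z|; rewrite sqrrB1; lra.
lra.
Qed.

Lemma kernN b d z : kern b d (- z) = - kern b d z.
Proof.
rewrite /kern; have -> : nsq (- z) = nsq z by rewrite /nsq /=; ring.
have -> : coor b (- z) = - coor b z by case: b.
by rewrite mulNr mulrN.
Qed.

Section Main.
Variables (Psi : R * R -> R) (D1 D2 : set (R * R)) (s Omega : R).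
Hypotheses (oD1 : open D1) (oD2 : open D2) (bD1 : bounded_set D1) (bD2 : bounded_set D2).
Hypothesis cPsi : Ck 1 Psi.
Hypothesis wl : weak_laplacian Psi (fun p => s * \1_D1 p + s * \1_D2 p - 2 * Omega).
Hypothesis far : grad (fun p => Psi p + 2^-1 * Omega * (p.1 ^+ 2 + p.2 ^+ 2)) q
          @[q --> infty_nbhs (R * R)%type] --> ((0, 0) : R * R).

Definition dTheta b y := partial b Psi y + Omega * coor b y.

Lemma dTheta_cont b : continuous (dTheta b).
Proof.
move=> y; apply: cvgD; first exact: (partial_cont cPsi).
by apply: cvgM; [exact: cvg_cst|exact: coor_cont].
Qed.

Lemma dTheta_far b e : 0 < e -> exists M0 : R, forall p, M0 < `|p| -> `|dTheta b p| <= e.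
Proof.
move=> e0.
have [M M0 hM] : infty_nbhs (R * R)%type [set q | `|grad (fun p => Psi p + 2^-1 * Omega * (p.1 ^+ 2 + p.2 ^+ 2)) q| <= e].
  suff /far : nbhs ((0, 0) : R * R) [set v | `|v| <= e] by [].
  apply/nbhs_ballP; exists e => //= v [/= h1 h2]; move: h1 h2.
  by rewrite /ball/= !sub0r !normrN prod_normE/= ge_max => /ltW -> /ltW ->.
exists M => p /hM; rewrite /= /grad prod_normE/= ge_max => /andP[h1 h2].
have isdQ j : is_partial j (fun p : R * R => Psi p + 2^-1 * Omega * (p.1 ^+ 2 + p.2 ^+ 2)) p (dTheta j p).
  have -> : (fun p : R * R => Psi p + 2^-1 * Omega * (p.1 ^+ 2 + p.2 ^+ 2)) =
     (fun p => Psi p + (2^-1 * Omega) * nsq (p - 0)).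
    by apply/funext => q; rewrite subr0.
  apply: is_partial_eq; first by apply: is_partialD; [exact: is_partial_Ck|apply: is_partialZ; exact: is_partial_nsq].
  by rewrite subr0 /dTheta; field.
by case: b; [rewrite -(partial_eq (isdQ true))|rewrite -(partial_eq (isdQ false))].
Qed.

Lemma dTheta_bdd b : exists2 M, 0 <= M & forall y, `|dTheta b y| <= M.
Proof.
have [M0 h0] := dTheta_far b (@ltr01 R).
have [M M0' hM] := continuous_bddP M0 (@dTheta_cont b).
exists (M + 1); first by rewrite addr_ge0.
move=> y; have [/hM h|/h0 h] := leP `|y| M0; first by rewrite (le_trans h)// lerDl.
by rewrite (le_trans h)// lerDr.
Qed.

Lemma chi_kern_itg b d x : 0 < d ->
  itg2 (fun y => (s * \1_D1 y + s * \1_D2 y) * kern b d (x - y)).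
Proof.
move=> d0.
have [N1 N10 hN1] := bounded_setP bD1; have [N2 N20 hN2] := bounded_setP bD2.
pose B := (2 * pi)^-1 * (1 + d ^- 2).
have B0 : 0 <= B.
  by rewrite mulr_ge0 ?invr_ge0 ?mulr_ge0 ?pi_ge0 ?addr_ge0 ?invr_ge0 ?sqr_ge0.
have mchi : mf2 (fun y => s * \1_D1 y + s * \1_D2 y).
  by apply: mf2D; apply: mf2Z; exact: mf2_indic.
have sB : 0 <= 2 * `|s| * B by rewrite mulr_ge0// mulr_ge0.
apply: (itg2_bdd (M := 2 * `|s| * B + N1 + N2)).
- apply: mf2M => //; apply: mf2_cont => y.
  apply: (continuous_comp (f := fun y => x - y)); last exact: kern_cont.
  by apply: cvgB; [exact: cvg_cst|exact: cvg_id].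
- move=> y; rewrite -addrA; apply: (@le_trans _ _ (2 * `|s| * B)); last by rewrite lerDl addr_ge0.
  rewrite normrM ler_pM//; last exact: kern_bdd.
  rewrite !indicE; have s0 := normr_ge0 s.
  by case: (y \in D1); case: (y \in D2); rewrite ?(mulr1, mulr0, addr0, add0r, normr0);
     rewrite ?(le_trans (ler_normD _ _)) ?mulr_natl ?mulr2n ?lerDl ?addr_ge0.
- move=> y yN; rewrite !indicE !memNset ?mulr0 ?addr0 ?mul0r//.
    by move=> /hN2; move: yN sB N10; lra.
  by move=> /hN1; move: yN sB N20; lra.
Qed.

(* The kernels [eta d] are the divergences of [kern], so that the potential of the
   vorticity is, up to a small term supported far away, a mollification of dTheta. *)
Lemma chi_kern_mollified b e : 0 < e -> exists2 M, 0 <= M & forall x, exists h,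
  [/\ continuous h, forall y, `|h y| <= M, h x = dTheta b x & forall d, 0 < d ->
  `|I2 (fun y => (s * \1_D1 y + s * \1_D2 y) * kern b d (x - y))
    - I2 (fun y => h y * eta d (y - x))| <= e].
Proof.
move=> e0.
have [K K0 hK] := @cutoff'_bdd R.
have [M M0 hM] := dTheta_bdd b.
exists M => // x.
pose e' := e / (9 * K + 1).
have K1 : 0 < 9 * K + 1 by rewrite ltr_wpDl// mulr_ge0.
have e'0 : 0 < e' by rewrite !divr_gt0.
have [M1 hM1] := dTheta_far b e'0.
have [N1 N10 hN1] := bounded_setP bD1; have [N2 N20 hN2] := bounded_setP bD2.
(* The factor 2 leaves room for comparing the maximum norm with the Euclidean one: both patches lie
   in T <= L^2, where the cutoff is 1, and the annulus T > L^2 lies in |y| > M1, where [dTheta] is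
   at most e'. *)
pose L := 2 * (`|x| + `|M1| + N1 + N2 + 1).
have nx : 0 <= `|x| := normr_ge0 x.
have nM1 : 0 <= `|M1| := normr_ge0 M1.
have L0 : 0 < L by rewrite /L; lra.
pose T y := nsq (y - x).
pose c y := cutoff (T y / L ^+ 2).
pose c1 y := cutoff' (T y / L ^+ 2).
have L2 : 0 < L ^+ 2 by rewrite exprn_gt0.
have cT : continuous T by move=> y; apply: (continuous_comp (@sub_cont2 _ x _)); exact: nsq_cont.
have cTL : continuous (fun y => T y / L ^+ 2) by move=> y; apply: cvgM; [exact: cT|exact: cvg_cst].
have cc : continuous c.
  move=> y; apply: (continuous_comp (cTL _)).
  by apply/differentiable_continuous/derivable1_diffP; have [] := cutoff_derive (T y / L ^+ 2).
have cc1 : continuous c1 by move=> y; apply: (continuous_comp (cTL _)); exact: cutoff'_cont.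
pose h y := dTheta b y * c y.
have ch : continuous h by move=> y; apply: cvgM; [exact: dTheta_cont|exact: cc].
have hb y : `|h y| <= M.
  by rewrite normrM -[leRHS]mulr1 ler_pM// ger0_norm ?cutoff_ge0// cutoff_le.
have hx : h x = dTheta b x.
  by rewrite /h /c /T subrr /nsq /= !expr0n /= addr0 mul0r cutoff_le1// mulr1.
exists h; split=> // d dp.
have T0 y : 0 <= T y by exact: nsq_ge0.
have Td y : 0 < T y + d ^+ 2 by exact: nsqd_gt0.
have pi0 : 0 < pi :> R := pi_gt0 R.
pose E2 y := pi^-1 * (L ^- 2 * (c1 y * (T y / (T y + d ^+ 2)))).
have mHE' y : mH d L x y = 2 * pi * (c y * eta d (y - x) + E2 y).
  rewrite mHE// /eta -/(T y) -/(c y) -/(c1 y) /E2.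
  move: (Td y); move: (T y) (c y) (c1 y) => t u v t0.
  move: L0; generalize L => l /lt0r_neq0 l0; move: t0 pi0 => /lt0r_neq0 t0 /lt0r_neq0 pi0.
  by rewrite -[LHS]mul1r -(divff pi0); ring.
have [ie1 Ie1] := eta_int x dp; have [ie2 Ie2] := eta_int x L0.
have i1 : itg2 (fun y => h y * eta d (y - x)).
  apply: itg2_dom (itg2Z M ie1) _; first by apply: mf2M; [exact: mf2_cont|exact: mf2_eta].
  by move=> y; rewrite normrM (ger0_norm (eta_ge0 _ _)) ler_wpM2r ?eta_ge0.
(* On the annulus T + L^2 <= 3 L^2, hence L^-2 <= 9 L^2 / (T + L^2)^2. The error is thus dominated
   by a multiple of [eta L], of integral 1 whatever L is; this is the origin of the 9 in [e']. *)
have E2b y : `|dTheta b y * E2 y| <= e' * (9 * K) * eta L (y - x).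
  have [Ty|Ty] := leP (T y) (L ^+ 2).
    rewrite /E2 /c1 cutoff'_out ?ler_pdivrMr ?mul1r ?Ty// mul0r !mulr0 normr0.
    by apply: mulr_ge0; [apply: mulr_ge0; [exact: ltW|exact: mulr_ge0]|exact: eta_ge0].
  have [Ty2|Ty2] := leP (2 * L ^+ 2) (T y).
    rewrite /E2 /c1 cutoff'_out ?ler_pdivlMr ?Ty2 ?orbT// mul0r !mulr0 normr0.
    by apply: mulr_ge0; [apply: mulr_ge0; [exact: ltW|exact: mulr_ge0]|exact: eta_ge0].
  have yM : M1 < `|y|.
    have h1 := nsq_norm2 (y - x).
    have h2 : L / 2 < `|y - x|.
      rewrite ltNge; apply/negP => h3.
      have h4 : `|y - x| ^+ 2 <= (L / 2) ^+ 2 by rewrite ler_pXn2r ?nnegrE// divr_ge0// ltW.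
      move: Ty h1 h4; rewrite -/(T y) expr_div_n; move: L2; lra.
    have h3 := ler_normB y x; have := ler_norm M1; move: h2; rewrite /L; lra.
  rewrite normrM -[leRHS]mulrA ler_pM ?hM1//.
  have a1 : `|pi^-1 : R| = pi^-1 by rewrite gtr0_norm// invr_gt0.
  have a2 : `|L ^- 2| = L ^- 2 by rewrite gtr0_norm// invr_gt0.
  have a3 : `|T y / (T y + d ^+ 2)| <= 1.
    rewrite normrM normfV (ger0_norm (T0 y)) (gtr0_norm (Td y)) ler_pdivrMr// mul1r lerDl sqr_ge0//.
  have -> : `|E2 y| = pi^-1 * (L ^- 2 * (`|c1 y| * `|T y / (T y + d ^+ 2)|)).
    by rewrite /E2 (normrM pi^-1) (normrM (L ^- 2)) (normrM (c1 y)) a1 a2.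
  rewrite /eta -/(T y).
  have -> : 9 * K * (pi^-1 * (L ^+ 2 / (T y + L ^+ 2) ^+ 2)) = pi^-1 * (K * (9 * L ^+ 2 / (T y + L ^+ 2) ^+ 2)) by ring.
  rewrite ler_pM2l ?invr_gt0//.
  apply: (@le_trans _ _ (L ^- 2 * (K * 1))).
    rewrite ler_pM2l ?invr_gt0// ler_pM//; exact: hK.
  rewrite mulr1 mulrC ler_wpM2l// ler_pdivlMr ?exprn_gt0 ?ltr_wpDl//.
  rewrite mulrC ler_pdivrMr//.
  have : (T y + L ^+ 2) ^+ 2 <= (3 * L ^+ 2) ^+ 2.
    have tl : T y + L ^+ 2 <= 3 * L ^+ 2 by move: Ty2; lra.
    have tl0 : 0 <= T y + L ^+ 2 by rewrite addr_ge0// ltW.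
    by rewrite ler_pXn2r ?nnegrE// (le_trans tl0).
  by rewrite exprMn; move: (L ^+ 2) => l; lra.
have i2 : itg2 (fun y => dTheta b y * E2 y).
  apply: itg2_dom (itg2Z (e' * (9 * K)) ie2) _ => //.
  apply: mf2_cont => y; apply: cvgM; first exact: dTheta_cont.
  apply: cvgM; first exact: cvg_cst.
  apply: cvgM; first exact: cvg_cst.
  apply: cvgM; first exact: cc1.
  apply: cvgM; first exact: cT.
  apply: cvgV; first by rewrite gt_eqF.
  by apply: cvgD; [exact: cT|exact: cvg_cst].
have key : I2 (fun y => (s * \1_D1 y + s * \1_D2 y) * kern b d (x - y)) =
    I2 (fun y => h y * eta d (y - x)) + I2 (fun y => dTheta b y * E2 y).
  have := weak_mollified dp L0 x b oD1 oD2 cPsi wl.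
  have -> : (fun y => (partial b Psi y + Omega * coor b y) * mH d L x y) =
     (fun y => 2 * pi * (h y * eta d (y - x) + dTheta b y * E2 y)).
    by apply/funext => y; rewrite mHE' /h /dTheta; ring.
  rewrite I2Z; last exact: itg2D.
  rewrite I2D// => /(congr1 (fun t => (2 * pi)^-1 * t)).
  have -> : (fun y => (s * \1_D1 y + s * \1_D2 y) * (coor b (y - x) * mq d L x y)) =
    (fun y => - (2 * pi) * ((s * \1_D1 y + s * \1_D2 y) * kern b d (x - y))).
    apply/funext => y; rewrite /mq /kern (nsqC x y) -/(T y) -/(c y).
    have -> : coor b (y - x) = - coor b (x - y) by case: (b); rewrite /= opprB.
    rewrite !indicE.
    have [yD|yD] := boolP ((y \in D1) || (y \in D2)).
      have -> : c y = 1.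
        apply: cutoff_le1; rewrite ler_pdivrMr// mul1r.
        apply: (le_trans (nsq_norm2 _)).
        have h1 : `|y - x| <= L / 2.
          apply: (le_trans (ler_normB _ _)).
          case/orP : yD => /set_mem; [move=> /hN1|move=> /hN2]; rewrite /L; lra.
        have h2 : `|y - x| ^+ 2 <= (L / 2) ^+ 2 by rewrite ler_pXn2r ?nnegrE// divr_ge0// ltW.
        by move: h2; rewrite expr_div_n; move: L2; lra.
      have p2 : 2 * pi != 0 :> R by rewrite gt_eqF// mulr_gt0.
      move: p2; move: (2 * pi) (s * _ + s * _) (coor b (x - y)) (T y + d ^+ 2) => P A k t p2.
      by rewrite div1r -[LHS]mul1r -(divff p2); ring.
    move: yD; rewrite negb_or => /andP[/negbTE -> /negbTE ->].
    by rewrite !mulr0 addr0 !mul0r !mulr0.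
  rewrite I2Z; last exact: chi_kern_itg.
  have p2 : 2 * pi != 0 :> R by rewrite gt_eqF// mulr_gt0.
  by rewrite mulNr opprK !(mulKf p2) => ->.
rewrite key addrAC subrr add0r.
have := I2_abs i2 (itg2Z (e' * (9 * K)) ie2) E2b.
rewrite I2Z// Ie2 mulr1 => /le_trans; apply.
have -> : e = e' * (9 * K + 1) by rewrite /e' divfK// gt_eqF.
by rewrite ler_pM2l// lerDl.
Qed.
Lemma representation b x : forall e, 0 < e ->
  exists2 d0, 0 < d0 & forall d, 0 < d -> d < d0 ->
  `|I2 (fun y => (s * \1_D1 y + s * \1_D2 y) * kern b d (x - y)) - dTheta b x| <= e.
Proof.
move=> e e0; have e2 : 0 < e / 2 by rewrite divr_gt0.
have [M M0 /(_ x)[h [ch hb hx hd]]] := chi_kern_mollified b e2.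
have [d0 d00 hd0] := mollify (mf2_cont ch) hb (ch x) e2.
exists d0 => // d dp dd0; rewrite -hx.
have {}hd0 := hd0 d dp dd0; have {}hd := hd d dp.
apply: le_trans (ler_distD (I2 (fun y => h y * eta d (y - x))) _ _) _.
by rewrite (splitr e) lerD.
Qed.

(** The independence of [x] and [d] supplies the domination in [potential_limit]. It holds because
    the mollified functions are bounded by a bound for [dTheta] and [eta d] has mass 1. *)
Lemma chi_kern_bdd b : exists2 M, 0 <= M & forall x d, 0 < d ->
  `|I2 (fun y => (s * \1_D1 y + s * \1_D2 y) * kern b d (x - y))| <= M.
Proof.
have [M M0 hM] := chi_kern_mollified b ltr01.
exists (M + 1); first by rewrite addr_ge0.
move=> x d d0; have [h [ch hb _ hd]] := hM x.
have [ie Ie] := eta_int x d0.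
have h1 : `|I2 (fun y => h y * eta d (y - x))| <= M.
  have fb y : `|h y * eta d (y - x)| <= M * eta d (y - x).
    by rewrite normrM (ger0_norm (eta_ge0 _ _)) ler_wpM2r ?eta_ge0.
  have fi : itg2 (fun y => h y * eta d (y - x)).
    by apply: itg2_dom (itg2Z M ie) fb; apply: mf2M; [exact: mf2_cont|exact: mf2_eta].
  by have := I2_abs fi (itg2Z M ie) fb; rewrite I2Z// Ie mulr1.
rewrite -[X in `|X|](subrK (I2 (fun y => h y * eta d (y - x)))).
by apply: le_trans (ler_normD _ _) _; rewrite addrC lerD// hd.
Qed.
End Main.
End Repr.

(** * Positivity of integrals and the second moment *)

Section Energy0.
Context {R : realType}.
Implicit Types (f g h : R * R -> R) (p x y : R * R) (b j : bool) (D : set (R * R)).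

Lemma closed_vanish_cont D f : open D -> continuous f ->
  (forall p, closure D p -> ~ D p -> f p = 0) -> continuous (fun p => f p * \1_D p).
Proof.
move=> oD cf f0 p; have [Dp|nDp] := pselect (D p).
  apply: (@cvg_trans _ (f q @[q --> p])); last first.
    by rewrite indicE mem_set// mulr1; exact: cf.
  apply: near_eq_cvg; have : nbhs p D by exact: open_nbhs_nbhs.
  by apply: filterS => q Dq; rewrite indicE mem_set// mulr1.
rewrite /continuous_at indicE memNset// mulr0.
have [cDp|ncDp] := pselect (closure D p); last first.
  apply: cvg_near_cst.
  have : nbhs p (~` closure D) by apply: open_nbhs_nbhs; split => //; apply: closed_openC; exact: closed_closure.
  apply: filterS => q nq; rewrite indicE memNset ?mulr0// => /subset_closure.
  exact: nq.
apply/cvgrPdist_le => e e0; have := cf p; rewrite /continuous_at (f0 _ cDp nDp) => /cvgrPdist_le/(_ e e0).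
apply: filterS => q; rewrite !sub0r !normrN normrM => h.
apply: le_trans h; rewrite ler_piMr// indicE; case: (q \in D); by rewrite ?normr1 ?normr0.
Qed.

(** On a small ball [f] exceeds half of its value at [p0]. A box inside the ball shows that its
    measure is positive, a box around it that the measure is finite, so that [fine] does not return
    its default value 0. *)
Lemma I2_open_gt0 D f p0 : open D -> bounded_set D -> continuous f -> D p0 ->
  (forall p, D p -> 0 <= f p) -> 0 < f p0 -> 0 < I2 (fun p => f p * \1_D p).
Proof.
move=> oD bD cf Dp0 f0 fp0.
have : nbhs p0 (D `&` [set p | f p0 / 2 < f p]).
  apply: filterI; first exact: open_nbhs_nbhs.
  have : nbhs (f p0) [set t | f p0 / 2 < t] by apply: lt_nbhsr; rewrite ltr_pdivrMr// ltr_pMr// ltr1n.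
  exact: cf.
move=> /nbhs_ballP[e /= e0 he].
pose U : set (R * R) := ball p0 e.
have oU : open U by exact: ball_open.
have bU : bounded_set U.
  have [N N0 hN] := bounded_setP bD.
  exists N; split; first exact: num_real.
  by move=> M NM p /he[/hN pN _] /=; rewrite ltW// (le_lt_trans pN).
have i1 := itg2_cont_indic oD bD cf.
have i2 : itg2 (fun p => f p0 / 2 * \1_U p) by apply: itg2_cont_indic => // p; exact: cvg_cst.
have le12 p : f p0 / 2 * \1_U p <= f p * \1_D p.
  rewrite !indicE; have [/set_mem/he[Dp /= /ltW fp]|_] := boolP (p \in U).
    by rewrite mem_set// !mulr1.
  rewrite mulr0; have [/set_mem/f0|_] := boolP (p \in D); by rewrite ?mulr1 ?mulr0.
apply: lt_le_trans (I2_le i2 i1 le12).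
rewrite I2Z; last by apply: (itg2_ext (f := fun p => 1 * \1_U p)) => [p|]; rewrite ?mul1r//; apply: itg2_cont_indic => // p; exact: cvg_cst.
rewrite mulr_gt0 ?divr_gt0//.
pose c := e / 2.
have c0 : 0 < c by rewrite divr_gt0.
pose K : set (R * R) := `[p0.1 - c, p0.1 + c] `*` `[p0.2 - c, p0.2 + c].
have KU : K `<=` U.
  move=> [x y] [/=]; rewrite !in_itv/= => /andP[a1 a2] /andP[b1 b2].
  split; rewrite /ball/= ltr_norml; move: a1 a2 b1 b2 c0; rewrite /c; lra.
have mK : measurable (K : set (measurableTypeR R * measurableTypeR R)).
  by apply: measurableX; exact: measurable_itv.
have mU : measurable (U : set (measurableTypeR R * measurableTypeR R)) by exact: open_measurable2.
have KUm := le_measure (@plane_measure R) (mem_set mK) (mem_set mU) KU.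
have pK : plane_measure K = ((p0.1 + c - (p0.1 - c)) * (p0.2 + c - (p0.2 - c)))%:E.
  by apply: plane_box; move: c0; lra.
have : (((p0.1 + c - (p0.1 - c)) * (p0.2 + c - (p0.2 - c)))%:E <= plane_measure U)%E by rewrite -pK; exact: KUm.
have -> : I2 \1_U = fine (plane_measure U).
  by rewrite /I2 /Rintegral integral_indic// setIT.
pose V : set (R * R) := `[p0.1 - e, p0.1 + e] `*` `[p0.2 - e, p0.2 + e].
have UV : U `<=` V.
  move=> [x y] [/=]; rewrite /ball/= !ltr_norml => /andP[a1 a2] /andP[b1 b2].
  split; rewrite /= in_itv/=; apply/andP; move: a1 a2 b1 b2; lra.
have mV : measurable (V : set (measurableTypeR R * measurableTypeR R)).
  by apply: measurableX; exact: measurable_itv.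
have UVm := le_measure (@plane_measure R) (mem_set mU) (mem_set mV) UV.
have pV : plane_measure V = ((p0.1 + e - (p0.1 - e)) * (p0.2 + e - (p0.2 - e)))%:E.
  by apply: plane_box; move: e0; lra.
have : (plane_measure U <= ((p0.1 + e - (p0.1 - e)) * (p0.2 + e - (p0.2 - e)))%:E)%E by rewrite -pV; exact: UVm.
case: (plane_measure U) => [r| |]//= _; rewrite lee_fin; apply: lt_le_trans.
by rewrite mulr_gt0//; move: c0; lra.
Qed.

Lemma nsq_disc (r : R) : 0 < r -> open [set p : R * R | nsq p < r] /\ bounded_set [set p : R * R | nsq p < r].
Proof.
move=> r0; split.
  have := @open_comp _ _ (@nsq R) [set t | t < r].
  apply; last exact: open_lt.
  by move=> q _; exact: nsq_cont.
exists (r + 1); split; first exact: num_real.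
move=> M rM p /= pr; rewrite leNgt; apply/negP => Mp.
have := nsq_norm p; have : r + 1 <= `|p| ^+ 2; last by move: pr; lra.
rewrite expr2; apply: (@le_trans _ _ ((r + 1) * 1)); first by rewrite mulr1.
by apply: ler_pM; move: Mp rM r0; lra.
Qed.

(** The two sides are in fact equal; polar coordinates are avoided. The field p q(p), with [q] as
    below, vanishes on the circle and has divergence 4 (r - |p|^2) / r^2 - 2 pi k [eta d]. Since
    [eta d] has mass at most 1 on the disc and k tends to 1, the bound follows as d tends to 0. *)
Lemma disc_moment (r : R) : 0 < r -> I2 (fun p => (r - nsq p) * \1_[set p | nsq p < r] p) <= pi * r ^+ 2 / 2.
Proof.
move=> r0; have [oD bD] := nsq_disc r0; set D := [set p : R * R | nsq p < r] in oD bD *.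
have key (d : R) : 0 < d -> I2 (fun p => (r - nsq p) * \1_D p) <= pi * r ^+ 2 / 2 + pi * r * d ^+ 2 / 2.
  move=> d0.
  (* This value makes [q] vanish on the circle |p|^2 = r. *)
  pose k := (r + d ^+ 2) / r.
  pose q p := 2 / r + (- r ^- 2 * nsq (p - 0) + - k * (nsq (p - 0) + d ^+ 2)^-1).
  have t0 p : 0 < nsq (p - 0) + d ^+ 2 by exact: nsqd_gt0.
  pose q1 p := - r ^- 2 + k * (nsq (p - 0) + d ^+ 2)^-1 ^+ 2.
  have ckq : Ck 1 q.
    apply: CkD; first exact: Ck_cst.
    apply: CkD; first by apply: CkM; [exact: Ck_cst|exact: Ck_nsq].
    apply: CkM; first exact: Ck_cst.
    apply: Ck_inv; first by move=> p; rewrite gt_eqF.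
    by apply: CkD; [exact: Ck_nsq|exact: Ck_cst].
  have isdq j p : is_partial j q p (2 * coor j p * q1 p).
    apply: is_partial_eq.
      apply: is_partialD; first exact: is_partial_cst.
      apply: is_partialD; first by apply: is_partialZ; exact: is_partial_nsq.
      apply: is_partialZ; apply: (is_partial_comp (F := fun t => t^-1) (h := fun y => nsq (y - 0) + d ^+ 2)).
        have tn : nsq (p - 0) + d ^+ 2 != 0 by rewrite gt_eqF.
        refine (is_derive_eq (df := - (nsq (p - 0) + d ^+ 2)^-1 ^+ 2) (@is_deriveV R id (nsq (p - 0) + d ^+ 2) _ 1 tn (is_derive_id _ (1 : R))) _).
        by rewrite /GRing.scale/= mulr1 exprVn.
      by apply: is_partialD; [exact: is_partial_nsq|exact: is_partial_cst].
    by rewrite /q1 subr0; ring.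
  have isdg j p : is_partial j (fun p => coor j p * q p) p (q p + coor j p * (2 * coor j p * q1 p)).
    by apply: is_partial_eq; [apply: is_partialM; [exact: is_partial_co|exact: isdq]|rewrite eqxx mul1r].
  have ckg j : Ck 1 (fun p => coor j p * q p) by apply: CkM => //; exact: Ck_co.
  have g0 j p : closure D p -> ~ D p -> coor j p * q p = 0.
    move=> cD nD; have np : nsq p = r.
      apply/eqP; rewrite eq_le; apply/andP; split; last by rewrite leNgt; apply/negP.
      have cl : closed [set p : R * R | nsq p <= r].
        apply: (closed_comp (f := @nsq R) (D := [set t | t <= r])); last exact: closed_le.
        by move=> z _; exact: nsq_cont.
      suff : closure D `<=` [set p : R * R | nsq p <= r] by move=> /(_ _ cD).
      rewrite [X in _ `<=` X](closure_id _).1//; apply: closureS => z /=; exact: ltW.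
    rewrite /q subr0 np /k.
    have rd : r + d ^+ 2 != 0 by rewrite gt_eqF// addr_gt0// exprn_gt0.
    by rewrite mulNr mulNr mulrAC divff//; field; rewrite gt_eqF.
  have i1 j : itg2 (fun p => partial j (fun p => coor j p * q p) p * \1_D p).
    by apply: itg2_cont_indic => //; exact: partial_cont.
  have S0 : I2 (fun p => (partial false (fun p => coor false p * q p) p * \1_D p + partial true (fun p => coor true p * q p) p * \1_D p)) = 0.
    by rewrite I2D// !partial_div0// ?addr0//; exact: g0.
  have cn : continuous (fun p => r - nsq p).
    by move=> p; apply: cvgB; [exact: cvg_cst|exact: nsq_cont].
  have iJ := itg2_cont_indic oD bD cn.
  have [ie Ie] := eta_int (0 : R * R) d0.
  have ie0 : itg2 (fun p => eta d (p - 0) * \1_D p).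
    apply: itg2_cont_indic => // p; apply: (continuous_comp (@sub_cont2 _ 0 _)); exact: eta_cont.
  have e1 : I2 (fun p => eta d (p - 0) * \1_D p) <= 1.
    rewrite -Ie; apply: I2_le => // p; by rewrite ler_piMr ?eta_ge0// indicE; case: (p \in D).
  have E : I2 (fun p => 4 / r ^+ 2 * ((r - nsq p) * \1_D p) - 2 * k * pi * (eta d (p - 0) * \1_D p)) = 0.
    rewrite -S0; apply: I2_ext => p.
    rewrite (partial_eq (isdg _ _)) (partial_eq (isdg _ _)) /q /q1 /eta.
    have pn := lt0r_neq0 (pi_gt0 R).
    have dn := lt0r_neq0 (t0 p); move: dn; rewrite subr0 => dn.
    have hpi (X c : R) : 2 * k * pi * (pi^-1 * X * c) = 2 * k * (X * c).
      by rewrite -[RHS]mulr1 -(divff pn); ring.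
    rewrite hpi.
    move: dn; rewrite nsqE; generalize k, (\1_D p : R), (coor false p), (coor true p), (d ^+ 2) => K c x1 x2 partial dn.
    by field; rewrite dn gt_eqF.
  move: E; rewrite I2B; [|exact: itg2Z|exact: itg2Z].
  rewrite !I2Z// => /eqP; rewrite subr_eq0 => /eqP E.
  have -> : I2 (fun p => (r - nsq p) * \1_D p) = r ^+ 2 / 4 * (4 / r ^+ 2 * I2 (fun p => (r - nsq p) * \1_D p)).
    by field; rewrite gt_eqF.
  rewrite E.
  have k0 : 0 <= 2 * k * pi by rewrite !mulr_ge0 ?pi_ge0// ?invr_ge0 ?addr_ge0 ?sqr_ge0// ltW.
  apply: (@le_trans _ _ (r ^+ 2 / 4 * (2 * k * pi * 1))).
    apply: ler_wpM2l; first by rewrite divr_ge0 ?sqr_ge0.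
    by apply: ler_wpM2l.
  by rewrite /k le_eqVlt; apply/orP; left; apply/eqP; field; rewrite gt_eqF.
apply/ler_addgt0Pr => /= e e0.
have c0 : 0 < pi * r / 2 by rewrite divr_gt0// mulr_gt0// pi_gt0.
have := key (Num.sqrt (e / (pi * r / 2))); rewrite sqrtr_gt0 divr_gt0// => /(_ isT).
rewrite sqr_sqrtr; last by apply: ltW; exact: divr_gt0.
have -> : pi * r * (e / (pi * r / 2)) / 2 = e.
  move: (lt0r_neq0 (pi_gt0 R)); generalize (@pi R) => P P0.
  by field; rewrite P0 gt_eqF.
exact.
Qed.

(** The disc |p|^2 < r with r = B / pi has the total area B of the patches. By disjointness the sum
    of the indicators lies between 0 and 1, so its product with r - |p|^2 is at most the positive
    part of r - |p|^2, which [disc_moment] integrates. *)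
Lemma bathtub D1 D2 : open D1 -> open D2 -> bounded_set D1 -> bounded_set D2 ->
  D1 `&` D2 = set0 ->
  I2 (fun p => \1_D1 p + \1_D2 p) ^+ 2 / (2 * pi) <= I2 (fun p => nsq p * (\1_D1 p + \1_D2 p)).
Proof.
move=> oD1 oD2 bD1 bD2 D12; set B := I2 _.
have i1 f : continuous f -> itg2 (fun p => f p * (\1_D1 p + \1_D2 p)).
  move=> cf; apply: (itg2_ext (f := fun p => f p * \1_D1 p + f p * \1_D2 p)) => [p|]; first by rewrite mulrDr.
  by apply: itg2D; exact: itg2_cont_indic.
have iB : itg2 (fun p => \1_D1 p + \1_D2 p).
  by apply: itg2_ext (i1 (fun=> 1) _) => [p|p]; [rewrite mul1r|exact: cvg_cst].
have B0 : 0 <= B by apply: I2_ge0 => p; rewrite addr_ge0// indicE.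
have p0 := pi_gt0 R.
have [B00|Bn] := eqVneq B 0.
  rewrite B00 expr0n mul0r; apply: I2_ge0 => p; rewrite mulr_ge0 ?nsq_ge0// addr_ge0// indicE.
have Bp : 0 < B by rewrite lt0r Bn.
pose r := B / pi; have r0 : 0 < r by rewrite divr_gt0.
have [oD bD] := nsq_disc r0; set D := [set p : R * R | nsq p < r] in oD bD.
have cn : continuous (fun p => r - nsq p).
  by move=> p; apply: cvgB; [exact: cvg_cst|exact: nsq_cont].
have h : I2 (fun p => r * (\1_D1 p + \1_D2 p) - nsq p * (\1_D1 p + \1_D2 p)) <=
         I2 (fun p => (r - nsq p) * \1_D p).
  apply: I2_le.
  - apply: itg2B; last by apply: i1; exact: nsq_cont.
    exact: itg2Z.
  - exact: itg2_cont_indic.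
  - move=> p; rewrite -mulrBl.
    have e01 : 0 <= (\1_D1 p + \1_D2 p : R) <= 1.
      rewrite !indicE; have [/set_mem h1|_] := boolP (p \in D1); have [/set_mem h2|_] := boolP (p \in D2); rewrite ?addr0 ?add0r ?lexx ?ler01//.
      by have : (D1 `&` D2) p by []; rewrite D12.
    move: e01; move: (\1_D1 p + \1_D2 p : R) => t /andP[t0 t1].
    rewrite indicE; have [/set_mem|/negP/negP pD] := boolP (p \in D).
      by rewrite /D/= => np; rewrite mulr1 ler_piMr// subr_ge0 ltW.
    rewrite mulr0; apply: mulr_le0_ge0 => //; rewrite subr_le0 leNgt.
    by apply: contra pD => np; exact/mem_set.
move: h; rewrite I2B; [|exact: itg2Z|by apply: i1; exact: nsq_cont].
rewrite I2Z// -/B => h.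
have h2 := le_trans h (disc_moment r0).
have e1 : r * B = B ^+ 2 / pi by rewrite /r expr2 mulrAC.
have e2 : pi * r ^+ 2 / 2 = B ^+ 2 / pi / 2.
  rewrite /r; move: p0; generalize (@pi R) => P p0; field; by rewrite gt_eqF.
have e3 : B ^+ 2 / (2 * pi) = B ^+ 2 / pi / 2 by rewrite invfM mulrA mulrAC.
move: h2; rewrite e1 e2 e3; lra.
Qed.
End Energy0.

(** * Double integrals of bounded kernels *)

Section DoubleIntegral.
Context {R : realType}.
Implicit Types (f g h e : R * R -> R) (p x y : R * R) (b j : bool) (D : set (R * R)) (d : R).
Implicit Types (k l : R * R -> R * R -> R).

Definition bdd_supp f := mf2 f /\ exists2 M, 0 <= M & (forall p, `|f p| <= M) /\ (forall p, M < `|p| -> f p = 0).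
Definition bdd_supp_kernel k := mf4 k /\ exists2 M, 0 <= M & (forall x y, `|k x y| <= M) /\
  (forall x y, M < `|x| \/ M < `|y| -> k x y = 0).
Definition double_integral k := I2 (fun x => I2 (k x)).

Lemma bdd_supp_itg f : bdd_supp f -> itg2 f.
Proof. by move=> [mf [M M0 [h1 h2]]]; exact: (itg2_bdd (M := M)). Qed.

Lemma bdd_supp_indic D : open D -> bounded_set D -> bdd_supp \1_D.
Proof.
move=> oD bD; split; first exact: mf2_indic.
have [N N0 hN] := bounded_setP bD; exists (1 + N); first by rewrite addr_ge0.
split=> p.
  by rewrite indicE; case: (p \in D); rewrite ?normr1 ?normr0 ?lerDl// addr_ge0.
move=> pN; rewrite indicE memNset// => /hN; move: pN; lra.
Qed.

Lemma bdd_suppD f g : bdd_supp f -> bdd_supp g -> bdd_supp (fun p => f p + g p).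
Proof.
move=> [mf [M M0 [h1 h2]]] [mg [N N0 [h3 h4]]]; split; first exact: mf2D.
exists (M + N); first by rewrite addr_ge0.
split=> p; first by rewrite (le_trans (ler_normD _ _))// lerD.
by move=> pN; rewrite h2 ?h4 ?addr0//; move: pN; lra.
Qed.

Lemma bdd_suppM f g : continuous f -> bdd_supp g -> bdd_supp (fun p => f p * g p).
Proof.
move=> cf [mg [M M0 [h1 h2]]]; split; first by apply: mf2M => //; exact: mf2_cont.
have [N N0 hN] := continuous_bddP M cf.
exists (N * M + M); first by rewrite addr_ge0 ?mulr_ge0.
split=> p.
  have [pM|pM] := leP `|p| M; last by rewrite h2// mulr0 normr0 addr_ge0 ?mulr_ge0.
  by rewrite normrM (@le_trans _ _ (N * M)) ?lerDl// ler_pM// hN.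
move=> pM; rewrite h2 ?mulr0//; apply: le_lt_trans pM; by rewrite lerDr mulr_ge0.
Qed.

Lemma bdd_supp_kernelD k l : bdd_supp_kernel k -> bdd_supp_kernel l -> bdd_supp_kernel (fun x y => k x y + l x y).
Proof.
move=> [mf [M M0 [h1 h2]]] [mg [N N0 [h3 h4]]]; split; first exact: mf4D.
exists (M + N); first by rewrite addr_ge0.
split=> x y; first by rewrite (le_trans (ler_normD _ _))// lerD.
by move=> h; rewrite h2 ?h4 ?addr0//; case: h => h; [left|right|left|right]; move: h; lra.
Qed.

Lemma bdd_supp_kernelM (k : R * R -> R * R -> R) e g (C : R) : mf4 k -> 0 <= C -> (forall x y, `|k x y| <= C) ->
  bdd_supp g -> bdd_supp e -> bdd_supp_kernel (fun x y => g x * (k x y * e y)).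
Proof.
move=> mk C0 kC [mg [M M0 [h1 h2]]] [me [N N0 [h3 h4]]]; split.
  by apply: mf4M; [exact: mf4_1|apply: mf4M => //; exact: mf4_2].
have P0 : 0 <= M * (C * N) by rewrite !mulr_ge0.
exists (M * (C * N) + M + N); first by rewrite !addr_ge0.
split=> x y.
  apply: (@le_trans _ _ (M * (C * N))); last by rewrite -addrA lerDl addr_ge0.
  by rewrite normrM ler_pM// normrM ler_pM.
case=> h; first by rewrite h2 ?mul0r//; move: h; lra.
by rewrite h4 ?mulr0//; move: h; lra.
Qed.

Lemma bdd_supp_kernel_kern b d e g : 0 < d -> bdd_supp g -> bdd_supp e -> bdd_supp_kernel (fun x y => g x * (kern b d (x - y) * e y)).
Proof.
move=> d0 bg be; apply: (bdd_supp_kernelM (C := (2 * pi)^-1 * (1 + d ^- 2))) => //.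
- by apply: (@mf4_diff _ (kern b d)); apply: mf2_cont; exact: kern_cont.
- by rewrite mulr_ge0 ?invr_ge0 ?mulr_ge0 ?pi_ge0 ?addr_ge0 ?invr_ge0 ?sqr_ge0.
- by move=> x y; exact: kern_bdd.
Qed.

Lemma bdd_supp_kernel_prod (c : R) e g : bdd_supp g -> bdd_supp e -> bdd_supp_kernel (fun x y => g x * (c * e y)).
Proof.
move=> bg be; apply: (bdd_supp_kernelM (C := `|c|)) => //.
by apply: (@mf4_1 _ (fun=> c)); apply: mf2_cont => p; exact: cvg_cst.
Qed.

Lemma bdd_supp_kernel_ext k l : (forall x y, k x y = l x y) -> bdd_supp_kernel k -> bdd_supp_kernel l.
Proof. by move=> kl; suff -> : k = l by []; apply/funext => x; apply/funext => y. Qed.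

Lemma double_integral_ext k l : (forall x y, k x y = l x y) -> double_integral k = double_integral l.
Proof. by move=> kl; apply: I2_ext => x; apply: I2_ext => y. Qed.

Lemma bdd_supp_kernel_slice k x : bdd_supp_kernel k -> itg2 (k x).
Proof. by move=> [mk [M M0 [h1 h2]]]; exact: kernel_slice1 mk h1 h2. Qed.
Lemma bdd_supp_kernel_itg1 k : bdd_supp_kernel k -> itg2 (fun x => I2 (k x)).
Proof. by move=> [mk [M M0 [h1 h2]]]; exact: kernel_itg1 mk h1 h2. Qed.

Lemma double_integral_D k l : bdd_supp_kernel k -> bdd_supp_kernel l -> double_integral (fun x y => k x y + l x y) = double_integral k + double_integral l.
Proof.
move=> bkk bl; rewrite /double_integral -I2D; [|exact: bdd_supp_kernel_itg1|exact: bdd_supp_kernel_itg1].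
by apply: I2_ext => x; rewrite I2D//; exact: bdd_supp_kernel_slice.
Qed.

Lemma double_integral_Z (c : R) k : bdd_supp_kernel k -> double_integral (fun x y => c * k x y) = c * double_integral k.
Proof.
move=> bkk; rewrite /double_integral -I2Z; last exact: bdd_supp_kernel_itg1.
by apply: I2_ext => x; rewrite I2Z//; exact: bdd_supp_kernel_slice.
Qed.

Lemma double_integral_swap k : bdd_supp_kernel k -> double_integral k = double_integral (fun x y => k y x).
Proof. by move=> [mk [M M0 [h1 h2]]]; exact: (I2_swap mk h1 h2). Qed.

Lemma bdd_supp_kernel_swap k : bdd_supp_kernel k -> bdd_supp_kernel (fun x y => k y x).
Proof.
move=> [mk [M M0 [h1 h2]]]; split.
  apply: (measurableT_comp (f := fun z : (measurableTypeR R * measurableTypeR R) * (measurableTypeR R * measurableTypeR R) => k z.1 z.2) (g := fun z => (z.2, z.1))) => //.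
  exact: measurable_fun_pair.
by exists M => //; split=> x y //; case=> h; apply: h2; [right|left].
Qed.

Lemma double_integral_le k l : bdd_supp_kernel k -> bdd_supp_kernel l -> (forall x y, k x y <= l x y) -> double_integral k <= double_integral l.
Proof.
move=> bkk bl kl; apply: I2_le; [exact: bdd_supp_kernel_itg1|exact: bdd_supp_kernel_itg1|move=> x].
by apply: I2_le => //; exact: bdd_supp_kernel_slice.
Qed.

Lemma double_integral_prod (c : R) e g : bdd_supp e -> bdd_supp g -> double_integral (fun x y => g x * (c * e y)) = c * (I2 g * I2 e).
Proof.
move=> be bg; rewrite /double_integral (_ : c * (I2 g * I2 e) = c * I2 e * I2 g); last by ring.
rewrite -(I2Z (c * I2 e)); last exact: bdd_supp_itg.
apply: I2_ext => x; rewrite I2Z; last by apply: itg2Z; exact: bdd_supp_itg.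
by rewrite (I2Z c) 1?mulrC//; exact: bdd_supp_itg.
Qed.

(* The kernel is antisymmetric: this is the vanishing self-interaction of a patch. *)
Lemma double_integral_kern_self b d e : 0 < d -> bdd_supp e -> double_integral (fun x y => e x * (kern b d (x - y) * e y)) = 0.
Proof.
move=> d0 be; set k := (fun x y => e x * (kern b d (x - y) * e y)).
have bkk : bdd_supp_kernel k by exact: bdd_supp_kernel_kern.
have : double_integral k = (-1) * double_integral k.
  rewrite -(double_integral_Z (-1) bkk) {1}(double_integral_swap bkk); apply: double_integral_ext => x y.
  by rewrite /k -[y - x]opprB kernN mulN1r mulNr mulrN; congr (- _); rewrite mulrCA [RHS]mulrCA (mulrC (e y)).
by move: (double_integral k) => t; lra.
Qed.
End DoubleIntegral.

Lemma cvg_seq_ext (R : realType) (f h : nat -> R) (l : R) : (forall n, f n = h n) ->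
  f n @[n --> \oo] --> l -> h n @[n --> \oo] --> l.
Proof. by move=> fh; suff -> : h = f by []; apply/funext. Qed.

(** With L = 2 O - s the last inequality gives U <= L (I - T) / 4. Inserted into the first it leaves
    s I + L T <= s b <= s I, impossible since L T > 0. In the application I is the second moment, b
    its value for the disc of the same area and T the gain from the centroid of D1. *)
Lemma energy_arith (R : realFieldType) (s O U I T b : R) : 0 < s -> s / 2 < O -> 0 < T ->
  - 2 * U + O * I <= s * (b / 2) -> b <= I ->
  0 <= (2 * O - s) * U - (2 * O - s) * U * 2 + (2 * O - s) ^+ 2 / 4 * (I - T) -> False.
Proof.
move=> s0 sO T0 h1 h2 h3; have L0 : 0 < 2 * O - s by lra.
have h4 : U <= (2 * O - s) / 4 * (I - T).
  by rewrite -(ler_pM2l L0) -subr_ge0; apply: le_trans h3 _; rewrite le_eqVlt; apply/orP; left; apply/eqP; ring.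
have h5 : 0 < (2 * O - s) * T by exact: mulr_gt0.
have h6 : s * b <= s * I by rewrite ler_pM2l.
have h7 : (2 * O - s) / 4 * (I - T) * 4 = 2 * (O * I) - s * I - (2 * O - s) * T by field.
have h8 : s * (b / 2) * 2 = s * b by field.
by move: h1 h4 h5 h6 h7 h8; clear; move: (O * I) (s * I) (s * b) (s * (b / 2)) (_ / 4 * _) (_ * T) => *; lra.
Qed.

(** * Torque, virial and energy identities *)

Section Energy.
Context {R : realType}.
Implicit Types (f g h e : R * R -> R) (p x y : R * R) (b j : bool) (D : set (R * R)) (d : R).
Variables (Psi : R * R -> R) (D1 D2 : set (R * R)) (s Omega c1 c2 : R).
Hypotheses (oD1 : open D1) (oD2 : open D2) (bD1 : bounded_set D1) (bD2 : bounded_set D2).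
Hypothesis cPsi : Ck 1 Psi.
Hypothesis wl : weak_laplacian Psi (fun p => s * \1_D1 p + s * \1_D2 p - 2 * Omega).
Hypothesis far : grad (fun p => Psi p + 2^-1 * Omega * (p.1 ^+ 2 + p.2 ^+ 2)) q
          @[q --> infty_nbhs (R * R)%type] --> ((0, 0) : R * R).
Hypothesis bc1 : forall p, closure D1 p -> ~ D1 p -> Psi p = c1.
Hypothesis bc2 : forall p, closure D2 p -> ~ D2 p -> Psi p = c2.

Let dn n : R := n.+1%:R^-1.
Let dn0 n : 0 < dn n. Proof. by rewrite invr_gt0. Qed.
Let dn_small (d : R) : 0 < d -> \forall n \near \oo, dn n < d.
Proof.
move=> d0; exact: near_infty_natSinv_lt (PosNum d0).
Qed.

Let b1 : bdd_supp (\1_D1 : R * R -> R). Proof. exact: bdd_supp_indic. Qed.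
Let b2 : bdd_supp (\1_D2 : R * R -> R). Proof. exact: bdd_supp_indic. Qed.
Let E p : R := \1_D1 p + \1_D2 p.
Let bE : bdd_supp E. Proof. exact: bdd_suppD. Qed.

(** Dominated convergence in the outer variable only: [representation] gives the pointwise limit and
    [chi_kern_bdd] the bound, so no singular inner integral is formed. *)
Lemma potential_limit b g : bdd_supp g ->
  double_integral (fun x y => g x * (kern b (dn n) (x - y) * (s * \1_D1 y + s * \1_D2 y))) @[n --> \oo]
    --> I2 (fun x => dTheta Psi Omega b x * g x).
Proof.
move=> bg.
pose f n x := I2 (fun y => (s * \1_D1 y + s * \1_D2 y) * kern b (dn n) (x - y)).
have fi n x : itg2 (fun y => (s * \1_D1 y + s * \1_D2 y) * kern b (dn n) (x - y)).
  exact: chi_kern_itg.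
have [M M0 hM] := chi_kern_bdd oD1 oD2 bD1 bD2 cPsi wl far b.
have bchi : bdd_supp (fun y => s * \1_D1 y + s * \1_D2 y).
  by apply: bdd_suppD; apply: bdd_suppM => // p; exact: cvg_cst.
have e1 n x : I2 (fun y => g x * (kern b (dn n) (x - y) * (s * \1_D1 y + s * \1_D2 y))) = f n x * g x.
  rewrite -[RHS]mulrC -I2Z//; apply: I2_ext => y; by rewrite (mulrC (kern _ _ _)).
have -> : (fun n => double_integral (fun x y => g x * (kern b (dn n) (x - y) * (s * \1_D1 y + s * \1_D2 y)))) =
  (fun n => I2 (fun x => f n x * g x)).
  by apply/funext => n; apply: I2_ext => x; rewrite e1.
have := @I2_cvg R (fun n x => f n x * g x) (fun x => dTheta Psi Omega b x * g x) (fun x => M * `|g x|).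
case=> //.
- move=> n; apply: itg2_mf; apply: itg2_ext (bdd_supp_kernel_itg1 (bdd_supp_kernel_kern b (dn0 n) bg bchi)) => x.
  exact: e1.
- by apply: itg2Z; apply: itg2_abs; exact: bdd_supp_itg.
- by move=> n x; rewrite normrM ler_wpM2r// hM.
- move=> x; apply: cvgM; last exact: cvg_cst.
  apply/cvgrPdist_le => /= e e0.
  have [d0 d00 hd] := representation oD1 oD2 bD1 bD2 cPsi wl far b x e0.
  by apply: filterS (dn_small d00) => n nd; rewrite distrC; exact: hd.
Qed.

(** (Psi - c) w is C^1 on the plane and vanishes on the boundary of [D], so its partial derivative
    has integral 0 over [D]. *)
Lemma green b D w (c : R) : open D -> bounded_set D ->
  (forall p, closure D p -> ~ D p -> Psi p = c) -> Ck 1 w ->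
  I2 (fun p => partial b Psi p * w p * \1_D p) = - I2 (fun p => (Psi p - c) * partial b w p * \1_D p).
Proof.
move=> oD bD bc cw.
have cPc : Ck 1 (fun p => Psi p + - c) by apply: CkD => //; exact: Ck_cst.
have isdP p : is_partial b (fun p => Psi p + - c) p (partial b Psi p + 0).
  by apply: is_partialD; [exact: is_partial_Ck|exact: is_partial_cst].
have ckf : Ck 1 (fun p => (Psi p + - c) * w p) by apply: CkM.
have := partial_div0 b oD bD ckf.
have -> : (fun p => partial b (fun p => (Psi p + - c) * w p) p * \1_D p) =
   (fun p => partial b Psi p * w p * \1_D p + (Psi p - c) * partial b w p * \1_D p).
  apply/funext => p; rewrite (partial_eq (is_partialM (isdP p) (is_partial_Ck b p cw))) addr0; ring.
rewrite I2D; first last.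
- apply: itg2_cont_indic => // p; apply: cvgM; last exact: (partial_cont cw).
  by apply: cvgB; [exact: (Ck_cont cPsi)|exact: cvg_cst].
- apply: itg2_cont_indic => // p; apply: cvgM; last exact: (Ck_cont cw).
  exact: (partial_cont cPsi).
move=> h; apply/eqP; rewrite -addr_eq0; apply/eqP; apply: h => p cD nD.
by rewrite (bc _ cD nD) subrr mul0r.
Qed.

Lemma partial_int0 b D (c : R) : open D -> bounded_set D ->
  (forall p, closure D p -> ~ D p -> Psi p = c) -> I2 (fun p => partial b Psi p * \1_D p) = 0.
Proof.
move=> oD bD bc.
have := green b oD bD bc (Ck_cst 1 1).
under eq_fun do rewrite mulr1.
move=> ->; rewrite (_ : (fun p => _) = fun=> 0); first by rewrite /I2 /Rintegral integral0 oppr0.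
by apply/funext => p; rewrite (partial_eq (is_partial_cst _ _ _)) mulr0 mul0r.
Qed.

Section HalfPlane.
Variable (sg : R).
Hypotheses (s0 : 0 < s) (h1 : forall x, D1 x -> 0 < sg * coor false x) (h2 : forall y, D2 y -> sg * coor false y < 0).
Hypotheses (ne1 : D1 !=set0) (ne2 : D2 !=set0).

Let X1 := I2 (fun x => coor false x * \1_D1 x).
Let cco b : continuous (coor b : R * R -> R) := @coor_cont R b.

(** The self-interaction cancels for every [dn n], before the limit, so only the interaction between
    the two patches passes to the limit. *)
Lemma torque_limit :
  s * double_integral (fun x y => \1_D1 x * (kern false (dn n) (x - y) * \1_D2 y)) @[n --> \oo] --> Omega * X1.
Proof.
have := potential_limit (b := false) b1.
have -> : (fun n => double_integral (fun x y => \1_D1 x * (kern false (dn n) (x - y) * (s * \1_D1 y + s * \1_D2 y)))) =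
  (fun n => s * double_integral (fun x y => \1_D1 x * (kern false (dn n) (x - y) * \1_D2 y))).
  apply/funext => n.
  have -> : s * double_integral (fun x y => \1_D1 x * (kern false (dn n) (x - y) * \1_D2 y)) =
     s * double_integral (fun x y => \1_D1 x * (kern false (dn n) (x - y) * \1_D1 y)) +
     s * double_integral (fun x y => \1_D1 x * (kern false (dn n) (x - y) * \1_D2 y)).
    by rewrite double_integral_kern_self// mulr0 add0r.
  rewrite -mulrDr -double_integral_D; [|exact: bdd_supp_kernel_kern|exact: bdd_supp_kernel_kern].
  rewrite -double_integral_Z; last by apply: bdd_supp_kernelD; exact: bdd_supp_kernel_kern.
  by apply: double_integral_ext => x y; ring.
congr (_ --> _).
have -> : (fun x => dTheta Psi Omega false x * \1_D1 x) =
    (fun x => partial false Psi x * \1_D1 x + Omega * (coor false x * \1_D1 x)).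
  by apply/funext => x; rewrite /dTheta mulrDl mulrA.
have i1 : itg2 (fun x => coor false x * \1_D1 x) by apply: itg2_cont_indic => //; exact: (cco false).
rewrite I2D; [|by apply: itg2_cont_indic => //; exact: partial_cont|exact: itg2Z].
by rewrite (partial_int0 false oD1 bD1 bc1) add0r I2Z.
Qed.

(** The number [u] is the signed distance of the two points along the x-axis, and u^2 <= |z|^2 + d^2
    <= 2 N^2 + 1; the factor 2 is due to the maximum norm and the 1 to d <= 1. Both bounds on u /
    (|z|^2 + d^2) follow. *)
Lemma kern_pair_bounds (m N d : R) x y : 0 < d -> d <= 1 -> sg ^+ 2 = 1 -> 0 < m ->
  m <= sg * coor false (x - y) -> `|x - y| <= N ->
  (2 * pi)^-1 * (2 * N ^+ 2 + 1)^-1 * m <= sg * kern false d (x - y) <= (2 * pi)^-1 * m^-1.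
Proof.
move=> d0 d1 sg1 m0; move: (x - y) => z mz zN.
have p0 : 0 < (2 * pi : R)^-1 by rewrite invr_gt0 mulr_gt0// pi_gt0.
have t0 := nsqd_gt0 z d0.
set u := sg * coor false z in mz *.
have -> : sg * kern false d z = (2 * pi)^-1 * (u / (nsq z + d ^+ 2)).
  by rewrite /kern /u mulrCA !mulrA.
have u2 : u ^+ 2 <= nsq z + d ^+ 2.
  rewrite exprMn sg1 mul1r /nsq -addrA lerDl addr_ge0 ?sqr_ge0//.
have u0 : 0 < u by exact: lt_le_trans mz.
have N1 : nsq z + d ^+ 2 <= 2 * N ^+ 2 + 1.
  apply: lerD; last by rewrite expr_le1// ltW.
  apply: le_trans (nsq_norm2 _) _; rewrite ler_pM2l// ler_pXn2r ?nnegrE//.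
  exact: le_trans zN.
apply/andP; split; last first.
  rewrite (ler_pM2l p0) ler_pdivrMr// mulrC ler_pdivlMr//.
  by apply: le_trans u2; rewrite expr2 ler_pM2l.
rewrite -mulrA (ler_pM2l p0).
  rewrite mulrC ler_pM// ?invr_ge0 ?(ltW m0)//.
    by rewrite addr_ge0// mulr_ge0// sqr_ge0.
  by rewrite lef_pV2// posrE (lt_le_trans t0).
Qed.

Let A1 := I2 \1_D1.
Let A2 := I2 \1_D2.
Let X2 := I2 (fun y => coor false y * \1_D2 y).

Let indD D p : (\1_D p = 1 :> R /\ D p) \/ \1_D p = 0 :> R.
Proof. by rewrite indicE; have [/set_mem|] := boolP (p \in D); [left|right]. Qed.

Lemma area_gt0 D : open D -> bounded_set D -> D !=set0 -> 0 < I2 (\1_D : R * R -> R).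
Proof.
move=> oD bD [p Dp].
have c1c : continuous (fun _ : R * R => 1 : R) by move=> q; exact: cvg_cst.
have := I2_open_gt0 oD bD c1c Dp (fun _ _ => ler01) ltr01.
by under eq_fun do rewrite mul1r.
Qed.

Lemma moment_gt0 : 0 < sg * X1 /\ sg * X2 < 0.
Proof.
have iX D : open D -> bounded_set D -> itg2 (fun x => coor false x * \1_D x).
  by move=> oD bD; apply: itg2_cont_indic.
split.
  rewrite -I2Z; last exact: iX.
  under eq_fun do rewrite mulrA.
  have [p Dp] := ne1.
  apply: (I2_open_gt0 (f := fun x => sg * coor false x) oD1 bD1 _ Dp) => //.
  - by move=> q; apply: cvgM; [exact: cvg_cst|exact: cco].
  - by move=> q /h1/ltW.
  - exact: h1.
rewrite -I2Z; last exact: iX.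
rewrite -oppr_gt0 -mulN1r -I2Z; last by apply: itg2Z; exact: iX.
under eq_fun do rewrite !mulrA.
have [p Dp] := ne2.
apply: (I2_open_gt0 (f := fun x => (-1 * sg) * coor false x) oD2 bD2 _ Dp) => //.
- by move=> q; apply: cvgM; [exact: cvg_cst|exact: cco].
- by move=> q /h2 h; rewrite mulN1r mulNr oppr_ge0 ltW.
- by rewrite mulN1r mulNr oppr_gt0; exact: h2.
Qed.

(* On D1 x D2 the first component of the kernel has the sign of x_1, so the limit of the
   torques in [torque_limit] is positive. *)
Lemma Omega_gt0 : sg ^+ 2 = 1 -> 0 < Omega.
Proof.
move=> sg1.
have [x1p x2n] := moment_gt0.
have A1p : 0 < A1 by exact: area_gt0.
have A2p : 0 < A2 by exact: area_gt0.
have [N1 N10 hN1] := bounded_setP bD1; have [N2 N20 hN2] := bounded_setP bD2.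
pose c := (2 * pi)^-1 * (2 * (N1 + N2) ^+ 2 + 1)^-1.
have c0 : 0 < c.
  rewrite mulr_gt0 ?invr_gt0//; first by rewrite mulr_gt0// pi_gt0.
  by rewrite ltr_wpDl// mulr_ge0// sqr_ge0.
have bX1 : bdd_supp (fun x => coor false x * \1_D1 x) by apply: bdd_suppM.
have bX2 : bdd_supp (fun x => coor false x * \1_D2 x) by apply: bdd_suppM.
have lim := torque_limit.
(* The kernel is at least c sg (x_1 - y_1), a sum of products, so the double integral of this bound
   is explicit, positive and the same for all [n]; strict positivity survives the limit. *)
have lb n : s * (c * (sg * X1 * A2 - sg * X2 * A1)) <= sg * (s * double_integral (fun x y => \1_D1 x * (kern false (dn n) (x - y) * \1_D2 y))).
  rewrite [leRHS]mulrCA ler_pM2l//.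
  have bk1 := bdd_supp_kernel_kern false (dn0 n) b1 b2.
  rewrite -double_integral_Z//.
  have -> : c * (sg * X1 * A2 - sg * X2 * A1) =
     double_integral (fun x y => (coor false x * \1_D1 x) * ((c * sg) * \1_D2 y) +
                    \1_D1 x * ((- (c * sg)) * (coor false y * \1_D2 y))).
    rewrite double_integral_D; [|exact: bdd_supp_kernel_prod|exact: bdd_supp_kernel_prod].
    by rewrite !double_integral_prod// -/A1 -/A2 -/X1 -/X2; ring.
  apply: double_integral_le.
  - by apply: bdd_supp_kernelD; exact: bdd_supp_kernel_prod.
  - by apply: (bdd_supp_kernel_ext (k := fun x y => (sg * \1_D1 x) * (kern false (dn n) (x - y) * \1_D2 y))) => [x y|]; [rewrite !mulrA|apply: bdd_supp_kernel_kern => //; apply: bdd_suppM => // p; exact: cvg_cst].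
  - move=> x y.
    have [[-> Dx]|->] := indD D1 x; last by rewrite !(mulr0, mul0r, addr0).
    have [[-> Dy]|->] := indD D2 y; last by rewrite !(mulr0, mul0r, addr0).
    have dxy : 0 < sg * coor false (x - y).
      have := h1 Dx; have := h2 Dy; rewrite /= mulrBr; lra.
    have nxy : `|x - y| <= N1 + N2.
      by apply: le_trans (ler_normB _ _) _; rewrite lerD// ?hN1// hN2.
    have d1 : dn n <= 1 by rewrite invf_le1// ler1n.
    have /andP[+ _] := kern_pair_bounds (dn0 n) d1 sg1 dxy (lexx _) nxy.
    by rewrite -/c !mulr1 !mul1r => /(le_trans _); apply; rewrite /= le_eqVlt; apply/orP; left; apply/eqP; ring.
have lim2 : sg * (s * double_integral (fun x y => \1_D1 x * (kern false (dn n) (x - y) * \1_D2 y))) @[n --> \oo] --> sg * (Omega * X1).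
  by apply: cvgM; [exact: cvg_cst|exact: lim].
have h : s * (c * (sg * X1 * A2 - sg * X2 * A1)) <= sg * (Omega * X1).
  rewrite -(cvg_lim _ lim2)//; apply: limr_ge; first exact: cvgP lim2.
  by near=> n; exact: lb.
have : 0 < sg * (Omega * X1).
  apply: (lt_le_trans _ h); apply: mulr_gt0 => //; apply: mulr_gt0 => //; rewrite subr_gt0.
  by apply: (@lt_trans _ _ 0); [rewrite pmulr_llt0|rewrite mulr_gt0].
by rewrite mulrCA pmulr_lgt0.
Unshelve. all: by end_near.
Qed.

(** Points of the two patches are at least L apart along the x-axis, so the kernel is at most 1 / (2
    pi L) and the torque at most s A1 A2 / (2 pi L), while sg X1 >= L A1 / 2. The area A1
    cancels. *)
Lemma Omega_far (L : R) : sg ^+ 2 = 1 -> 0 < L ->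
  (forall x, D1 x -> L / 2 <= sg * coor false x) -> (forall y, D2 y -> sg * coor false y <= - (L / 2)) ->
  Omega * L ^+ 2 <= s * A2 / pi.
Proof.
move=> sg1 L0 H1 H2.
have A1p : 0 < A1 by exact: area_gt0.
have A2p : 0 < A2 by exact: area_gt0.
have O0 := Omega_gt0 sg1.
have pi0 := pi_gt0 R.
have [N1 N10 hN1] := bounded_setP bD1; have [N2 N20 hN2] := bounded_setP bD2.
have lim := torque_limit.
have ub n : sg * (s * double_integral (fun x y => \1_D1 x * (kern false (dn n) (x - y) * \1_D2 y))) <=
    s * ((2 * pi)^-1 * L^-1 * (A1 * A2)).
  rewrite mulrCA ler_pM2l//.
  have bk1 := bdd_supp_kernel_kern false (dn0 n) b1 b2.
  rewrite -(double_integral_Z _ bk1) -(double_integral_prod _ b2 b1).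
  apply: double_integral_le.
  - by apply: (bdd_supp_kernel_ext (k := fun x y => (sg * \1_D1 x) * (kern false (dn n) (x - y) * \1_D2 y))) => [x y|]; [rewrite !mulrA|apply: bdd_supp_kernel_kern => //; apply: bdd_suppM => // p; exact: cvg_cst].
  - exact: bdd_supp_kernel_prod.
  - move=> x y.
    have [[-> Dx]|->] := indD D1 x; last by rewrite !(mulr0, mul0r, addr0).
    have [[-> Dy]|->] := indD D2 y; last by rewrite !(mulr0, mul0r, addr0).
    have dxy : L <= sg * coor false (x - y).
      have := H1 _ Dx; have := H2 _ Dy; rewrite /= mulrBr; lra.
    have nxy : `|x - y| <= N1 + N2.
      by apply: le_trans (ler_normB _ _) _; rewrite lerD// ?hN1// hN2.
    have d1 : dn n <= 1 by rewrite invf_le1// ler1n.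
    have /andP[_] := kern_pair_bounds (dn0 n) d1 sg1 L0 dxy nxy.
    by rewrite !mulr1 !mul1r.
have lim2 : sg * (s * double_integral (fun x y => \1_D1 x * (kern false (dn n) (x - y) * \1_D2 y))) @[n --> \oo] --> sg * (Omega * X1).
  by apply: cvgM; [exact: cvg_cst|exact: lim].
have h : Omega * (sg * X1) <= s * ((2 * pi)^-1 * L^-1 * (A1 * A2)).
  rewrite mulrCA -(cvg_lim _ lim2)//; apply: limr_le; first exact: cvgP lim2.
  by near=> n; exact: ub.
have iX : itg2 (fun x => coor false x * \1_D1 x) by apply: itg2_cont_indic.
have lbX : L / 2 * A1 <= sg * X1.
  rewrite -I2Z; last exact: bdd_supp_itg.
  rewrite -I2Z//; apply: I2_le.
  - by apply: itg2Z; exact: bdd_supp_itg.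
  - exact: itg2Z.
  - move=> x; have [[-> Dx]|->] := indD D1 x; last by rewrite !mulr0.
    by rewrite !mulr1; exact: H1.
have h3 : Omega * (L / 2 * A1) <= s * ((2 * pi)^-1 * L^-1 * (A1 * A2)).
  by apply: le_trans h; rewrite ler_pM2l.
have k0 : 0 < 2 * L / A1 by rewrite !(mulr_gt0, invr_gt0).
have := ler_wpM2l (ltW k0) h3.
have -> : 2 * L / A1 * (Omega * (L / 2 * A1)) = Omega * L ^+ 2.
  by field; rewrite gt_eqF.
have -> // : 2 * L / A1 * (s * ((2 * pi)^-1 * L^-1 * (A1 * A2))) = s * A2 / pi.
move: (lt0r_neq0 pi0) (lt0r_neq0 A1p) (lt0r_neq0 L0); generalize (@pi R), A1, L => P a l P0 a0 l0.
by field; rewrite a0 l0 P0.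
Unshelve. all: by end_near.
Qed.

Hypothesis D12 : D1 `&` D2 = set0.

(** Subtracting each patch's own boundary constant makes the extension by 0 continuous on the plane
    even when the two constants differ. *)
Let u p := (Psi p - c1) * \1_D1 p + (Psi p - c2) * \1_D2 p.
Let U := I2 u.
Let cPc (c : R) : continuous (fun p => Psi p - c).
Proof. by move=> p; apply: cvgB; [exact: (Ck_cont cPsi)|exact: cvg_cst]. Qed.

Let u_cont : continuous u.
Proof.
have h1' : continuous (fun p => (Psi p - c1) * \1_D1 p).
  by apply: closed_vanish_cont => // p cD nD; rewrite (bc1 cD nD) subrr.
have h2' : continuous (fun p => (Psi p - c2) * \1_D2 p).
  by apply: closed_vanish_cont => // p cD nD; rewrite (bc2 cD nD) subrr.
by move=> p; apply: cvgD; [exact: h1'|exact: h2'].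
Qed.

Let bu : bdd_supp u. Proof. by apply: bdd_suppD; apply: bdd_suppM. Qed.

Let Eu p : E p * u p = u p.
Proof.
rewrite /E /u; have [[-> d1]|->] := indD D1 p; have [[-> d2]|->] := indD D2 p.
- by have : (D1 `&` D2) p by []; rewrite D12.
- by rewrite addr0 mul1r.
- by rewrite add0r mul1r.
- by rewrite addr0 mul0r !mulr0 addr0.
Qed.

Lemma greenE b w : Ck 1 w ->
  I2 (fun p => partial b Psi p * w p * E p) = - I2 (fun p => u p * partial b w p).
Proof.
move=> cw.
have iL D : open D -> bounded_set D -> itg2 (fun p => partial b Psi p * w p * \1_D p).
  move=> oD bD; apply: itg2_cont_indic => // p; apply: cvgM; last exact: (Ck_cont cw).
  exact: (partial_cont cPsi).
have iR D c : open D -> bounded_set D -> itg2 (fun p => (Psi p - c) * partial b w p * \1_D p).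
  move=> oD bD; apply: itg2_cont_indic => // p; apply: cvgM; last exact: (partial_cont cw).
  exact: cPc.
have -> : (fun p => partial b Psi p * w p * E p) =
   (fun p => partial b Psi p * w p * \1_D1 p + partial b Psi p * w p * \1_D2 p).
  by apply/funext => p; rewrite /E mulrDr.
have -> : (fun p => u p * partial b w p) =
   (fun p => (Psi p - c1) * partial b w p * \1_D1 p + (Psi p - c2) * partial b w p * \1_D2 p).
  by apply/funext => p; rewrite /u mulrDl mulrAC; congr (_ + _); rewrite mulrAC.
rewrite !I2D; [|exact: iR|exact: iR|exact: iL|exact: iL].
by rewrite (green b oD1 bD1 bc1 cw) (green b oD2 bD2 bc2 cw) opprD.
Qed.

(** Each coordinate contributes the same amount; the sum over both gives the factor 2 in int x .
    grad Psi. *)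
Lemma virial b : I2 (fun p => partial b Psi p * coor b p * E p) = - U.
Proof.
rewrite (greenE b (Ck_co 1 b)); congr (- _); apply: I2_ext => p.
by rewrite (partial_eq (is_partial_co b b p)) eqxx mulr1.
Qed.

Lemma Ck_kern b d y : 0 < d -> Ck 1 (fun x => kern b d (x - y)).
Proof.
move=> d0; apply: CkM; first exact: Ck_cst.
apply: CkM; first exact: Ck_shift.
apply: Ck_inv; first by move=> p; rewrite gt_eqF// nsqd_gt0.
by apply: CkD; [exact: Ck_nsq|exact: Ck_cst].
Qed.

Lemma div_kern d x y : 0 < d ->
  partial false (fun x => kern false d (x - y)) x + partial true (fun x => kern true d (x - y)) x = eta d (x - y).
Proof.
move=> d0; have t0 := nsqd_gt0 (x - y) d0.
have isdk b : is_partial b (fun x => kern b d (x - y)) x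
  ((2 * pi)^-1 * ((nsq (x - y) + d ^+ 2)^-1 - coor b (x - y) * ((nsq (x - y) + d ^+ 2)^-1 ^+ 2 * (2 * coor b (x - y))))).
  apply: is_partial_eq.
    apply: is_partialZ; apply: is_partialM; first exact: is_partial_shift.
    apply: (is_partial_comp (F := fun t => t^-1) (h := fun x => nsq (x - y) + d ^+ 2)).
      have tn : nsq (x - y) + d ^+ 2 != 0 by rewrite gt_eqF.
      refine (is_derive_eq (df := - (nsq (x - y) + d ^+ 2)^-1 ^+ 2) (@is_deriveV R id (nsq (x - y) + d ^+ 2) _ 1 tn (is_derive_id _ (1 : R))) _).
      by rewrite /GRing.scale/= mulr1 exprVn.
    by apply: is_partialD; [exact: is_partial_nsq|exact: is_partial_cst].
  by rewrite eqxx /=; ring.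
rewrite (partial_eq (isdk false)) (partial_eq (isdk true)) /eta.
move: t0; rewrite nsqE; generalize (coor false (x - y)), (coor true (x - y)), (d ^+ 2) => X Y k /lt0r_neq0 t0.
move: (lt0r_neq0 (pi_gt0 R)); generalize (@pi R) => P P0.
by field; rewrite t0 P0.
Qed.

Let g b p := partial b Psi p * E p.
Let bg b : bdd_supp (g b). Proof. by apply: bdd_suppM => //; exact: partial_cont. Qed.

(** Green's identity in [x] for both components moves the derivatives from [Psi] to the kernel,
    whose divergence is [eta]. *)
Lemma inner_mollified d y : 0 < d ->
  I2 (fun x => g false x * kern false d (x - y) + g true x * kern true d (x - y)) =
  - I2 (fun x => u x * eta d (x - y)).
Proof.
move=> d0.
have e1 b : (fun x => g b x * kern b d (x - y)) = (fun x => partial b Psi x * kern b d (x - y) * E x).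
  by apply/funext => x; rewrite /g mulrAC.
have kc b : continuous (fun x => kern b d (x - y)) by exact: (Ck_cont (Ck_kern b y d0)).
have i1 b : itg2 (fun x => g b x * kern b d (x - y)).
  apply: bdd_supp_itg; under eq_fun do rewrite mulrC.
  exact: bdd_suppM.
have i2 b : itg2 (fun x => u x * partial b (fun x => kern b d (x - y)) x).
  apply: bdd_supp_itg; under eq_fun do rewrite mulrC.
  by apply: bdd_suppM => //; apply: partial_cont; exact: Ck_kern.
rewrite I2D; [|exact: i1|exact: i1].
rewrite !e1 !greenE; [|exact: Ck_kern|exact: Ck_kern].
rewrite -opprD -I2D; [|exact: i2|exact: i2].
congr (- _); apply: I2_ext => x; by rewrite -mulrDr div_kern.
Qed.

(** Formally this is Green's identity with the Laplacian s - 2 Omega of [Psi] on the patches, but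
    second derivatives of [Psi] are not at hand. The limit of the double integral of grad Psi(x) .
    k(x - y) s E(y) is therefore computed twice: exchanging the integrals and mollifying gives - s
    U, whereas [potential_limit] gives the integral of grad Psi . grad Theta, that is int |grad
    Psi|^2 - 2 Omega U. *)
Lemma energy_identity :
  I2 (fun p => partial false Psi p * g false p) + I2 (fun p => partial true Psi p * g true p) = (2 * Omega - s) * U.
Proof.
have sE : (fun y => s * \1_D1 y + s * \1_D2 y) = (fun y => s * E y).
  by apply/funext => y; rewrite /E mulrDr.
have bsE : bdd_supp (fun y => s * E y) by apply: bdd_suppM => // p; exact: cvg_cst.
have [mu' [M M0 [hM1 hM2]]] := bu.
pose v n y := I2 (fun x => u x * eta (dn n) (x - y)).
have vM n y : `|v n y| <= M.
  have [ie Ie] := eta_int y (dn0 n).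
  have fb x : `|u x * eta (dn n) (x - y)| <= M * eta (dn n) (x - y).
    by rewrite normrM (ger0_norm (eta_ge0 _ _)) ler_wpM2r ?eta_ge0.
  have fi : itg2 (fun x => u x * eta (dn n) (x - y)).
    by apply: itg2_dom (itg2Z M ie) fb; apply: mf2M; [exact: mf2_cont|exact: mf2_eta].
  by have := I2_abs fi (itg2Z M ie) fb; rewrite I2Z// Ie mulr1.
have vl y : v n y @[n --> \oo] --> u y.
  apply/cvgrPdist_le => /= e e0.
  have [d0 d00 hd] := mollify (mf2_cont u_cont) hM1 (@u_cont y) e0.
  by apply: filterS (dn_small d00) => n nd; rewrite distrC; exact: hd.
have bkb n b : bdd_supp_kernel (fun x y => g b x * (kern b (dn n) (x - y) * (s * E y))) by exact: bdd_supp_kernel_kern.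
pose k n x y := g false x * (kern false (dn n) (x - y) * (s * E y)) +
  g true x * (kern true (dn n) (x - y) * (s * E y)).
have bks n : bdd_supp_kernel (k n) by exact: bdd_supp_kernelD.
have inn n y : I2 (fun x => k n x y) = - (s * E y) * v n y.
  rewrite mulNr -mulrN -inner_mollified// -I2Z.
    apply: I2_ext => x; rewrite (mulrDr (s * E y)) /k.
    by congr (_ + _); rewrite mulrA mulrC.
  have ib b : itg2 (fun x => g b x * kern b (dn n) (x - y)).
    apply: bdd_supp_itg; under eq_fun do rewrite mulrC.
    by apply: bdd_suppM => //; exact: (Ck_cont (Ck_kern _ _ _)).
  by apply: itg2D; exact: ib.
have S n : double_integral (fun x y => g false x * (kern false (dn n) (x - y) * (s * E y))) +
   double_integral (fun x y => g true x * (kern true (dn n) (x - y) * (s * E y))) =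
   I2 (fun y => - (s * E y) * v n y).
  by rewrite -double_integral_D// (double_integral_swap (bks n)); apply: I2_ext => y; exact: inn.
have mv n : mf2 (fun y => - (s * E y) * v n y).
  by apply: itg2_mf; apply: itg2_ext (bdd_supp_kernel_itg1 (bdd_supp_kernel_swap (bks n))) => y; exact: inn.
have lim1 : I2 (fun y => - (s * E y) * v n y) @[n --> \oo] --> - s * U.
  have := @I2_cvg R (fun n y => - (s * E y) * v n y) (fun y => - (s * E y) * u y) (fun y => M * `|s * E y|).
  case=> //.
  - by apply: itg2Z; apply: itg2_abs; exact: bdd_supp_itg.
  - by move=> n y; rewrite normrM normrN mulrC ler_wpM2r.
  - by move=> y; apply: cvgM; [exact: cvg_cst|exact: vl].
  move=> _; suff -> : I2 (fun y => - (s * E y) * u y) = - s * U by [].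
  rewrite -I2Z; last exact: bdd_supp_itg.
  by apply: I2_ext => y; rewrite mulNr -mulrA Eu mulNr.
have lim2 b : double_integral (fun x y => g b x * (kern b (dn n) (x - y) * (s * E y))) @[n --> \oo] -->
    I2 (fun p => partial b Psi p * g b p) - Omega * U.
  have := potential_limit (b := b) (bg b).
  rewrite (_ : I2 (fun x => dTheta Psi Omega b x * g b x) = I2 (fun p => partial b Psi p * g b p) - Omega * U).
    by apply: cvg_seq_ext => n; apply: double_integral_ext => x y; rewrite -mulrDr.
  rewrite -mulrN -(virial b) -I2Z; last first.
    have -> : (fun p => partial b Psi p * coor b p * E p) = (fun p => coor b p * g b p).
      by apply/funext => p; rewrite /g mulrCA mulrA mulrAC.
    by apply: bdd_supp_itg; exact: bdd_suppM.
  rewrite -I2D.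
  - by apply: I2_ext => p; rewrite /dTheta /g; ring.
  - by apply: bdd_supp_itg; apply: bdd_suppM => //; exact: partial_cont.
  - apply: itg2Z; have -> : (fun p => partial b Psi p * coor b p * E p) = (fun p => coor b p * g b p).
      by apply/funext => p; rewrite /g mulrCA mulrA mulrAC.
    by apply: bdd_supp_itg; exact: bdd_suppM.
have lim3 : I2 (fun y => - (s * E y) * v n y) @[n --> \oo] -->
   (I2 (fun p => partial false Psi p * g false p) - Omega * U) + (I2 (fun p => partial true Psi p * g true p) - Omega * U).
  by apply: cvg_seq_ext (cvgD (lim2 false) (lim2 true)); exact: S.
have lims : - s * U = (I2 (fun p => partial false Psi p * g false p) - Omega * U) + (I2 (fun p => partial true Psi p * g true p) - Omega * U).
  have l1 := cvg_lim (@norm_hausdorff _ _) lim1.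
  have l3 := cvg_lim (@norm_hausdorff _ _) lim3.
  by rewrite -l1; exact: l3.
move: lims; generalize U, (I2 (fun p => partial false Psi p * g false p)), (I2 (fun p => partial true Psi p * g true p)) => u0 G1 G2 lims.
rewrite mulrBl -[- (s * u0)]mulNr lims; ring.
Qed.

Let B := I2 E.

(** Symmetrizing in x and y turns x . k(x - y) into (x - y) . k(x - y) / 2, and the smoothed kernel
    satisfies (x - y) . k(x - y) <= 1 / (2 pi). Hence the factor 1 / (4 pi). *)
Lemma moment_bound :
  I2 (fun x => dTheta Psi Omega false x * (coor false x * E x)) +
  I2 (fun x => dTheta Psi Omega true x * (coor true x * E x)) <= s * (B ^+ 2 / (4 * pi)).
Proof.
have pi0 := pi_gt0 R.
have bc b : bdd_supp (fun x => coor b x * E x) by exact: bdd_suppM.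
have E0 x : 0 <= E x by rewrite addr_ge0// indicE.
pose k n x y := coor false x * E x * (kern false (dn n) (x - y) * E y) +
                coor true x * E x * (kern true (dn n) (x - y) * E y).
have bks n : bdd_supp_kernel (k n) by apply: bdd_supp_kernelD; exact: bdd_supp_kernel_kern.
have kB n : double_integral (k n) <= B ^+ 2 / (4 * pi).
  have bkp : bdd_supp_kernel (fun x y => E x * ((2 * pi)^-1 * E y)) by exact: bdd_supp_kernel_prod.
  have : double_integral (fun x y => k n x y + k n y x) <= double_integral (fun x y => E x * ((2 * pi)^-1 * E y)).
    apply: double_integral_le => //; first by apply: bdd_supp_kernelD => //; exact: bdd_supp_kernel_swap.
    move=> x y.
    have -> : k n x y + k n y x = E x * E y * (coor false (x - y) * kern false (dn n) (x - y) + coor true (x - y) * kern true (dn n) (x - y)).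
      rewrite /k -[y - x]opprB !kernN.
      have -> : coor false (x - y) = coor false x - coor false y by [].
      have -> : coor true (x - y) = coor true x - coor true y by [].
      by ring.
    rewrite (mulrC (2 * pi)^-1 (E y)) (mulrA (E x) (E y) (2 * pi)^-1) ler_wpM2l ?mulr_ge0//.
    have t0 := nsqd_gt0 (x - y) (dn0 n).
    have -> : coor false (x - y) * kern false (dn n) (x - y) + coor true (x - y) * kern true (dn n) (x - y) =
      (2 * pi)^-1 * (nsq (x - y) / (nsq (x - y) + dn n ^+ 2)).
      rewrite /kern; generalize (nsq (x - y) + dn n ^+ 2)^-1 => I; rewrite nsqE; ring.
    have p20 : 0 <= (2 * pi : R)^-1 by rewrite invr_ge0 mulr_ge0// pi_ge0.
    apply: ler_piMr => //.
    by rewrite ler_pdivrMr// mul1r lerDl sqr_ge0.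
  rewrite double_integral_D//; last exact: bdd_supp_kernel_swap.
  rewrite -(double_integral_swap (bks n)) (double_integral_prod (2 * pi)^-1 bE bE) -/B => h.
  have -> : B ^+ 2 / (4 * pi) = ((2 * pi)^-1 * (B * B)) / 2.
    by move: (lt0r_neq0 pi0); generalize (@pi R) => P P0; field.
  by rewrite ler_pdivlMr// mulr_natr mulr2n.
have lim b := potential_limit (b := b) (bc b).
have h : s * double_integral (k n) @[n --> \oo] -->
  I2 (fun x => dTheta Psi Omega false x * (coor false x * E x)) +
  I2 (fun x => dTheta Psi Omega true x * (coor true x * E x)).
  apply: cvg_seq_ext (cvgD (lim false) (lim true)) => n.
  rewrite -(double_integral_Z s (bks n)).
  have bsE : bdd_supp (fun y => s * \1_D1 y + s * \1_D2 y).
    by apply: bdd_suppD; apply: bdd_suppM => // p; exact: cvg_cst.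
  rewrite [LHS](_ : _ = double_integral (fun x y => coor false x * E x * (kern false (dn n) (x - y) * (s * \1_D1 y + s * \1_D2 y))) +
     double_integral (fun x y => coor true x * E x * (kern true (dn n) (x - y) * (s * \1_D1 y + s * \1_D2 y))))//.
  rewrite -double_integral_D; [|exact: bdd_supp_kernel_kern|exact: bdd_supp_kernel_kern].
  apply: double_integral_ext => x y; rewrite -mulrDr -/(E y) [RHS]mulrDr.
  by congr (_ + _); rewrite (mulrCA _ s) (mulrCA _ s).
rewrite -(cvg_lim _ h)//; apply: limr_le; first exact: cvgP h.
by near=> n; rewrite ler_pM2l//; exact: kB.
Unshelve. all: by end_near.
Qed.

(* If 2 Omega > s, then the virial and energy identities, put into the expansion of
   0 <= int |grad Psi + (2 Omega - s)/2 (x - a)|^2 with a the centroid of D1 on D1, bound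
   the second moment of D1 u D2 strictly below that of the disc of the same area. *)
Lemma Omega_le : Omega <= s / 2.
Proof.
rewrite leNgt; apply/negP => sO.
have A1p : 0 < A1 by exact: area_gt0.
have [X1p _] := moment_gt0.
have pi0 := pi_gt0 R.
pose a := X1 / A1.
pose L := 2 * Omega - s.
have L0 : 0 < L by rewrite /L; move: sO; lra.
pose I := I2 (fun p => nsq p * E p).
have inq : continuous (@nsq R) := @nsq_cont R.
have bn : bdd_supp (fun p => nsq p * E p) by exact: bdd_suppM.
have bIb b : bdd_supp (fun p => coor b p * (coor b p * E p)) by apply: bdd_suppM => //; exact: bdd_suppM.
have IE : I = I2 (fun p => coor false p * (coor false p * E p)) + I2 (fun p => coor true p * (coor true p * E p)).
  rewrite -I2D; [|exact: bdd_supp_itg|exact: bdd_supp_itg].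
  by apply: I2_ext => p; rewrite nsqE; ring.
have h1' := bathtub oD1 oD2 bD1 bD2 D12; rewrite -/E -/B -/I in h1'.
have bgco b : bdd_supp (fun p => coor b p * g b p) by exact: bdd_suppM.
have virial' b : I2 (fun p => coor b p * g b p) = - U.
  by rewrite -(virial b); apply: I2_ext => p; rewrite /g mulrCA mulrA mulrAC.
have h2' : - 2 * U + Omega * I <= s * (B ^+ 2 / (4 * pi)).
  apply: le_trans moment_bound.
  have e b : I2 (fun x => dTheta Psi Omega b x * (coor b x * E x)) = - U + Omega * I2 (fun p => coor b p * (coor b p * E p)).
    rewrite -(virial' b) -I2Z; last exact: bdd_supp_itg.
    rewrite -I2D; [|exact: bdd_supp_itg|by apply: itg2Z; exact: bdd_supp_itg].
    by apply: I2_ext => p; rewrite /dTheta /g; ring.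
  by rewrite !e IE; move: (I2 _) (I2 _) => t1 t2; lra.
have h3' := energy_identity; rewrite -/L in h3'.
have h4' : 0 <= L * U - L * U * 2 + L ^+ 2 / 4 * (I - X1 ^+ 2 / A1).
  pose q b p := partial b Psi p + L / 2 * coor b p.
  (* [F] is the expansion of |q - (L a / 2) e_1|^2 on D1 and of |q|^2 on D2, with e_1 the first
     basis vector. For a = X1 / A1 the terms in a integrate to - L^2 X1^2 / (4 A1), the strict
     gain. *)
  pose F p := (q false p * q false p + q true p * q true p) * E p +
      (- (L * a) * (partial false Psi p * \1_D1 p) + (- (L ^+ 2 / 2 * a) * (coor false p * \1_D1 p) + L ^+ 2 / 4 * a ^+ 2 * \1_D1 p)).
  have F0 p : 0 <= F p.
    have : F p = ((q false p - L / 2 * a) ^+ 2 + q true p ^+ 2) * \1_D1 p + (q false p ^+ 2 + q true p ^+ 2) * \1_D2 p.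
      by rewrite /F /E /q; field.
    move=> ->; apply: addr_ge0; apply: mulr_ge0; rewrite ?addr_ge0 ?sqr_ge0// indicE.
  have := I2_ge0 F0.
  have bgg b : bdd_supp (fun p => partial b Psi p * g b p) by apply: bdd_suppM => //; exact: partial_cont.
  have bdd1 : itg2 (fun p => partial false Psi p * \1_D1 p) by apply: itg2_cont_indic => //; exact: partial_cont.
  have bco1 : itg2 (fun p => coor false p * \1_D1 p) by apply: itg2_cont_indic.
  have b1' := bdd_supp_itg b1.
  have ibg b : itg2 (fun p => partial b Psi p * g b p) by exact: bdd_supp_itg.
  have ibc b : itg2 (fun p => coor b p * g b p) by exact: bdd_supp_itg.
  have ibi b : itg2 (fun p => coor b p * (coor b p * E p)) by exact: bdd_supp_itg.
  have -> : F = (fun p => ((partial false Psi p * g false p + (L * (coor false p * g false p) + L ^+ 2 / 4 * (coor false p * (coor false p * E p)))) +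
       (partial true Psi p * g true p + (L * (coor true p * g true p) + L ^+ 2 / 4 * (coor true p * (coor true p * E p))))) +
    (- (L * a) * (partial false Psi p * \1_D1 p) + (- (L ^+ 2 / 2 * a) * (coor false p * \1_D1 p) + L ^+ 2 / 4 * a ^+ 2 * \1_D1 p))).
    by apply/funext => p; rewrite /F /q /g; field.
  have iT b : itg2 (fun p => partial b Psi p * g b p + (L * (coor b p * g b p) + L ^+ 2 / 4 * (coor b p * (coor b p * E p)))).
    by apply: itg2D => //; apply: itg2D; apply: itg2Z.
  have iS : itg2 (fun p => - (L * a) * (partial false Psi p * \1_D1 p) + (- (L ^+ 2 / 2 * a) * (coor false p * \1_D1 p) + L ^+ 2 / 4 * a ^+ 2 * \1_D1 p)).
    by apply: itg2D; [exact: itg2Z|apply: itg2D; exact: itg2Z].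
  have eT b : I2 (fun p => partial b Psi p * g b p + (L * (coor b p * g b p) + L ^+ 2 / 4 * (coor b p * (coor b p * E p)))) =
    I2 (fun p => partial b Psi p * g b p) + (L * - U + L ^+ 2 / 4 * I2 (fun p => coor b p * (coor b p * E p))).
    rewrite I2D//; last by apply: itg2D; exact: itg2Z.
    by rewrite (I2D (itg2Z L (ibc b)) (itg2Z _ (ibi b))) (I2Z L (ibc b)) (I2Z _ (ibi b)) virial'.
  have eS : I2 (fun p => - (L * a) * (partial false Psi p * \1_D1 p) + (- (L ^+ 2 / 2 * a) * (coor false p * \1_D1 p) + L ^+ 2 / 4 * a ^+ 2 * \1_D1 p)) =
     - (L ^+ 2 / 2 * a) * X1 + L ^+ 2 / 4 * a ^+ 2 * A1.
    rewrite I2D; [|exact: itg2Z|by apply: itg2D; exact: itg2Z].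
    by rewrite (I2D (itg2Z _ bco1) (itg2Z _ b1')) (I2Z _ bdd1) (I2Z _ bco1) (I2Z _ b1') (partial_int0 false oD1 bD1 bc1) mulr0 add0r.
  rewrite I2D//; last exact: itg2D.
  rewrite I2D// !eT eS IE.
  have -> : - (L ^+ 2 / 2 * a) * X1 + L ^+ 2 / 4 * a ^+ 2 * A1 = - (L ^+ 2 / 4 * (X1 ^+ 2 / A1)).
    rewrite /a; move: (lt0r_neq0 A1p); generalize A1, X1 => t1 t2 t10; by field.
  by move: h3'; move: (I2 _) (I2 _) (I2 _) (I2 _) => t1 t2 t3 t4; lra.
have X2p : 0 < X1 ^+ 2 / A1.
  rewrite divr_gt0// exprn_even_gt0//=; apply/negP => /eqP X10.
  by move: X1p; rewrite X10 mulr0 ltxx.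
have e4 : B ^+ 2 / (4 * pi) = B ^+ 2 / (2 * pi) / 2.
  by move: (lt0r_neq0 pi0); generalize (@pi R), B => P b P0; field.
rewrite e4 in h2'; exact: (energy_arith s0 sO X2p h2' h1' h4').
Qed.
End HalfPlane.
End Energy.

(** * Riemann's summation of trigonometric series *)

Section RiemannSummation.
Context {R : realType}.
Implicit Types (x y h t A s : R) (a c : nat -> R).

Lemma abs_sinB x y : x < y -> `|sin y - sin x| <= y - x.
Proof.
move=> xy; have [|c _ ->] := @MVT R sin cos x y xy (fun z _ => is_derive_sin z).
  by apply: continuous_subspaceT; exact: continuous_sin.
have d0 : 0 <= y - x by rewrite subr_ge0 ltW.
by rewrite normrM (ger0_norm d0) ler_piMl// cos_max.
Qed.

Lemma abs_sin x : 0 < x -> `|sin x| <= x.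
Proof. by move=> x0; have := abs_sinB x0; rewrite sin0 !subr0. Qed.

Lemma xcos_sin x : 0 < x -> `|x * cos x - sin x| <= x ^+ 2.
Proof.
move=> x0; pose f z : R := z * cos z - sin z.
have df z : is_derive z (1 : R) f (- (z * sin z)).
  have d1 := is_deriveB (is_deriveM (is_derive_id z (1 : R)) (is_derive_cos z)) (is_derive_sin z).
  by refine (is_derive_eq d1 _); rewrite /GRing.scale/= mulr1; ring.
have [|c] := @MVT R f _ 0 x x0 (fun z _ => df z).
  apply: continuous_subspaceT => z; apply: differentiable_continuous.
  by apply/derivable1_diffP; have [] := df z.
rewrite in_itv/= => /andP[c0 cx]; rewrite /f mul0r sin0 !subr0 => ->.
rewrite normrM normrN (gtr0_norm x0) expr2 ler_pM2r// normrM (gtr0_norm c0).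
by apply: le_trans (ltW cx); apply: ler_piMr; [exact: ltW|exact: sin_max].
Qed.

Definition sinc x : R := sin x / x.
(** The weights of Riemann's method: the second difference of - cos(k t) / k^2 with step 2 h is 4
    h^2 cos(k t) [sinc2] (k h). *)
Definition sinc2 x := sinc x ^+ 2.

Lemma sinc_le1 x : 0 < x -> `|sinc x| <= 1.
Proof. by move=> x0; rewrite /sinc normrM normfV (gtr0_norm x0) ler_pdivrMr// mul1r abs_sin. Qed.

Lemma sinc_leV x : 0 < x -> `|sinc x| <= x^-1.
Proof.
move=> x0; rewrite /sinc normrM normfV (gtr0_norm x0).
by apply: ler_piMl; [rewrite invr_ge0 ltW|exact: sin_max].
Qed.

Lemma sinc_lip x y : 0 < x -> x < y -> `|sinc y - sinc x| <= y - x.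
Proof.
move=> x0 xy.
have df (z : R) : 0 < z -> is_derive z (1 : R) sinc ((z * cos z - sin z) / z ^+ 2).
  move=> z0; have zn : z != 0 by rewrite gt_eqF.
  have d1 := is_deriveM (is_derive_sin z) (@is_deriveV R id z _ 1 zn (is_derive_id z (1 : R))).
  have -> : sinc = sin * (fun z => (id z)^-1) by apply/funext.
  by refine (is_derive_eq d1 _); rewrite /GRing.scale/= mulr1; field.
have [z|z|c] := @MVT R sinc (fun z => (z * cos z - sin z) / z ^+ 2) x y xy.
- by rewrite in_itv/= => /andP[xz _]; apply: df; exact: lt_trans xz.
- apply: continuous_in_subspaceT => z'; rewrite inE/= in_itv/= => /andP[xz _].
  apply: differentiable_continuous; apply/derivable1_diffP.
  by have [] := df z' (lt_le_trans x0 xz).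
rewrite in_itv/= => /andP[xc cy] ->; have c0 : 0 < c by exact: lt_trans xc.
have d0 : 0 <= y - x by rewrite subr_ge0 ltW.
rewrite normrM (ger0_norm d0) ler_piMl//.
by rewrite normrM normfV (ger0_norm (sqr_ge0 c)) ler_pdivrMr ?exprn_gt0// mul1r xcos_sin.
Qed.

Lemma sinc2_lip x y : 0 < x -> x < y -> `|sinc2 y - sinc2 x| <= 2 * (y - x).
Proof.
move=> x0 xy; have y0 : 0 < y by exact: lt_trans xy.
rewrite /sinc2 subr_sqr normrM mulrC ler_pM//; last exact: sinc_lip.
by apply: le_trans (ler_normD _ _) _; have := sinc_le1 x0; have := sinc_le1 y0; lra.
Qed.

(** In the difference of squares one factor is at most 2 (y - x) / y and the other at most 2 / x.
    Their product is the increment of -4 / x, so the variation near infinity is finite. *)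
Lemma sinc2_tail x y : 0 < x -> x < y -> `|sinc2 y - sinc2 x| <= 4 * (x^-1 - y^-1).
Proof.
move=> x0 xy; have y0 : 0 < y by exact: lt_trans xy.
have h1 : `|sinc y - sinc x| <= 2 * ((y - x) / y).
  have -> : sinc y - sinc x = (sin y - sin x) / y - sinc x * ((y - x) / y).
    by rewrite /sinc; field; rewrite !gt_eqF.
  have q0 : 0 <= (y - x) / y by rewrite divr_ge0 ?subr_ge0 ?ltW.
  apply: le_trans (ler_normB _ _) _; rewrite mulr_natl mulr2n; apply: lerD.
    by rewrite normrM normfV (gtr0_norm y0) ler_pM2r ?invr_gt0// abs_sinB.
  by rewrite normrM (ger0_norm q0) ler_piMl// sinc_le1.
have h2 : `|sinc y + sinc x| <= 2 * x^-1.
  apply: le_trans (ler_normD _ _) _; rewrite mulr_natl mulr2n; apply: lerD; last exact: sinc_leV.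
  by apply: le_trans (sinc_leV y0) _; rewrite lef_pV2 ?posrE// ltW.
rewrite /sinc2 subr_sqr normrM.
have -> : 4 * (x^-1 - y^-1) = (2 * ((y - x) / y)) * (2 * x^-1) by field; rewrite !gt_eqF.
by rewrite ler_pM.
Qed.

(* The total variation of sinc2 on an interval ]x, y[ is at most svar y - svar x. *)
Definition svar x : R := if x <= 1 then 2 * x else 6 - 4 / x.

Lemma svar_bound x : 0 < x -> 0 <= svar x <= 6.
Proof.
move=> x0; rewrite /svar; case: ifP => x1; first by apply/andP; split; move: x0 x1; lra.
have {}x1 : 1 < x by rewrite ltNge x1.
have : x^-1 <= 1 by rewrite invf_le1// ltW.
have : 0 < x^-1 by rewrite invr_gt0.
by move=> *; apply/andP; split; lra.
Qed.

Lemma sinc2_var x y : 0 < x -> x < y -> `|sinc2 y - sinc2 x| <= svar y - svar x.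
Proof.
move=> x0 xy; have y0 : 0 < y by exact: lt_trans xy.
rewrite /svar; have [y1|y1] := leP y 1.
  have -> : x <= 1 by rewrite (le_trans (ltW xy)).
  by have := sinc2_lip x0 xy; lra.
have [x1|x1] := leP x 1; last by have := sinc2_tail x0 xy; lra.
have h1 := sinc2_tail ltr01 y1; rewrite invr1 in h1.
move: x1; rewrite le_eqVlt => /orP[/eqP ->|x1]; first by move: h1; lra.
have h2 := sinc2_lip x0 x1.
have := ler_normD (sinc2 y - sinc2 1) (sinc2 1 - sinc2 x); rewrite addrA subrK.
by move: h1 h2; lra.
Qed.

Lemma sinc2_near0 : exists2 h0, 0 < h0 & forall h, 0 < h -> h < h0 -> 1 / 4 <= sinc2 h.
Proof.
have cc : cos x @[x --> (0 : R)] --> cos (0 : R) by exact: continuous_cos.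
move: cc; rewrite cos0 => /cvgrPdist_lt/(_ (1 / 2)); rewrite divr_gt0// => /(_ isT).
move=> /nbhs_ballP[e /= e0 he]; exists e => // h h0 hh.
have [|c] := @MVT R sin cos 0 h h0 (fun z _ => is_derive_sin z).
  by apply: continuous_subspaceT; exact: continuous_sin.
rewrite in_itv/= => /andP[c0 ch]; rewrite sin0 !subr0 => sh.
have hc : 1 / 2 <= cos c.
  have := he c; rewrite /ball/= sub0r normrN gtr0_norm// => /(_ (lt_trans ch hh)).
  by rewrite ltr_norml => /andP[_]; lra.
rewrite /sinc2 /sinc sh mulfK ?gt_eqF//.
have -> : 1 / 4 = (1 / 2) ^+ 2 :> R by field.
by rewrite ler_pXn2r ?nnegrE ?divr_ge0// (le_trans _ hc)// divr_ge0.
Qed.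

(** Abel summation with the partial sums centred at [s], the contribution of the constant [s]
    telescoping to s [sinc2 h]. *)
Lemma abel_sinc (c : nat -> R) s h N : let S n := \sum_(1 <= k < n.+1) c k in
  \sum_(1 <= k < N.+1) c k * sinc2 (k%:R * h) - s * sinc2 h =
  \sum_(1 <= k < N.+1) (S k - s) * (sinc2 (k%:R * h) - sinc2 (k.+1%:R * h)) + (S N - s) * sinc2 (N.+1%:R * h).
Proof.
move=> S; elim: N => [|N IH].
  by rewrite /S !big_geq// mul1r; ring.
rewrite !(big_nat_recr N.+1)//= addrAC IH.
have -> : S N.+1 = S N + c N.+1 by rewrite /S (big_nat_recr N.+1).
ring.
Qed.

(** The main term s [sinc2 h] is at least s/4. In the Abel sum the terms before N0 cost at most s/16
    by the Lipschitz bound, the later ones s/64 times the total variation 6, and the last term s/64.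
    What remains is 5 s/64 >= s/16. *)
Lemma riemann_pos c s : 0 < s -> \sum_(1 <= k < N.+1) c k @[N --> \oo] --> s ->
  exists2 h, 0 < h < 1 & exists N0, forall N, (N0 <= N)%N -> s / 16 <= \sum_(1 <= k < N.+1) c k * sinc2 (k%:R * h).
Proof.
move=> s0 cs; set S := (fun N : nat => _) in cs.
have [B B0 hB] : exists2 B, 0 <= B & forall k, `|S k - s| <= B.
  have [M [_ hM]] := cvg_seq_bounded (cvgP _ cs).
  exists (`|M| + 1 + `|s|); first by rewrite !addr_ge0.
  move=> k; apply: le_trans (ler_normB _ _) _; rewrite lerD2r.
  apply: hM => //; by rewrite (le_lt_trans (ler_norm M))// ltrDl.
have [N0 hN0] : exists N0, forall k, (N0 <= k)%N -> `|S k - s| <= s / 64.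
  move/cvgrPdist_le : cs => /(_ (s / 64)); rewrite divr_gt0// => /(_ isT)[N0 _ hN0].
  by exists N0 => k /hN0; rewrite distrC.
have [h0 h00 hh0] := sinc2_near0.
(* The three bounds keep h below 1, give the weight 1/4, and make B (2 h) N0 at most s/16. *)
pose h := Num.min (Num.min (1 / 2) (h0 / 2)) (s / (32 * (B * N0%:R + 1))).
have BN : 0 < B * N0%:R + 1 by rewrite ltr_wpDl// mulr_ge0.
have hp : 0 < h by rewrite !lt_min !divr_gt0// mulr_gt0.
have h1 : h <= 1 / 2 by rewrite /h !ge_min lexx.
have h2 : h <= h0 / 2 by rewrite /h !ge_min lexx !orbT.
have h3 : h <= s / (32 * (B * N0%:R + 1)) by rewrite /h !ge_min lexx !orbT.
exists h; first by rewrite hp/=; move: h1; lra.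
exists N0 => N NN.
have u4 : 1 / 4 <= sinc2 h by apply: hh0 => //; move: h2 h00; lra.
have xk k : (0 < k)%N -> 0 < k%:R * h by move=> k0; rewrite mulr_gt0// ltr0n.
have xk1 k : k%:R * h < k.+1%:R * h by rewrite ltr_pM2r// ltr_nat.
have P n : `|\sum_(1 <= k < n.+1) (S k - s) * (sinc2 (k%:R * h) - sinc2 (k.+1%:R * h))| <=
    B * (2 * h) * (minn n N0)%:R + s / 64 * (svar (n.+1%:R * h) - svar h).
  elim: n => [|n IH].
    by rewrite big_geq// normr0 mul1r subrr min0n !mulr0 addr0.
  rewrite (big_nat_recr n.+1)//=; apply: le_trans (ler_normD _ _) _.
  apply: le_trans (lerD IH (lexx _)) _; rewrite normrM.
  have d1 := sinc2_lip (xk n.+1 isT) (xk1 n.+1); have d2 := sinc2_var (xk n.+1 isT) (xk1 n.+1).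
  rewrite distrC in d1; rewrite distrC in d2.
  have e1 : n.+2%:R * h - n.+1%:R * h = h by rewrite -mulrBl -natrB// subSnn mul1r.
  rewrite e1 in d1.
  set T := `|sinc2 _ - _| in d1 d2 *.
  have [nN|Nn] := ltnP n.+1 N0.
    have -> : minn n N0 = n by apply/minn_idPl; exact: ltnW (ltnW nN).
    have t1 : `|S n.+1 - s| * T <= B * (2 * h) by apply: ler_pM => //; exact: normr_ge0.
    have t2 : 0 <= s / 64 * (svar (n.+2%:R * h) - svar (n.+1%:R * h)).
      by apply: mulr_ge0; [rewrite divr_ge0// ltW|apply: le_trans d2; exact: normr_ge0].
    have e2 : B * (2 * h) * n.+1%:R = B * (2 * h) * n%:R + B * (2 * h) by rewrite -[X in _ * X = _]natr1 mulrDr mulr1.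
    by move: t1 t2; rewrite e2 !mulrBr; lra.
  have mm : ((minn n N0)%:R : R) <= N0%:R by rewrite ler_nat geq_minr.
  have t1 : `|S n.+1 - s| * T <= s / 64 * (svar (n.+2%:R * h) - svar (n.+1%:R * h)).
    by apply: ler_pM => //; [exact: normr_ge0|exact: hN0].
  have t3 : B * (2 * h) * (minn n N0)%:R <= B * (2 * h) * N0%:R.
    by rewrite ler_wpM2l// !mulr_ge0// ltW.
  by move: t1 t3; rewrite !mulrBr; lra.
have AB := abel_sinc c s h N; rewrite /= -/(S N) in AB.
have hP := P N.
have mN : ((minn N N0)%:R : R) <= N0%:R by rewrite ler_nat geq_minr.
have b1 : B * (2 * h) * (minn N N0)%:R <= s / 16.
  apply: (@le_trans _ _ (2 * h * (B * N0%:R + 1))).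
    have -> : B * (2 * h) * (minn N N0)%:R = 2 * h * (B * (minn N N0)%:R) by ring.
    rewrite ler_pM2l ?mulr_gt0//; apply: (@le_trans _ _ (B * N0%:R)); last by rewrite lerDl.
    by rewrite ler_wpM2l.
  move: h3; rewrite ler_pdivlMr ?mulr_gt0//; lra.
have b2 : s / 64 * (svar (N.+1%:R * h) - svar h) <= s / 64 * 6.
  have s64 : 0 <= s / 64 by rewrite divr_ge0// ltW.
  rewrite ler_wpM2l//.
  have /andP[_ k1] := svar_bound (xk N.+1 isT); have /andP[k2 _] := svar_bound hp.
  by rewrite (le_trans _ k1)// gerDl oppr_le0.
have b3 : `|(S N - s) * sinc2 (N.+1%:R * h)| <= s / 64.
  rewrite normrM -[leRHS]mulr1 ler_pM ?hN0//.
  by rewrite /sinc2 normrX expr_le1// sinc_le1// xk.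
have b4 : s * (1 / 4) <= s * sinc2 h by rewrite ler_pM2l.
have hP2 := le_trans hP (lerD b1 b2).
move: hP2 b3 AB b4; rewrite !ler_norml => /andP[p1 _] /andP[p2 _] AB b4.
move: (\sum_(1 <= k < _) _) (\sum_(1 <= k < _) _) AB p1 => X Y.
by move: b4 p2; lra.
Qed.

(** The rate is returned along with the limit: as [A] will not depend on t, it plays the part of
    uniform convergence. *)
Lemma cauchy_bound (x_ : nat -> R) A : 0 <= A -> (forall M N, (0 < M)%N -> (M <= N)%N -> `|x_ N - x_ M| <= A / M%:R) ->
  exists l, forall M, (0 < M)%N -> `|l - x_ M| <= A / M%:R.
Proof.
move=> A0 hx.
have small e : 0 < e -> exists2 M, (0 < M)%N & A / M%:R < e.
  move=> e0; exists (Num.Def.archi_bound (A / e)).+1 => //.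
  rewrite ltr_pdivrMr// mulrC -ltr_pdivrMr//; apply: lt_le_trans (archi_boundP _) _.
    by rewrite divr_ge0// ltW.
  by rewrite ler_nat.
have cx : cvg (x_ @ \oo).
  apply: cauchy_cvg; apply: cauchy_exP => /= e e0.
  have [M M0 hM] := small e e0; exists (x_ M), M => // N /= MN.
  by rewrite /ball/= distrC; apply: le_lt_trans hM; exact: hx.
exists (lim (x_ @ \oo)) => M M0.
have cl : `|x_ N - x_ M| @[N --> \oo] --> `|lim (x_ @ \oo) - x_ M|.
  by apply: cvg_norm; apply: cvgB; [exact: cx|exact: cvg_cst].
rewrite -(cvg_lim _ cl)//; apply: limr_le; first exact: cvgP cl.
by exists M => // N /= MN; exact: hx.
Qed.

Lemma cos_second_diff K t h :
  cos (K * (t + 2 * h)) + cos (K * (t - 2 * h)) - 2 * cos (K * t) = - 4 * (cos (K * t) * sin (K * h) ^+ 2).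
Proof.
have -> : K * (t + 2 * h) = K * t + (K * h) *+ 2 by rewrite -mulr_natl; ring.
have -> : K * (t - 2 * h) = K * t - (K * h) *+ 2 by rewrite -mulr_natl; ring.
rewrite cosD cosB cos_mulr2n cos2sin2 -mulr_natl; ring.
Qed.

Lemma sinc2E x : x != 0 -> x ^+ 2 * sinc2 x = sin x ^+ 2.
Proof. by move=> x0; rewrite /sinc2 /sinc; field. Qed.

Lemma second_diff_step (u v w a h K cu cv cw q : R) : K != 0 ->
  cu + cv - 2 * cw = - 4 * (cw * ((K * h) ^+ 2 * q)) ->
  u - a * cu / K ^+ 2 + (v - a * cv / K ^+ 2) - 2 * (w - a * cw / K ^+ 2) =
  u + v - 2 * w + 4 * h ^+ 2 * (a * cw * q).
Proof.
move=> K0 sd; have -> : cu = - 4 * (cw * ((K * h) ^+ 2 * q)) - cv + 2 * cw by rewrite -sd; ring.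
by field.
Qed.

(* Riemann: the sum S of the twice integrated series is continuous and periodic, hence has a
   maximum; the second differences of S there are nonpositive and sum the series. *)
Lemma trig_series_sign a (F : R -> R) :
  (forall t, \sum_(1 <= n < N.+1) a n * cos (n%:R * t) @[N --> \oo] --> F t) -> exists t, F t <= 0.
Proof.
move=> hF; apply: contrapT => /forallNP hn.
have Fp t : 0 < F t by rewrite ltNge; apply/negP; exact: hn.
(* Convergence at t = 0 already bounds the coefficients. *)
have [A A0 hA] : exists2 A, 0 <= A & forall n, `|a n.+1| <= A.
  have c0 := hF 0.
  have [M [_ hM]] := cvg_seq_bounded (cvgP _ c0).
  exists ((`|M| + 1) * 2); first by rewrite mulr_ge0// addr_ge0.
  move=> n.
  have e1 : a n.+1 = \sum_(1 <= k < n.+2) a k * cos (k%:R * 0) - \sum_(1 <= k < n.+1) a k * cos (k%:R * 0).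
    by rewrite (big_nat_recr n.+1)//= mulr0 cos0 mulr1 addrAC subrr add0r.
  rewrite e1; apply: le_trans (ler_normB _ _) _; rewrite mulrC mulr_natl mulr2n.
  by apply: lerD; apply: hM => //; rewrite (le_lt_trans (ler_norm M))// ltrDl.
pose SN N t := - \sum_(1 <= n < N.+1) a n * cos (n%:R * t) / n%:R ^+ 2.
have SNS N t : SN N.+1 t = SN N t - a N.+1 * cos (N.+1%:R * t) / N.+1%:R ^+ 2.
  by rewrite /SN (big_nat_recr N.+1)//= opprD.
(* The tail telescopes by 1 / (N+1)^2 <= 1/N - 1/(N+1), uniformly in t. *)
have hS t M N : (0 < M)%N -> (M <= N)%N -> `|SN N t - SN M t| <= A / M%:R - A / N%:R.
  move=> M0; elim: N => [|N IH]; first by rewrite leqn0 => /eqP h; rewrite h in M0.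
  rewrite leq_eqVlt => /orP[/eqP ->|]; first by rewrite !subrr normr0.
  rewrite ltnS => MN; have N0 : (0 < N)%N by exact: leq_trans MN.
  rewrite SNS addrAC; apply: le_trans (ler_normB _ _) _.
  apply: le_trans (lerD (IH MN) (lexx _)) _.
  have N1 : (0 : R) < N%:R by rewrite ltr0n.
  have : `|a N.+1 * cos (N.+1%:R * t) / N.+1%:R ^+ 2| <= A * (N%:R^-1 - N.+1%:R^-1).
    rewrite normrM; apply: ler_pM => //.
      by rewrite normrM -[leRHS]mulr1 ler_pM// cos_max.
    rewrite normfV ger0_norm ?sqr_ge0//.
    have -> : N%:R^-1 - N.+1%:R^-1 = (N%:R * N.+1%:R)^-1 :> R.
      by rewrite -natr1; field; rewrite !gt_eqF// ltr_pwDr.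
    by rewrite lef_pV2 ?posrE ?mulr_gt0 ?exprn_gt0// expr2 ler_wpM2r// ler_nat.
  rewrite mulrBr; move: (A / M%:R) (A / N%:R) (A / N.+1%:R) `|_| => *; lra.
have hS1 t M N : (0 < M)%N -> (M <= N)%N -> `|SN N t - SN M t| <= A / M%:R.
  by move=> M0 MN; apply: le_trans (hS t M N M0 MN) _; rewrite gerBl divr_ge0.
have [S HS] := choice (fun t => cauchy_bound A0 (hS1 t)).
have cSN N : continuous (SN N).
  elim: N => [|N IH].
    rewrite (_ : SN 0%N = fun=> 0); first by move=> t; exact: cvg_cst.
    by apply/funext => t; rewrite /SN big_geq// oppr0.
  rewrite (_ : SN N.+1 = fun t => SN N t - a N.+1 * cos (N.+1%:R * t) / N.+1%:R ^+ 2); last first.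
    by apply/funext => t; rewrite SNS.
  move=> t; apply: cvgB; first exact: IH.
  apply: cvgM; last exact: cvg_cst.
  apply: cvgM; first exact: cvg_cst.
  apply: (cvg_comp (fun t => N.+1%:R * t) cos); last exact: continuous_cos.
  by apply: cvgM; [exact: cvg_cst|exact: cvg_id].
have small e : 0 < e -> exists2 M, (0 < M)%N & A / M%:R < e.
  move=> e0; exists (Num.Def.archi_bound (A / e)).+1 => //.
  rewrite ltr_pdivrMr// mulrC -ltr_pdivrMr//; apply: lt_le_trans (archi_boundP _) _.
    by rewrite divr_ge0// ltW.
  by rewrite ler_nat.
have cS : continuous S.
  move=> t; apply/cvgrPdist_lt => e e0.
  have e3 : 0 < e / 3 by rewrite divr_gt0.
  have [M M0 hM] := small _ e3.
  have := cSN M t; move=> /cvgrPdist_lt/(_ _ e3); apply: filterS => t' ht.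
  have k1 := HS t M M0; have k2 := HS t' M M0.
  have -> : S t - S t' = (S t - SN M t) + ((SN M t - SN M t') - (S t' - SN M t')) by ring.
  apply: le_lt_trans (ler_normD _ _) _; have := ler_normB (SN M t - SN M t') (S t' - SN M t').
  by move: k1 k2 hM ht; lra.
have perSN N t : SN N (t + pi *+ 2) = SN N t.
  rewrite /SN; congr (- _); apply: eq_bigr => n _; congr (_ * _ / _).
  by rewrite mulrDr mulr_natl (mulr_natl (pi *+ 2)) (periodicn (@cosD2pi R)).
have perS t : S (t + pi *+ 2) = S t.
  apply/eqP; rewrite -subr_eq0 -normr_le0; apply/ler_addgt0Pr => /= e e0; rewrite add0r.
  have e3 : 0 < e / 2 by rewrite divr_gt0.
  have [M M0 hM] := small _ e3.
  have k1 := HS t M M0; have := HS (t + pi *+ 2) M M0; rewrite perSN => k2.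
  have -> : S (t + pi *+ 2) - S t = (S (t + pi *+ 2) - SN M t) - (S t - SN M t) by ring.
  by apply: le_trans (ler_normB _ _) _; move: k1 k2 hM; lra.
have pi0 : 0 < pi :> R := pi_gt0 R.
have p20 : 0 <= pi *+ 2 :> R by rewrite mulrn_wge0// ltW.
have [t0 t0I hmax] := EVT_max p20 (continuous_subspaceT cS).
(* The points t0 + 2 h and t0 - 2 h may fall into a neighbouring period, where periodicity preserves
   the maximum. *)
have gmax x : - (pi *+ 2) <= x <= pi *+ 2 + pi *+ 2 -> S x <= S t0.
  move=> /andP[x1 x2]; have [x0|x0] := leP 0 x; last first.
    by rewrite -perS; apply: hmax; rewrite in_itv/=; apply/andP; split; move: x0 x1; lra.
  have [xp|xp] := leP x (pi *+ 2); first by apply: hmax; rewrite in_itv/= x0.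
  rewrite -(subrK (pi *+ 2) x) perS; apply: hmax; rewrite in_itv/=.
  by apply/andP; split; move: xp x2; lra.
have [h /andP[h0 h1] [N0 hN0]] := riemann_pos (Fp t0) (hF t0).
have pi1 : 1 < pi :> R.
  by have := pi_ge2 R; lra.
move: t0I; rewrite in_itv/= => /andP[t1 t2].
have m1 : S (t0 + 2 * h) <= S t0 by apply: gmax; rewrite mulr2n; apply/andP; split; move: t1 t2; rewrite mulr2n; lra.
have m2 : S (t0 - 2 * h) <= S t0 by apply: gmax; rewrite mulr2n; apply/andP; split; move: t1 t2; rewrite mulr2n; lra.
have dif N : SN N (t0 + 2 * h) + SN N (t0 - 2 * h) - 2 * SN N t0 =
   4 * h ^+ 2 * \sum_(1 <= k < N.+1) (a k * cos (k%:R * t0)) * sinc2 (k%:R * h).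
  elim: N => [|N IH]; first by rewrite /SN !big_geq// oppr0 !mulr0 oppr0 !addr0.
  rewrite (big_nat_recr N.+1)//= [RHS]mulrDr -IH !SNS.
  have nn : (N.+1%:R : R) != 0 by rewrite pnatr_eq0.
  have := cos_second_diff N.+1%:R t0 h; rewrite -(sinc2E (mulf_neq0 nn (lt0r_neq0 h0))) => sd.
  exact: second_diff_step nn sd.
have s0 : 0 < 4 * h ^+ 2 * (F t0 / 16) by rewrite !mulr_gt0 ?exprn_gt0 ?divr_gt0.
(* Replacing S by a partial sum in the second difference costs at most 4 A / N, its weights being 1,
   1 and 2; this must stay below the lower bound from [riemann_pos]. *)
have e4 : 0 < (4 * h ^+ 2 * (F t0 / 16)) / 4 by rewrite divr_gt0.
have [M M0 hM] := small _ e4.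
pose N := (maxn N0 M).
have NN : (0 < N)%N by rewrite (leq_trans M0)// leq_maxr.
have hN : A / N%:R < (4 * h ^+ 2 * (F t0 / 16)) / 4.
  apply: le_lt_trans hM; rewrite ler_wpM2l// lef_pV2 ?posrE ?ltr0n// ler_nat leq_maxr//.
have := hN0 N (leq_maxl _ _); rewrite -(ler_pM2l (_ : 0 < 4 * h ^+ 2)); last by rewrite mulr_gt0// exprn_gt0.
rewrite -dif => low.
have k1 := HS (t0 + 2 * h) N NN; have k2 := HS (t0 - 2 * h) N NN; have k3 := HS t0 N NN.
move: k1 k2 k3; rewrite !ler_norml => /andP[k1 _] /andP[k2 _] /andP[_ k3].
by move: low hN; lra.
Qed.

End RiemannSummation.

Local Open Scope complex_scope.

Lemma cvg_plane (R : realType) (T : Type) (F : set_system T) {FF : Filter F} (f g : T -> R) (a b : R) :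
  f @ F --> a -> g @ F --> b -> ((f x, g x) : R * R) @[x --> F] --> (a, b).
Proof.
move=> /cvgrPdist_lt ha /cvgrPdist_lt hb; apply/cvgrPdist_lt => e e0.
apply: filterS2 (ha e e0) (hb e e0) => x h1 h2.
by rewrite prod_normE/= gt_max h1.
Qed.

(** * The real-valued modulus of complex numbers *)

Section Modulus.
Context {R : realType}.
Implicit Types (z w : R[i]) (e r : R).

(* The norm of R[i] takes its values in R[i]; this is the modulus as an element of R. *)
Definition cmod z : R := Num.sqrt (complex.Re z ^+ 2 + complex.Im z ^+ 2).

Lemma cmodE z : `|z| = (cmod z)%:C. Proof. exact: normc_def. Qed.
Lemma cmod_eqP z w : `|z| = `|w| -> cmod z = cmod w.
Proof. by rewrite !cmodE => /(congr1 (@complex.Re R)). Qed.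
Lemma cmod_ge0 z : 0 <= cmod z. Proof. exact: sqrtr_ge0. Qed.
Lemma cmodM z w : cmod (z * w) = cmod z * cmod w.
Proof. by have := normrM z w; rewrite !cmodE -rmorphM => /(congr1 (@complex.Re R)). Qed.
Lemma cmodD z w : cmod (z + w) <= cmod z + cmod w.
Proof. by have := ler_normD z w; rewrite !cmodE -rmorphD lecR. Qed.
Lemma cmodN z : cmod (- z) = cmod z. Proof. by apply: cmod_eqP; rewrite normrN. Qed.
Lemma cmodB z w : cmod (z - w) = cmod (w - z). Proof. by rewrite -cmodN opprB. Qed.
Lemma cmodJ z : cmod (conjc z) = cmod z. Proof. by apply: cmod_eqP; rewrite normcJ. Qed.
Lemma conjcM z w : conjc (z * w) = conjc z * conjc w. Proof. exact: (rmorphM (@conjc R)). Qed.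
Lemma conjcD z w : conjc (z + w) = conjc z + conjc w. Proof. exact: (rmorphD (@conjc R)). Qed.
Lemma conjcB z w : conjc (z - w) = conjc z - conjc w. Proof. exact: (rmorphB (@conjc R)). Qed.
Lemma conjcV z : conjc z^-1 = (conjc z)^-1. Proof. exact: (fmorphV (@conjc R)). Qed.
Lemma conjcX z n : conjc (z ^+ n) = conjc z ^+ n. Proof. exact: (rmorphXn (@conjc R)). Qed.
Lemma cmod0 : cmod 0 = 0. Proof. by rewrite /cmod /= expr0n addr0 sqrtr0. Qed.
Lemma cmod1 : cmod 1 = 1. Proof. by rewrite /cmod /= expr0n addr0 expr1n sqrtr1. Qed.
Lemma cmod_eq0 z : (cmod z == 0) = (z == 0).
Proof. by rewrite -[RHS]normr_eq0 cmodE; apply/eqP/eqP => [->|/(congr1 (@complex.Re R))]. Qed.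
Lemma cmod_gt0 z : (0 < cmod z) = (z != 0). Proof. by rewrite lt0r cmod_ge0 cmod_eq0 andbT. Qed.
Lemma cmodV z : cmod z^-1 = (cmod z)^-1.
Proof. by have := normfV z; rewrite !cmodE -fmorphV => /(congr1 (@complex.Re R)). Qed.
Lemma cmod_real r : cmod r%:C = `|r|.
Proof. by rewrite /cmod /= expr0n addr0 sqrtr_sqr. Qed.
Lemma Re_cm z : `|complex.Re z| <= cmod z.
Proof. by rewrite -sqrtr_sqr ler_wsqrtr// lerDl sqr_ge0. Qed.
Lemma Im_cm z : `|complex.Im z| <= cmod z.
Proof. by rewrite -sqrtr_sqr ler_wsqrtr// lerDr sqr_ge0. Qed.
Lemma cmod_ReIm z : cmod z <= `|complex.Re z| + `|complex.Im z|.
Proof.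
rewrite -[leRHS]ger0_norm ?addr_ge0// -sqrtr_sqr ler_wsqrtr//.
rewrite sqrrD !real_normK ?num_real//.
by rewrite -addrA lerD2l lerDr mulrn_wge0// mulr_ge0.
Qed.
Lemma cmodX z n : cmod (z ^+ n) = cmod z ^+ n.
Proof. by elim: n => [|n IH]; [rewrite !expr0 cmod1|rewrite !exprS cmodM IH]. Qed.
Lemma cmod_lower z w : cmod z - cmod w <= cmod (z + w).
Proof. by have := cmodD (z + w) (- w); rewrite addrK cmodN lerBlDr. Qed.
Lemma cmod_expi t : cmod (expi t) = 1.
Proof. by rewrite /cmod /= cos2Dsin2 sqrtr1. Qed.

Lemma cvg_cmP (T : Type) (F : set_system T) {FF : Filter F} (f : T -> R[i]) (l : R[i]) :
  f @ F --> l <-> forall e, 0 < e -> \forall x \near F, cmod (l - f x) < e.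
Proof.
split=> [/cvgrPdist_lt h e e0|h].
  have e0' : 0 < e%:C :> R[i] by rewrite -[0]/(0%:C) ltcR.
  by apply: filterS (h _ e0') => x; rewrite cmodE ltcR.
apply/cvgrPdist_lt => e e0; have e1 : e = (complex.Re e)%:C.
  by move: e0; rewrite ltcE /= => /andP[/eqP + _]; case: e => a b /= ->.
have : 0 < complex.Re e by move: e0; rewrite {1}e1 -[0]/(0%:C) ltcR.
by move=> /h; apply: filterS => x hx; rewrite e1 cmodE ltcR.
Qed.

Lemma infty_cmP (P : set R[i]) : infty_nbhs R[i] P <-> exists2 M : R, 0 < M & forall z, M < cmod z -> P z.
Proof.
split=> [[M /= M0 h]|[M M0 h]].
  have e1 : M = (complex.Re M)%:C.
    by move: M0; rewrite ltcE /= => /andP[/eqP + _]; case: (M) => a b /= ->.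
  exists (complex.Re M); first by move: M0; rewrite {1}e1 -[0]/(0%:C) ltcR.
  by move=> z hz; apply: h => /=; rewrite e1 cmodE ltcR.
exists M%:C; first by rewrite /= -[0]/(0%:C) ltcR.
by move=> z /=; rewrite cmodE ltcR; exact: h.
Qed.

Lemma exterior_cm z : exterior_disk z <-> 1 < cmod z.
Proof. by rewrite /exterior_disk /= cmodE -[1]/(1%:C) ltcR. Qed.
Lemma circle_cm z : circle z <-> cmod z = 1.
Proof.
by rewrite /circle /= cmodE -[1]/(1%:C); split=> [/(congr1 (@complex.Re R))//|->].
Qed.

Lemma circle_expi t : circle (expi t : R[i]).
Proof. by apply/circle_cm; exact: cmod_expi. Qed.

Lemma near_cm z e : 0 < e -> \forall w \near nbhs z, cmod (z - w) < e.
Proof.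
move=> e0; have h : id @ nbhs z --> z by exact: cvg_id.
have FF : Filter (nbhs z) by exact: nbhs_filter.
exact: (@cvg_cmP _ (nbhs z) FF id z).1 h e e0.
Qed.

Lemma continuous_plane_of_C : continuous (@plane_of_C R).
Proof.
move=> z; have FF : Filter (nbhs z) by exact: nbhs_filter.
apply/(cvgrPdist_lt (F := nbhs z)) => e e0.
apply: filterS (near_cm z e0) => w h; rewrite prod_normE/= gt_max.
apply/andP; split; apply: le_lt_trans h.
  by apply: le_trans (Re_cm _); rewrite raddfB.
by apply: le_trans (Im_cm _); rewrite raddfB.
Qed.

Lemma cvg_ReIm (T : Type) (F : set_system T) {FF : Filter F} (f : T -> R[i]) (l : R[i]) :
  f @ F --> l -> complex.Re (f x) @[x --> F] --> complex.Re l /\ complex.Im (f x) @[x --> F] --> complex.Im l.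
Proof.
move=> /cvg_cmP h; split; apply/cvgrPdist_lt => e e0; apply: filterS (h e e0) => x; apply: le_lt_trans.
  by apply: le_trans (Re_cm _); rewrite raddfB.
by apply: le_trans (Im_cm _); rewrite raddfB.
Qed.

End Modulus.

(** C meets V in a relatively open set, which is also relatively closed: by the last hypothesis it
    is the trace of the closure of V on C. *)
Lemma connected_in_open (T : topologicalType) (C V : set T) : connected C -> open V ->
  C `&` V !=set0 -> (forall p, C p -> closure V p -> V p) -> C `<=` V.
Proof.
move=> cC oV ne h; have <- : C `&` V = C; last by move=> p [].
apply: cC => //; first by exists V.
exists (closure V); first exact: closed_closure.
apply/seteqP; split=> p [Cp Vp]; split=> //; first exact: subset_closure.
exact: h.
Qed.

(** * Reflection symmetry of the shape *)

Section Symmetry.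
Context {R : realType}.
Variables (eps : R) (D : set (R * R)) (Phi f : R[i] -> R[i]) (a : nat -> R).
Let phi w := w + eps%:C * f w.
Hypotheses (oD : open D) (cD : connected D) (bD : bounded_set D) (neD : D !=set0).
Hypotheses (hPhi : exterior_conformal_map D Phi) (hf : negative_power_series a f).
Hypothesis hbd : [set plane_of_C (phi w) | w in circle] = boundary D.

Definition refl (p : R * R) : R * R := (p.1, - p.2).
Lemma reflK : involutive refl. Proof. by move=> [x y]; rewrite /refl /= opprK. Qed.
Lemma refl_cont : continuous refl.
Proof.
move=> p; apply: cvg_plane => /=; first exact: cvg_fst.
by apply: cvgN; exact: cvg_snd.
Qed.

(** The coefficients are real, so conjugation commutes with every partial sum. *)
Lemma trace_conj w : circle w -> f (conjc w) = conjc (f w).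
Proof.
move=> cw; have cw' : circle (conjc w) by apply/circle_cm; rewrite cmodJ; exact/circle_cm.
have h1 := hf cw'; have h2 := hf cw.
apply: (cvg_unique _ h1); first exact: norm_hausdorff.
apply/cvg_cmP => e e0; apply: filterS ((cvg_cmP _ _).1 h2 e e0) => n.
rewrite (_ : \sum_(1 <= k < n) (a k)%:C * (conjc w) ^- k = conjc (\sum_(1 <= k < n) (a k)%:C * w ^- k)).
  by rewrite -conjcB cmodJ.
rewrite rmorph_sum; apply: eq_bigr => k _.
by rewrite -[RHS]/(conjc ((a k)%:C * w ^- k)) conjcM conjcV conjcX conjc_real.
Qed.

Lemma boundary_refl p : boundary D p -> boundary D (refl p).
Proof.
rewrite -hbd => -[w cw <-]; exists (conjc w).
  by apply/circle_cm; rewrite cmodJ; exact/circle_cm.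
rewrite /phi trace_conj//.
have -> : (conjc w) + eps%:C * conjc (f w) = conjc (w + eps%:C * f w).
  by rewrite conjcD conjcM conjc_real.
by case: (w + _).
Qed.

Let Ds := refl @^-1` D.
Let oDs : open Ds. Proof. by apply: open_comp => // p _; exact: refl_cont. Qed.
Let cDs p : closure Ds p -> closure D (refl p).
Proof.
move=> h V nV; have : nbhs p (refl @^-1` V) by exact: refl_cont.
by move=> /h[q [q1 q2]]; exists (refl q).
Qed.

Let bdDs p : closure Ds p -> ~ Ds p -> boundary D p.
Proof.
move=> h1 h2; rewrite -[p]reflK; apply: boundary_refl; split; first exact: cDs.
by rewrite ((interior_id D).1 oD).
Qed.

(** Clamping the parameter at 1 keeps the ray in the exterior disk, so that it is a continuous image
    of the whole line. *)
Lemma ray_cont w : exterior_disk w -> continuous (fun s : R => plane_of_C (Phi ((Num.max 1 s)%:C * w))).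
Proof.
move=> /exterior_cm ew s; apply: (cvg_comp _ (@plane_of_C R)); last exact: continuous_plane_of_C.
have [_ dPhi _ _] := hPhi.
have ews : exterior_disk ((Num.max 1 s)%:C * w).
  apply/exterior_cm; rewrite cmodM cmod_real ger0_norm; last by rewrite le_max ler01.
  by apply: lt_le_trans ew _; rewrite ler_peMl ?cmod_ge0// le_max lexx.
apply: (cvg_comp _ Phi); last by apply: differentiable_continuous; apply/derivable1_diffP; exact: dPhi.
apply/cvg_cmP => e e0.
have w0 : 0 < cmod w by exact: lt_trans ew.
have : Num.max 1 x @[x --> s] --> Num.max 1 s.
  by apply: continuous_max; [exact: cvg_cst|exact: cvg_id].
move=> /cvgrPdist_lt/(_ (e / cmod w)); rewrite divr_gt0// => /(_ isT); apply: filterS => x.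
by rewrite -mulrBl -rmorphB cmodM cmod_real ltr_pdivlMr.
Qed.

(* Otherwise D contains no point of the closure of its reflection, and a point of the
   reflection is joined to infinity through a ray of the exterior domain. *)
Lemma meets_refl : D `&` Ds !=set0.
Proof.
apply: contrapT => ne.
have dis p : Ds p -> ~ closure D p.
  move=> Dsp h; have : nbhs p Ds by exact: open_nbhs_nbhs.
  by move=> /h[q [q1 q2]]; apply: ne; exists q.
have [p0 Dp0] := neD.
have [bij dPhi inf _] := hPhi.
have Dsp : Ds (refl p0) by rewrite /Ds /= reflK.
have [w ew Pw] : exists2 w, exterior_disk w & plane_of_C (Phi w) = refl p0.
  case: bij => [_ _ sur].
  have : [set z | ~ closure D (plane_of_C z)] ((refl p0).1 +i* (refl p0).2) by exact: dis.
  by move=> /sur[w ew Pw]; exists w => //; rewrite Pw.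
have ew' := (exterior_cm _).1 ew.
pose g (s : R) := plane_of_C (Phi ((Num.max 1 s)%:C * w)).
have ews s : exterior_disk ((Num.max 1 s)%:C * w).
  apply/exterior_cm; rewrite cmodM cmod_real ger0_norm; last by rewrite le_max ler01.
  by apply: lt_le_trans ew' _; rewrite ler_peMl ?cmod_ge0// le_max lexx.
have gout s : ~ closure D (g s) by case: bij => [fu _ _]; exact: fu.
have cI : connected [set g s | s in [set: R]].
  apply: connected_continuous_connected.
    by apply/connected_intervalP => x y _ _ z _.
  by apply: continuous_subspaceT; exact: ray_cont.
(* The ray starts in the reflected shape and avoids the closure of D, whose boundary contains that
   of the reflected shape. Being connected it stays in this bounded set, although [Phi] tends to
   infinity along it. *)
have sub : [set g s | s in [set: R]] `<=` Ds.
  apply: (connected_in_open cI oDs).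
    exists (refl p0); split => //; exists 1 => //.
    by rewrite /g (_ : Num.max 1 1 = 1) ?mul1r// maxxx.
  move=> p [s _ <-] cg; apply: contrapT => nDs.
  have [+ _] := bdDs cg nDs; exact: gout.
have [N N0 hN] := bounded_setP bD.
have /inf : infty_nbhs R[i] [set z | 2 * N < cmod z].
  apply/infty_cmP; exists (2 * N + 1); first by rewrite ltr_wpDl// mulr_ge0.
  by move=> z /= h; apply: le_lt_trans h; rewrite lerDl.
move=> /infty_cmP[M M0 hM].
have w0 : 0 < cmod w by exact: lt_trans ew'.
have /hM/= : M < cmod ((Num.max 1 (M + 1))%:C * w).
  rewrite cmodM cmod_real ger0_norm; last by rewrite le_max ler01.
  apply: (@lt_le_trans _ _ (Num.max 1 (M + 1))).
    by rewrite lt_max ltrDl ltr01 orbT.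
  by rewrite ler_peMr ?(ltW ew')// le_max ler01.
have /sub/hN : [set g s | s in [set: R]] (g (M + 1)) by exists (M + 1).
rewrite /g /refl /plane_of_C /=; move: (Phi _) => z.
rewrite prod_normE/= normrN ge_max => /andP[h1 h2].
by apply/negP; rewrite -leNgt; apply: le_trans (cmod_ReIm _) _; rewrite mulr_natl mulr2n lerD.
Qed.

(** D meets its reflection and cannot cross the boundary of the reflection, which lies in the
    boundary of D and so outside the open set D. *)
Lemma shape_refl p : D p -> D (refl p).
Proof.
have sub : D `<=` Ds.
  apply: (connected_in_open cD oDs); first exact: meets_refl.
  move=> q Dq cq; apply: contrapT => nDs.
  have [_ +] := bdDs cq nDs; apply; by rewrite ((interior_id D).1 oD).
exact: sub.
Qed.
End Symmetry.

(** * From the shape to the patch *)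

Section Patch.
Context {R : realType}.
Implicit Types (l eps : R) (D : set (R * R)).

Lemma vortex_patchE l eps D : 0 < eps ->
  vortex_patch l eps D = [set x | D ((x.1 - l) / eps, x.2 / eps)].
Proof.
move=> e0; have en := lt0r_neq0 e0; apply/seteqP; split=> [_ [p Dp <-]|[x y] /= Dx].
  by rewrite /= addrC addKr !(mulrC eps) !mulfK//; case: p Dp.
by exists ((x - l) / eps, y / eps) => //=; congr (_, _); rewrite mulrC divfK//; ring.
Qed.

Lemma patch_shape l eps D : 0 < eps -> admissible_pair l eps D ->
  let D1 := vortex_patch l eps D in
  [/\ open D1, bounded_set D1, connected D1 & D1 !=set0] /\
  [/\ open D, bounded_set D, connected D & D !=set0].
Proof.
move=> e0 [bD1 [ne1 oD1 cD1 _] _ _] D1; split; first by split.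
have en := lt0r_neq0 e0.
pose g (p : R * R) : R * R := (l + eps * p.1, eps * p.2).
pose h (x : R * R) : R * R := ((x.1 - l) / eps, x.2 / eps).
have hg p : h (g p) = p by rewrite /h /g /= addrC addKr !(mulrC eps) !mulfK//; case: p.
have gc : continuous g.
  move=> p; apply: cvg_plane => /=.
    by apply: cvgD; [exact: cvg_cst|apply: cvgM; [exact: cvg_cst|exact: cvg_fst]].
  by apply: cvgM; [exact: cvg_cst|exact: cvg_snd].
have hc : continuous h.
  move=> p; apply: cvg_plane => /=; apply: cvgM; try exact: cvg_cst; last exact: cvg_snd.
  by apply: cvgB; [exact: cvg_fst|exact: cvg_cst].
have Dg : D = g @^-1` D1.
  by rewrite /D1 vortex_patchE//; apply/seteqP; split=> p; rewrite /= -/(h (g p)) hg.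
have Dh : D = [set h x | x in D1].
  apply/seteqP; split=> [p Dp|_ [x D1x <-]].
    by exists (g p) => //; rewrite Dg in Dp.
  by move: D1x; rewrite /D1 vortex_patchE.
split.
- by rewrite Dg; apply: open_comp => // p _; exact: gc.
- have [N N0 hN] := bounded_setP bD1.
  exists ((N + `|l|) / eps); split; first exact: num_real.
  move=> M NM p /= Dp; apply: ltW; apply: le_lt_trans NM.
  have /hN : D1 (g p) by rewrite Dg in Dp.
  rewrite /g !prod_normE/= !ge_max => /andP[h1 h2].
  apply/andP; split; rewrite ler_pdivlMr// -[X in _ * X](gtr0_norm e0) -normrM mulrC.
    have := ler_normB (l + eps * p.1) l; rewrite addrC addKr => /le_trans; apply.
    by rewrite lerD2r.
  by apply: le_trans h2 _; rewrite lerDl.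
- by rewrite Dh; apply: connected_continuous_connected => //; exact: continuous_subspaceT.
- have [x D1x] := ne1; exists (h x); by move: D1x; rewrite vortex_patchE.
Qed.

(** If D1 contained a point (0, y), it would contain (0, -y) by symmetry, and -D1 would contain (0,
    y), against disjointness. Being connected, D1 lies on one side of the axis, and [sg] is 1 or -1
    accordingly. *)
Lemma patch_half_plane l eps D : 0 < eps -> admissible_pair l eps D ->
  exists2 sg : R, sg ^+ 2 = 1 & forall x, vortex_patch l eps D x -> 0 < sg * x.1.
Proof.
move=> e0 adm; have [[oD1 bD1 cD1 [x0 Dx0]] [oD bD cD neD]] := patch_shape e0 adm.
have [_ _ dis [Phi [f [a [k [al [hPhi _ hf _ hbd]]]]]]] := adm.
have en := lt0r_neq0 e0.
have sym := shape_refl oD cD bD neD hPhi hf hbd.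
have noaxis x : vortex_patch l eps D x -> x.1 != 0.
  move=> Dx; apply/negP => /eqP x10.
  suff : (vortex_patch l eps D `&` opp_set (vortex_patch l eps D)) x by rewrite dis.
  split=> //; exists (x.1, - x.2); last by rewrite [x]surjective_pairing x10; congr (_, _); rewrite /= ?oppr0 ?opprK.
  by move: Dx; rewrite vortex_patchE//= => /sym; rewrite /refl /= mulNr.
have oV (s : R) : open [set x : R * R | 0 < s * x.1].
  have := @open_comp _ _ (fun x : R * R => s * x.1) [set t | 0 < t].
  apply; last exact: open_gt.
  by move=> q _; apply: cvgM; [exact: cvg_cst|exact: cvg_fst].
have half (s : R) : s != 0 -> 0 < s * x0.1 -> vortex_patch l eps D `<=` [set x | 0 < s * x.1].
  move=> s0 sx; apply: connected_in_open => //; first by exists x0.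
  move=> p Dp cl /=.
  have : [set x : R * R | 0 <= s * x.1] p.
    have cc : closed [set x : R * R | 0 <= s * x.1].
      have := @closed_comp _ _ (fun x : R * R => s * x.1) [set t | 0 <= t].
      apply; last exact: closed_ge.
      by move=> q _; apply: cvgM; [exact: cvg_cst|exact: cvg_fst].
    rewrite ((closure_id [set x : R * R | 0 <= s * x.1]).1 cc); apply: closureS cl => z /=; exact: ltW.
  by rewrite /= le_eqVlt eq_sym mulf_eq0 (negbTE s0) (negbTE (noaxis p Dp)).
have := noaxis _ Dx0; rewrite neq_lt => /orP[h|h].
  by exists (-1); [rewrite sqrrN expr1n|apply: half; rewrite ?oppr_eq0 ?oner_eq0// mulN1r oppr_gt0].
by exists 1; [rewrite expr1n|apply: half; rewrite ?oner_eq0// mul1r].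
Qed.

End Patch.

(** * Contour integrals over rectangles and Goursat's theorem *)

Section Contour.
Context {R : realType}.
Implicit Types (f g : R -> R[i]) (q r : R[i] -> R[i]) (z w k : R[i]) (a b c d x y t M : R).
Local Notation mu := (@lebesgue_measure R).

Definition cintegral f a b : R[i] :=
  (\int[mu]_(x in `[a, b]) complex.Re (f x)) +i* (\int[mu]_(x in `[a, b]) complex.Im (f x)).

Definition ccont f a b := forall x, a <= x <= b ->
  {for x, continuous (fun x => complex.Re (f x))} /\ {for x, continuous (fun x => complex.Im (f x))}.

Lemma itv_int (f : R -> R) a b : (forall x, a <= x <= b -> {for x, continuous f}) ->
  mu.-integrable `[a, b] (EFin \o f).
Proof.
move=> cf; apply: continuous_compact_integrable; first exact: segment_compact.
apply: continuous_in_subspaceT => x; rewrite inE /= in_itv/=; exact: cf.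
Qed.

Lemma itv_cat (f : R -> R) a b c : a <= b -> b <= c -> (forall x, a <= x <= c -> {for x, continuous f}) ->
  \int[mu]_(x in `[a, c]) f x = \int[mu]_(x in `[a, b]) f x + \int[mu]_(x in `[b, c]) f x.
Proof.
move=> ab bc cf; have iac := itv_int cf.
have := Rintegral_itvB (a := BLeft a) (b := BRight c) (x := b) iac.
rewrite !bnd_simp => /(_ ab bc) h.
apply/eqP; rewrite addrC -subr_eq h; apply/eqP; rewrite Rintegral_itv_obnd_cbnd//.
apply: integrableS iac => //; apply: subset_itv; rewrite bnd_simp//.
Qed.

Lemma eqC_ReIm z w : complex.Re z = complex.Re w -> complex.Im z = complex.Im w -> z = w.
Proof. by case: z w => [a b] [c d] /= -> ->. Qed.

Lemma cintegral_cat f a b c : a <= b -> b <= c -> ccont f a c -> cintegral f a c = cintegral f a b + cintegral f b c.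
Proof.
by move=> ab bc h; apply: eqC_ReIm => /=; apply: itv_cat => // x xac; have [] := h x xac.
Qed.

Lemma cintegral_D f g a b : ccont f a b -> ccont g a b -> cintegral (fun x => f x + g x) a b = cintegral f a b + cintegral g a b.
Proof.
move=> hf hg; apply: eqC_ReIm => /=.
  rewrite -RintegralD//; first by apply: eq_Rintegral => x _; rewrite raddfD.
    by apply: itv_int => x /hf[].
  by apply: itv_int => x /hg[].
rewrite -RintegralD//; first by apply: eq_Rintegral => x _; rewrite raddfD.
  by apply: itv_int => x /hf[].
by apply: itv_int => x /hg[].
Qed.

Lemma ReM z w : complex.Re (z * w) = complex.Re z * complex.Re w - complex.Im z * complex.Im w.
Proof. by case: z w => [a b] [c d]. Qed.
Lemma ImM z w : complex.Im (z * w) = complex.Re z * complex.Im w + complex.Im z * complex.Re w.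
Proof. by case: z w => [a b] [c d]. Qed.

Lemma ReB z w : complex.Re (z - w) = complex.Re z - complex.Re w.
Proof. by case: z w => [a b] [c d]. Qed.
Lemma ImB z w : complex.Im (z - w) = complex.Im z - complex.Im w.
Proof. by case: z w => [a b] [c d]. Qed.
Lemma ImD z w : complex.Im (z + w) = complex.Im z + complex.Im w.
Proof. by case: z w => [a b] [c d]. Qed.

Lemma cintegral_Z k f a b : ccont f a b -> cintegral (fun x => k * f x) a b = k * cintegral f a b.
Proof.
move=> hf.
have i1 : mu.-integrable `[a, b] (EFin \o (fun x => complex.Re (f x))) by apply: itv_int => x /hf[].
have i2 : mu.-integrable `[a, b] (EFin \o (fun x => complex.Im (f x))) by apply: itv_int => x /hf[].
have iz (l : R) (h : R -> R) : mu.-integrable `[a, b] (EFin \o h) -> mu.-integrable `[a, b] (EFin \o (fun x => l * h x)).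
  move=> ih; have mI : measurable (`[a, b] : set (measurableTypeR R)) by exact: measurable_itv.
  have := integrableZl mI l ih; apply: eq_integrable => //.
apply: eqC_ReIm; rewrite ?ReM ?ImM /=.
  rewrite -!RintegralZl// -RintegralB//; [|exact: iz|exact: iz].
  by apply: eq_Rintegral => x _; rewrite ReM.
rewrite -!RintegralZl// -RintegralD//; [|exact: iz|exact: iz].
by apply: eq_Rintegral => x _; rewrite ImM.
Qed.

Lemma cintegral_ext f g a b : (forall x, a <= x <= b -> f x = g x) -> cintegral f a b = cintegral g a b.
Proof.
by move=> fg; apply: eqC_ReIm => /=; apply: eq_Rintegral => x; rewrite inE/= in_itv/= => /fg ->.
Qed.

Lemma cintegral_B f g a b : ccont f a b -> ccont g a b -> cintegral (fun x => f x - g x) a b = cintegral f a b - cintegral g a b.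
Proof.
move=> hf hg; have hg' : ccont (fun x => (-1) * g x) a b.
  move=> x /hg[h1 h2]; split.
    rewrite (_ : (fun x => _) = (fun x => - complex.Re (g x))); first exact: cvgN.
    by apply/funext => y; rewrite mulN1r raddfN.
  rewrite (_ : (fun x => _) = (fun x => - complex.Im (g x))); first exact: cvgN.
  by apply/funext => y; rewrite mulN1r raddfN.
rewrite -mulN1r -cintegral_Z// -cintegral_D//; apply: cintegral_ext => x _; by rewrite mulN1r.
Qed.

Lemma cintegral_cst k a b : a <= b -> cintegral (fun=> k) a b = (b - a)%:C * k.
Proof.
move=> ab; have m1 : fine (mu `[a, b]%classic) = b - a by rewrite lebesgue_itvcc.
apply: eqC_ReIm; rewrite ?ReM ?ImM /= ?mul0r ?subr0 ?addr0 Rintegral_cst// mulrC; congr (_ * _); exact: m1.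
Qed.

Lemma itv_bound (f : R -> R) a b M : a <= b -> (forall x, a <= x <= b -> {for x, continuous f}) ->
  (forall x, a <= x <= b -> `|f x| <= M) -> `|\int[mu]_(x in `[a, b]) f x| <= M * (b - a).
Proof.
move=> ab cf fM; have i1 := itv_int cf.
apply: le_trans (le_normr_Rintegral _ i1) _ => //.
have i2 : mu.-integrable `[a, b] (EFin \o (fun=> M)) by apply: itv_int => x _; exact: cvg_cst.
have i3 : mu.-integrable `[a, b] (EFin \o (fun x => `|f x|)).
  by apply: itv_int => x /cf h; apply: (cvg_comp _ (fun x => `|x|) h); exact: norm_continuous.
have := le_Rintegral (mu := mu) (D := `[a, b]%classic) _ i3 i2.
rewrite Rintegral_cst// (_ : fine (mu `[a, b]%classic) = b - a); last by rewrite lebesgue_itvcc.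
by apply => // x; rewrite /= in_itv/=; exact: fM.
Qed.

Lemma cintegral_bound f a b M : a <= b -> ccont f a b -> (forall x, a <= x <= b -> cmod (f x) <= M) ->
  cmod (cintegral f a b) <= 2 * (M * (b - a)).
Proof.
move=> ab hf fM; apply: le_trans (cmod_ReIm _) _ => /=; rewrite mulr_natl mulr2n.
apply: lerD; apply: itv_bound => // x xab; try by have [] := hf x xab.
  by apply: le_trans (fM x xab); exact: Re_cm.
by apply: le_trans (fM x xab); exact: Im_cm.
Qed.

Lemma ctD q r w : {for w, continuous q} -> {for w, continuous r} -> {for w, continuous (fun z => q z + r z)}.
Proof. by move=> hf hg; exact: (@cvgD _ _ _ (nbhs w) (nbhs_filter w) q r _ _ hf hg). Qed.
Lemma ctM q r w : {for w, continuous q} -> {for w, continuous r} -> {for w, continuous (fun z => q z * r z)}.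
Proof. by move=> hf hg; exact: (@cvgM _ _ (nbhs w) (nbhs_filter w) q r _ _ hf hg). Qed.
Lemma ctV q w : q w != 0 -> {for w, continuous q} -> {for w, continuous (fun z => (q z)^-1)}.
Proof. by move=> h hf; exact: (@cvgV _ _ (nbhs w) (nbhs_filter w) q _ h hf). Qed.
Lemma ctid w : {for w, continuous (fun z => z)}.
Proof. exact: cvg_id. Qed.
Lemma ctcst w k : {for w, continuous (fun _ : R[i] => k)}.
Proof. exact: (@cvg_cst _ k _ (nbhs w) (nbhs_filter w)). Qed.

Lemma nbhs_cmP w (P : set R[i]) : nbhs w P <-> exists2 e, 0 < e & forall w', cmod (w - w') < e -> P w'.
Proof.
split=> [|[e e0 h]]; last by apply: filterS (near_cm w e0) => w'; exact: h.
move=> /nbhs_ballP[e /= e0 h]; have e1 : e = (complex.Re e)%:C.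
  by move: e0; rewrite ltcE /= => /andP[/eqP + _]; case: e {h} => a b /= ->.
exists (complex.Re e); first by move: e0; rewrite {1}e1 -[0]/(0%:C) ltcR.
by move=> w' hw; apply: h; rewrite /ball/= e1 cmodE ltcR.
Qed.

(* Complex differentiability in Caratheodory's form. *)
Definition cdiff q w := exists h : R[i] -> R[i], {for w, continuous h} /\
  \forall w' \near nbhs w, q w' - q w = h w' * (w' - w).

Lemma cdiff_cont q w : cdiff q w -> {for w, continuous q}.
Proof.
move=> [h [ch hq]].
have : {for w, continuous (fun w' => h w' * (w' + (- w)) + q w)}.
  exact: (ctD (ctM ch (ctD (@ctid w) (@ctcst w (- w)))) (@ctcst w (q w))).
rewrite {1}/prop_for /continuous_at subrr mulr0 add0r => lim.
have FF : Filter (nbhs w) by exact: nbhs_filter.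
apply: cvg_trans lim; apply: (@near_eq_cvg _ _ (nbhs w) FF).
by apply: filterS hq => w' <-; rewrite subrK.
Qed.

Lemma cdiffD q r w : cdiff q w -> cdiff r w -> cdiff (fun z => q z + r z) w.
Proof.
move=> [h [ch hq]] [k [ck hr]]; exists (fun z => h z + k z); split; first exact: ctD.
by apply: filterS2 hq hr => z h1 h2; rewrite mulrDl -h1 -h2; ring.
Qed.

Lemma cdiffM q r w : cdiff q w -> cdiff r w -> cdiff (fun z => q z * r z) w.
Proof.
move=> cq cr; have [h [ch hq]] := cq; have [k [ck hr]] := cr.
exists (fun z => h z * r z + q w * k z); split.
  exact: (ctD (ctM ch (cdiff_cont cr)) (ctM (@ctcst w (q w)) ck)).
by apply: filterS2 hq hr => z h1 h2; rewrite mulrDl mulrAC -h1 -mulrA -h2; ring.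
Qed.

Lemma cdiff_cst k w : cdiff (fun=> k) w.
Proof.
exists (fun=> 0); split; first exact: ctcst.
by apply: nearW => z; rewrite subrr mul0r.
Qed.

Lemma cdiff_id w : cdiff id w.
Proof.
exists (fun=> 1); split; first exact: ctcst.
by apply: nearW => z; rewrite mul1r.
Qed.

Lemma near_neq0 q w : {for w, continuous q} -> q w != 0 -> \forall z \near nbhs w, q z != 0.
Proof.
move=> cq q0.
have FF : Filter (nbhs w) by exact: nbhs_filter.
have := (@cvg_cmP _ _ (nbhs w) FF q (q w)).1 cq (cmod (q w)).
rewrite cmod_gt0 => /(_ q0); apply: filterS => z h; apply/negP => /eqP qz.
by move: h; rewrite qz subr0 ltxx.
Qed.

Lemma cdiffV q w : q w != 0 -> cdiff q w -> cdiff (fun z => (q z)^-1) w.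
Proof.
move=> q0 cq; have [h [ch hq]] := cq; have cq' := cdiff_cont cq.
exists (fun z => (-1 * h z) * ((q z)^-1 * (q w)^-1)); split.
  exact: (ctM (ctM (@ctcst w (-1)) ch) (ctM (ctV q0 cq') (@ctcst w (q w)^-1))).
apply: filterS2 hq (near_neq0 cq' q0) => z h1 qz.
rewrite mulrAC mulN1r mulNr -h1.
by field; rewrite q0 qz.
Qed.

Lemma line1_cont y x : {for x, continuous (fun x : R => x +i* y)}.
Proof.
apply/cvg_cmP => e e0.
have : id @ nbhs x --> x by exact: cvg_id.
move=> /cvgrPdist_lt/(_ e e0); apply: filterS => x' /= h.
apply: le_lt_trans h; apply: le_trans (cmod_ReIm _) _.
by rewrite /= subrr normr0 addr0.
Qed.
Lemma line2_cont x y : {for y, continuous (fun y : R => x +i* y)}.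
Proof.
apply/cvg_cmP => e e0.
have : id @ nbhs y --> y by exact: cvg_id.
move=> /cvgrPdist_lt/(_ e e0); apply: filterS => x' /= h.
apply: le_lt_trans h; apply: le_trans (cmod_ReIm _) _.
by rewrite /= subrr normr0 add0r.
Qed.

Lemma ccont1 q a b y : (forall x, a <= x <= b -> {for x +i* y, continuous q}) -> ccont (fun x => q (x +i* y)) a b.
Proof.
move=> h x /h cq.
have : (fun x => q (x +i* y)) x' @[x' --> x] --> q (x +i* y).
  by apply: (cvg_comp _ q (line1_cont (y := y) (x := x))); exact: cq.
by move=> /cvg_ReIm[].
Qed.
Lemma ccont2 q a b x : (forall y, a <= y <= b -> {for x +i* y, continuous q}) -> ccont (fun y => q (x +i* y)) a b.
Proof.
move=> h y /h cq.
have : (fun y => q (x +i* y)) y' @[y' --> y] --> q (x +i* y).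
  by apply: (cvg_comp _ q (line2_cont (x := x) (y := y))); exact: cq.
by move=> /cvg_ReIm[].
Qed.

(** The contour is traversed counterclockwise; the factor ['i] is the complex differential along the
    vertical sides. *)
Definition rect_integral q a b c d := cintegral (fun x => q (x +i* c)) a b - cintegral (fun x => q (x +i* d)) a b
  + 'i * (cintegral (fun y => q (b +i* y)) c d - cintegral (fun y => q (a +i* y)) c d).

Definition rcont q a b c d := forall x y, a <= x <= b -> c <= y <= d -> {for x +i* y, continuous q}.

Lemma rcont1 q a b c d y : rcont q a b c d -> c <= y <= d -> ccont (fun x => q (x +i* y)) a b.
Proof. by move=> h yc; apply: ccont1 => x xa; exact: h. Qed.
Lemma rcont2 q a b c d x : rcont q a b c d -> a <= x <= b -> ccont (fun y => q (x +i* y)) c d.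
Proof. by move=> h yc; apply: ccont2 => y ya; exact: h. Qed.

Lemma rect_integral_split q a m b c n d : a <= m <= b -> c <= n <= d -> rcont q a b c d ->
  rect_integral q a b c d = (rect_integral q a m c n + rect_integral q m b c n) + (rect_integral q a m n d + rect_integral q m b n d).
Proof.
move=> /andP[am mb] /andP[cn nd] rc.
have ab := le_trans am mb; have cd' := le_trans cn nd.
have h1 y : c <= y <= d -> cintegral (fun x => q (x +i* y)) a b = cintegral (fun x => q (x +i* y)) a m + cintegral (fun x => q (x +i* y)) m b.
  by move=> hy; apply: cintegral_cat => //; exact: (rcont1 rc).
have h2 x : a <= x <= b -> cintegral (fun y => q (x +i* y)) c d = cintegral (fun y => q (x +i* y)) c n + cintegral (fun y => q (x +i* y)) n d.
  by move=> hy; apply: cintegral_cat => //; exact: (rcont2 rc).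
rewrite /rect_integral !h1 ?h2 ?lexx ?ab ?cd'//; ring.
Qed.

Lemma rect_integral_affine k l a b c d : a <= b -> c <= d -> rect_integral (fun w => k + l * w) a b c d = 0.
Proof.
move=> ab cd'.
have ct w : {for w, continuous (fun w => k + l * w)}.
  exact: (ctD (@ctcst w k) (ctM (@ctcst w l) (@ctid w))).
have c1 y x x' : ccont (fun x => k + l * (x +i* y)) x x'.
  exact: (@ccont1 (fun w => k + l * w) x x' y (fun _ _ => @ct _)).
have c2 x y y' : ccont (fun y => k + l * (x +i* y)) y y'.
  exact: (@ccont2 (fun w => k + l * w) y y' x (fun _ _ => @ct _)).
rewrite /rect_integral -!cintegral_B; [|exact: c2|exact: c2|exact: c1|exact: c1].
rewrite (cintegral_ext (g := fun=> l * (0 +i* (c - d)))); last first.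
  move=> x _; rewrite opprD addrACA subrr add0r -mulrBr; congr (_ * _).
  by apply: eqC_ReIm; rewrite /= ?subrr.
rewrite (cintegral_ext (a := c) (g := fun=> l * (b - a)%:C)); last first.
  move=> x _; rewrite opprD addrACA subrr add0r -mulrBr; congr (_ * _).
  by apply: eqC_ReIm; rewrite /= ?subrr.
rewrite !cintegral_cst//; clear; case: l => l1 l2.
by apply: eqC_ReIm => /=; ring.
Qed.

Lemma rect_integral_B q r a b c d : a <= b -> c <= d -> rcont q a b c d -> rcont r a b c d ->
  rect_integral (fun w => q w - r w) a b c d = rect_integral q a b c d - rect_integral r a b c d.
Proof.
move=> ab cd' hq hr; have axx := lexx a; have bxx := lexx b.
rewrite /rect_integral !cintegral_B; try by [apply: (rcont1 hq); rewrite ?lexx ?cd'|apply: (rcont1 hr); rewrite ?lexx ?cd'|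
   apply: (rcont2 hq); rewrite ?lexx ?ab|apply: (rcont2 hr); rewrite ?lexx ?ab].
by ring.
Qed.

Lemma cmod_i : cmod ('i : R[i]) = 1.
Proof. by rewrite /cmod /= expr0n add0r expr1n sqrtr1. Qed.

Lemma rect_integral_bound q a b c d M : a <= b -> c <= d -> rcont q a b c d ->
  (forall x y, a <= x <= b -> c <= y <= d -> cmod (q (x +i* y)) <= M) ->
  cmod (rect_integral q a b c d) <= 4 * (M * ((b - a) + (d - c))).
Proof.
move=> ab cd' rc hM.
have h1 y : c <= y <= d -> cmod (cintegral (fun x => q (x +i* y)) a b) <= 2 * (M * (b - a)).
  by move=> hy; apply: cintegral_bound => //; [exact: (rcont1 rc)|move=> x hx; exact: hM].
have h2 x : a <= x <= b -> cmod (cintegral (fun y => q (x +i* y)) c d) <= 2 * (M * (d - c)).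
  by move=> hx; apply: cintegral_bound => //; [exact: (rcont2 rc)|move=> y hy; exact: hM].
rewrite /rect_integral; apply: le_trans (cmodD _ _) _; rewrite cmodM cmod_i mul1r.
have := h1 c; have := h1 d; have := h2 a; have := h2 b; rewrite !lexx ab cd'.
move=> /(_ isT) k1 /(_ isT) k2 /(_ isT) k3 /(_ isT) k4.
have k5 := cmodD (cintegral (fun x => q (x +i* c)) a b) (- cintegral (fun x => q (x +i* d)) a b).
have k6 := cmodD (cintegral (fun x => q (b +i* x)) c d) (- cintegral (fun x => q (a +i* x)) c d).
move: k5 k6; rewrite !cmodN; clear -k1 k2 k3 k4; lra.
Qed.

Lemma nested_intervals (lo hi : nat -> R) : (forall n, lo n <= lo n.+1) -> (forall n, hi n.+1 <= hi n) ->
  (forall n, lo n <= hi n) -> exists x, forall n, lo n <= x <= hi n.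
Proof.
move=> hl hh hlh.
have mlo : {homo lo : m n / (m <= n)%N >-> m <= n} by apply: homo_leq => //; [exact: le_trans].
have mhi : {homo hi : m n / (m <= n)%N >-> n <= m} by apply: (homo_leq (r := fun x y => y <= x)) => // y x z xy /le_trans; apply.
have cross m n : lo m <= hi n.
  have [mn|/ltnW nm] := leqP m n.
    by apply: le_trans (hlh n); exact: mlo.
  by apply: le_trans (hlh m) _; exact: mhi.
have hs : has_sup (range lo).
  by split; [exists (lo 0%N), 0%N|exists (hi 0%N) => _ [n _ <-]; exact: cross].
exists (sup (range lo)) => n; apply/andP; split.
  by apply: sup_upper_bound => //; exists n.
apply: ge_sup; first by exists (lo 0%N), 0%N.
by move=> _ [m _ <-]; exact: cross.
Qed.

(* Quarter the rectangle, keeping each time a quarter with the largest contour integral. *)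
Lemma goursat q a b c d : a < b -> c < d ->
  (forall x y, a <= x <= b -> c <= y <= d -> cdiff q (x +i* y)) -> rect_integral q a b c d = 0.
Proof.
move=> ab cd' hq; apply/eqP; rewrite -cmod_eq0; apply: contraT => I0.
have rc : rcont q a b c d by move=> x y hx hy; apply: cdiff_cont; exact: hq.
pose K := cmod (rect_integral q a b c d) / 2.
have K0 : 0 < K by rewrite divr_gt0// lt0r I0 cmod_ge0.
pose u := b - a; pose v := d - c.
have u0 : 0 < u by rewrite subr_gt0.
have v0 : 0 < v by rewrite subr_gt0.
pose t n : R := 2^-1 ^+ n.
have t0 n : 0 < t n by rewrite exprn_gt0// invr_gt0.
have tS n : t n = 2 * t n.+1 by rewrite /t exprS mulrA divff ?mul1r.
(* The invariant of the quartering: a subrectangle scaled by [t n] with integral above K (t n)^2.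
   Taking for [K] half of the initial modulus makes the inequality strict at the start. *)
pose pr n (p : R * R) := [/\ a <= p.1, p.1 + u * t n <= b, c <= p.2, p.2 + v * t n <= d &
  K * t n ^+ 2 < cmod (rect_integral q p.1 (p.1 + u * t n) p.2 (p.2 + v * t n))].
pose rel n (p p' : R * R) := [/\ p.1 <= p'.1, p'.1 + u * t n.+1 <= p.1 + u * t n,
  p.2 <= p'.2 & p'.2 + v * t n.+1 <= p.2 + v * t n].
(* Stated as an implication for every pair, so that [choice] yields a total function. *)
have step (np : nat * (R * R)) : exists p', pr np.1 np.2 -> pr np.1.+1 p' /\ rel np.1 np.2 p'.
  case: np => n [x y]; rewrite /pr /rel /=.
  have [|hn] := pselect (pr n (x, y)); last by exists (0, 0) => h; exfalso; exact: hn.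
  rewrite /pr /= => -[ax xb cy yd hI].
  have uS : u * t n = 2 * (u * t n.+1) by rewrite tS; ring.
  have vS : v * t n = 2 * (v * t n.+1) by rewrite tS; ring.
  have KS : K * t n ^+ 2 = 4 * (K * t n.+1 ^+ 2) by rewrite tS exprMn; ring.
  have ut0 : 0 < u * t n.+1 by rewrite mulr_gt0.
  have vt0 : 0 < v * t n.+1 by rewrite mulr_gt0.
  rewrite KS uS vS in hI; rewrite uS vS; rewrite uS in xb; rewrite vS in yd.
  move: (u * t n.+1) (v * t n.+1) (K * t n.+1 ^+ 2) ut0 vt0 xb yd hI => U V L ut0 vt0 xb yd hI.
  have sp : rect_integral q x (x + 2 * U) y (y + 2 * V) =
      (rect_integral q x (x + U) y (y + V) + rect_integral q (x + U) (x + 2 * U) y (y + V)) +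
      (rect_integral q x (x + U) (y + V) (y + 2 * V) + rect_integral q (x + U) (x + 2 * U) (y + V) (y + 2 * V)).
    apply: rect_integral_split; [by clear -ut0; apply/andP; split; lra|by clear -vt0; apply/andP; split; lra|].
    move=> x' y' /andP[h1 h2] /andP[h3 h4]; apply: rc.
      by rewrite (le_trans ax)// (le_trans h2).
    by rewrite (le_trans cy)// (le_trans h4).
  have e1 : x + 2 * U = (x + U) + U by ring.
  have e2 : y + 2 * V = (y + V) + V by ring.
  have [h|h1] := ltP L (cmod (rect_integral q x (x + U) y (y + V))).
    by exists (x, y) => _ /=; split; split=> //; clear -ut0 vt0 xb yd; lra.
  have [h|h2] := ltP L (cmod (rect_integral q (x + U) (x + 2 * U) y (y + V))).
    by exists (x + U, y) => _ /=; rewrite -e1; split; split=> //; clear -ut0 vt0 xb yd ax cy; lra.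
  have [h|h3] := ltP L (cmod (rect_integral q x (x + U) (y + V) (y + 2 * V))).
    by exists (x, y + V) => _ /=; rewrite -e2; split; split=> //; clear -ut0 vt0 xb yd ax cy; lra.
  have [h|h4] := ltP L (cmod (rect_integral q (x + U) (x + 2 * U) (y + V) (y + 2 * V))).
    by exists (x + U, y + V) => _ /=; rewrite -e1 -e2; split; split=> //; clear -ut0 vt0 xb yd ax cy; lra.
  exfalso; move: hI; rewrite sp ltNge => /negP; apply.
  apply: le_trans (cmodD _ _) _.
  apply: (@le_trans _ _ ((L + L) + (L + L))); last by clear; lra.
  by apply: lerD; apply: le_trans (cmodD _ _) _; exact: lerD.
have [F HF] := choice step.
pose G n := iteri n (fun m p => F (m, p)) (a, c).
have pG n : pr n (G n).
  elim: n => [|n IH]; last by have [] := HF (n, G n) IH.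
  rewrite /pr /G /= /t expr0 expr1n !mulr1 /u /v [a + _]addrC [c + _]addrC !subrK.
  split=> //; rewrite /K ltr_pdivrMr// ltr_pMr; last by rewrite lt0r I0 cmod_ge0.
  by rewrite (ltr_nat _ 1 2).
have rG n : rel n (G n) (G n.+1) by have [] := HF (n, G n) (pG n).
have [xs hxs] : exists x, forall n, (G n).1 <= x <= (G n).1 + u * t n.
  apply: (nested_intervals (lo := fun n => (G n).1) (hi := fun n => (G n).1 + u * t n)) => n.
  - by have [] := rG n.
  - by have [] := rG n.
  - by rewrite lerDl mulr_ge0// ltW.
have [ys hys] : exists x, forall n, (G n).2 <= x <= (G n).2 + v * t n.
  apply: (nested_intervals (lo := fun n => (G n).2) (hi := fun n => (G n).2 + v * t n)) => n.
  - by have [] := rG n.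
  - by have [] := rG n.
  - by rewrite lerDl mulr_ge0// ltW.
pose P := xs +i* ys.
have inR : a <= xs <= b /\ c <= ys <= d.
  have [h1 h2 h3 h4 _] := pG 0%N; have /andP[k1 k2] := hxs 0%N; have /andP[k3 k4] := hys 0%N.
  by rewrite (le_trans h1)// (le_trans k2)// (le_trans h3)// (le_trans k4).
have [h [ch hqP]] : cdiff q P by have [] := inR; exact: hq.
pose W := u + v.
have W0 : 0 < W by rewrite addr_gt0.
(* With this value the final estimate 4 (e t W) (t W), where t is [t n], equals K t^2 and
   contradicts the invariant. *)
pose e := K / (4 * W ^+ 2).
have e0 : 0 < e by rewrite divr_gt0// mulr_gt0// exprn_gt0.
have FF : Filter (nbhs P) by exact: nbhs_filter.
have nh := (@cvg_cmP _ _ (nbhs P) FF h (h P)).1 ch e e0.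
have [del del0 hdel] := (nbhs_cmP _ _).1 (filterI hqP nh).
have [n hn] : exists n, t n * W < del.
  have : (fun n => t n) n @[n --> \oo] --> (0 : R).
    by apply: cvg_expr; rewrite gtr0_norm ?invr_gt0// invf_lt1// (ltr_nat _ 1 2).
  move=> /cvgrPdist_lt/(_ (del / W)); rewrite divr_gt0// => /(_ isT)[n _ /(_ n (leqnn n))].
  by rewrite /= sub0r normrN gtr0_norm// ltr_pdivlMr// => hn; exists n.
have [a1 a2 a3 a4] := pG n.
rewrite ltNge => /negP nb; exfalso; apply: nb.
move: (hxs n) (hys n) a1 a2 a3 a4; move: (G n) => [x y] /= => /andP[x1 x2] /andP[y1 y2] a1 a2 a3 a4.
have un0 : 0 <= u * t n by rewrite mulr_ge0// ltW.
have vn0 : 0 <= v * t n by rewrite mulr_ge0// ltW.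
have xx : x <= x + u * t n by rewrite lerDl.
have yy : y <= y + v * t n by rewrite lerDl.
have rcn : rcont q x (x + u * t n) y (y + v * t n).
  move=> x' y' /andP[h1 h2] /andP[h3 h4]; apply: rc.
    by rewrite (le_trans a1)// (le_trans h2).
  by rewrite (le_trans a3)// (le_trans h4).
pose A w := (q P - h P * P) + h P * w.
have cA w : {for w, continuous A}.
  exact: (ctD (@ctcst w _) (ctM (@ctcst w (h P)) (@ctid w))).
have -> : rect_integral q x (x + u * t n) y (y + v * t n) = rect_integral (fun w => q w - A w) x (x + u * t n) y (y + v * t n).
  have rcA : rcont A x (x + u * t n) y (y + v * t n) by move=> ? ? _ _; exact: cA.
  by rewrite (rect_integral_B xx yy rcn rcA) (rect_integral_affine _ _ xx yy) subr0.
have r0 : 0 <= t n * W by rewrite mulr_ge0// ltW.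
apply: (@le_trans _ _ (4 * (e * (t n * W) * ((x + u * t n - x) + (y + v * t n - y))))).
  apply: (rect_integral_bound xx yy).
    move=> x' y' h1 h2; rewrite (_ : (fun w => q w - A w) = (fun w => q w + (-1) * A w)).
      exact: (ctD (rcn _ _ h1 h2) (ctM (@ctcst _ (-1)) (@cA _))).
    by apply/funext => w; rewrite mulN1r.
  move=> x' y' /andP[h1 h2] /andP[h3 h4].
  have dist : cmod ((x' +i* y') - P) <= t n * W.
    apply: le_trans (cmod_ReIm _) _; rewrite /= /W mulrDr (mulrC _ u) (mulrC _ v).
    apply: lerD; rewrite ler_norml; move: h1 h2 h3 h4 x1 x2 y1 y2; clear; move=> *; apply/andP; split; lra.
  have [k1 k2] : q (x' +i* y') - q P = h (x' +i* y') * ((x' +i* y') - P) /\ cmod (h P - h (x' +i* y')) < e.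
    by apply: hdel; rewrite cmodB; exact: le_lt_trans dist hn.
  have -> : q (x' +i* y') - A (x' +i* y') = (h (x' +i* y') - h P) * ((x' +i* y') - P).
    by rewrite mulrBl -k1 /A; ring.
  by rewrite cmodM ler_pM ?cmod_ge0// cmodB ltW.
rewrite le_eqVlt; apply/orP; left; apply/eqP.
rewrite ![_ + _ - _]addrAC !subrr !add0r -mulrDl -/W /e.
by field; rewrite gt_eqF.
Qed.

Definition square_integral q (t : R) := rect_integral q (- t) t (- t) t.

(** The region between the squares is cut into two vertical strips of full height and two rectangles
    between them; Goursat applies to each and the common sides cancel. *)
Lemma square_annulus q (s t : R) : 0 < s -> s < t ->
  (forall x y, s <= Num.max `|x| `|y| -> cdiff q (x +i* y)) -> square_integral q s = square_integral q t.
Proof.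
move=> s0 st hq.
have ms : - s < s by lra.
have mt : - t < - s by lra.
have cq x y : s <= Num.max `|x| `|y| -> {for x +i* y, continuous q} by move=> h; apply: cdiff_cont; exact: hq.
have nx (x : R) : s <= x \/ x <= - s -> s <= `|x|.
  by case=> h; rewrite ler_normr ?h//; apply/orP; right; lra.
have mx1 (x y : R) : s <= `|x| -> s <= Num.max `|x| `|y| by rewrite le_max => ->.
have mx2 (x y : R) : s <= `|y| -> s <= Num.max `|x| `|y| by rewrite le_max orbC => ->.
have r1 : rect_integral q s t (- t) t = 0.
  by apply: goursat => [||x y /andP[h1 h2] _]; [by []|lra|apply: hq; apply: mx1; apply: nx; left].
have r2 : rect_integral q (- t) (- s) (- t) t = 0.
  by apply: goursat => [||x y /andP[h1 h2] _]; [by []|lra|apply: hq; apply: mx1; apply: nx; right].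
have r3 : rect_integral q (- s) s s t = 0.
  by apply: goursat => [||x y _ /andP[h1 h2]]; [by []|by []|apply: hq; apply: mx2; apply: nx; left].
have r4 : rect_integral q (- s) s (- t) (- s) = 0.
  by apply: goursat => [||x y _ /andP[h1 h2]]; [by []|by []|apply: hq; apply: mx2; apply: nx; right].
have c1 y a b : s <= `|y| -> ccont (fun x => q (x +i* y)) a b.
  by move=> h; apply: ccont1 => x _; apply: cq; exact: mx2.
have c2 x a b : s <= `|x| -> ccont (fun y => q (x +i* y)) a b.
  by move=> h; apply: ccont2 => y _; apply: cq; exact: mx1.
have le1 : - t <= - s by exact: ltW.
have le2 : - s <= s by exact: ltW.
have le3 : s <= t by exact: ltW.
have le4 : - s <= t by lra.
have sp1 y : s <= `|y| -> cintegral (fun x => q (x +i* y)) (- t) t =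
    cintegral (fun x => q (x +i* y)) (- t) (- s) + (cintegral (fun x => q (x +i* y)) (- s) s + cintegral (fun x => q (x +i* y)) s t).
  by move=> h; rewrite (cintegral_cat le1 le4 (c1 _ _ _ h)) (cintegral_cat le2 le3 (c1 _ _ _ h)).
have sp2 x : s <= `|x| -> cintegral (fun y => q (x +i* y)) (- t) t =
    cintegral (fun y => q (x +i* y)) (- t) (- s) + (cintegral (fun y => q (x +i* y)) (- s) s + cintegral (fun y => q (x +i* y)) s t).
  by move=> h; rewrite (cintegral_cat le1 le4 (c2 _ _ _ h)) (cintegral_cat le2 le3 (c2 _ _ _ h)).
have ns : s <= `|- s| by apply: nx; right.
have ps : s <= `|s| by apply: nx; left.
have nt : s <= `|- t| by apply: nx; right.
have pt : s <= `|t| by apply: nx; left.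
have tot : square_integral q t - square_integral q s = (rect_integral q s t (- t) t + rect_integral q (- t) (- s) (- t) t) + (rect_integral q (- s) s s t + rect_integral q (- s) s (- t) (- s)).
  rewrite /square_integral /rect_integral (sp1 (- t) nt) (sp1 t pt) (sp2 s ps) (sp2 (- s) ns).
  ring.
by apply/eqP; rewrite eq_sym -subr_eq0 tot r1 r2 r3 r4 !addr0.
Qed.

Lemma itv_lower (f : R -> R) a b M : a <= b -> (forall x, a <= x <= b -> {for x, continuous f}) ->
  (forall x, a <= x <= b -> M <= f x) -> M * (b - a) <= \int[mu]_(x in `[a, b]) f x.
Proof.
move=> ab cf fM.
have i2 : mu.-integrable `[a, b] (EFin \o (fun=> M)) by apply: itv_int => x _; exact: cvg_cst.
have := le_Rintegral (mu := mu) (D := `[a, b]%classic) _ i2 (itv_int cf).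
rewrite Rintegral_cst// (_ : fine (mu `[a, b]%classic) = b - a); last by rewrite lebesgue_itvcc.
by apply => // x; rewrite /= in_itv/=; exact: fM.
Qed.

Lemma invC_ReIm x y : (x +i* y)^-1 = (x / (x ^+ 2 + y ^+ 2)) +i* (- y / (x ^+ 2 + y ^+ 2)).
Proof. by rewrite mulNr. Qed.

(** The exact value is 2 pi, but 4 is enough: on each of the four sides the relevant component is t
    / (x^2 + t^2) >= 1 / (2 t) over a length 2 t. *)
Lemma square_inv (t : R) : 0 < t -> 4 <= complex.Im (square_integral (fun w => w^-1) t).
Proof.
move=> t0; have tt : - t <= t by lra.
have ci (w : R[i]) : w != 0 -> {for w, continuous (fun w => w^-1)}.
  by move=> w0; exact: (ctV w0 (@ctid w)).
have nz1 (x y : R) : y != 0 -> x +i* y != 0 :> R[i].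
  by apply: contraNN => /eqP [_ ->].
have nz2 (x y : R) : x != 0 -> x +i* y != 0 :> R[i].
  by apply: contraNN => /eqP [-> _].
have tn : t != 0 by rewrite gt_eqF.
have tn' : - t != 0 by rewrite oppr_eq0.
have c1 y : y != 0 -> ccont (fun x => (x +i* y)^-1) (- t) t.
  by move=> y0; apply: (@ccont1 (fun w => w^-1)) => x _; apply: ci; exact: nz1.
have c2 x : x != 0 -> ccont (fun y => (x +i* y)^-1) (- t) t.
  by move=> x0; apply: (@ccont2 (fun w => w^-1)) => y _; apply: ci; exact: nz2.
have bnd (x : R) : - t <= x <= t -> (2 * t)^-1 <= t / (x ^+ 2 + t ^+ 2).
  move=> /andP[h1 h2]; have x2 : x ^+ 2 <= t ^+ 2.
    have xt : `|x| <= t by rewrite ler_norml h1.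
    by rewrite -(real_normK (num_real x)) ler_pXn2r ?nnegrE// (le_trans _ xt).
  have p0 : 0 < x ^+ 2 + t ^+ 2 by rewrite ltr_wpDl ?sqr_ge0// exprn_gt0.
  rewrite ler_pdivlMr// mulrC ler_pdivrMr ?mulr_gt0//.
  by rewrite mulrCA -expr2 mulr_natl mulr2n lerD2r.
have half : (2 * t)^-1 * (t - - t) = 1 by rewrite opprK; field.
rewrite /square_integral /rect_integral.
rewrite ImD ImB ImM ReB (_ : complex.Re 'i = 0)// (_ : complex.Im 'i = 1)// mul0r add0r mul1r.
have e1 : 1 <= complex.Im (cintegral (fun x => (x +i* (- t))^-1) (- t) t).
  rewrite -half; apply: (itv_lower tt) => x hx; first by have [] := c1 _ tn' x hx.
  by rewrite invC_ReIm /= opprK sqrrN; exact: bnd.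
have e2 : 1 <= - complex.Im (cintegral (fun x => (x +i* t)^-1) (- t) t).
  rewrite -[leRHS]mulN1r -[-1]/(complex.Re (-1)) -[leRHS]subr0.
  have -> : complex.Re (-1) * complex.Im (cintegral (fun x => (x +i* t)^-1) (- t) t) - 0 =
    complex.Im (cintegral (fun x => (-1) * (x +i* t)^-1) (- t) t).
    by rewrite cintegral_Z ?ImM /= ?oppr0 ?mul0r ?subr0 ?addr0//; exact: c1.
  rewrite -half; apply: (itv_lower tt) => x hx.
    rewrite (_ : (fun x => _) = (fun x => - complex.Im (x +i* t)^-1)); last by apply/funext => y; rewrite mulN1r raddfN.
    by apply: cvgN; have [] := c1 _ tn x hx.
  by rewrite mulN1r raddfN invC_ReIm /= mulNr opprK; exact: bnd.
have e3 : 1 <= complex.Re (cintegral (fun x => (t +i* x)^-1) (- t) t).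
  rewrite -half; apply: (itv_lower tt) => x hx; first by have [] := c2 _ tn x hx.
  by rewrite invC_ReIm /= addrC; exact: bnd.
have e4 : 1 <= - complex.Re (cintegral (fun x => ((- t) +i* x)^-1) (- t) t).
  rewrite -[leRHS]mulN1r -[-1]/(complex.Re (-1)) -[leRHS]subr0.
  have -> : complex.Re (-1) * complex.Re (cintegral (fun x => ((- t) +i* x)^-1) (- t) t) - 0 =
    complex.Re (cintegral (fun x => (-1) * ((- t) +i* x)^-1) (- t) t).
    by rewrite cintegral_Z ?ReM /= ?oppr0 ?mul0r ?subr0 ?addr0//; exact: c2.
  rewrite -half; apply: (itv_lower tt) => x hx.
    rewrite (_ : (fun x => _) = (fun x => - complex.Re ((- t) +i* x)^-1)); last by apply/funext => y; rewrite mulN1r raddfN.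
    by apply: cvgN; have [] := c2 _ tn' x hx.
  by rewrite mulN1r raddfN invC_ReIm /= mulNr opprK sqrrN addrC; exact: bnd.
move: e1 e2 e3 e4; move: (cintegral _ _ _) (cintegral _ _ _) (cintegral _ _ _) (cintegral _ _ _) => z1 z2 z3 z4.
move: (complex.Im z1) (complex.Im z2) (complex.Re z3) (complex.Re z4); clear; move=> *; lra.
Qed.

Lemma max_cm x y : Num.max `|x| `|y| <= cmod (x +i* y).
Proof. by rewrite ge_max (Re_cm (x +i* y)) (Im_cm (x +i* y)). Qed.

(** The integral of H(w) / w is the same over all squares. Over large ones it is close to that of
    1/w, of imaginary part at least 4; over the given one its modulus is at most 16 B, each side
    giving at most 2 (B/s) (2 s). *)
Lemma square_mean (H : R[i] -> R[i]) (s B : R) : 0 < s ->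
  (forall x y, s <= Num.max `|x| `|y| -> cdiff H (x +i* y)) ->
  (forall e, 0 < e -> exists M, forall w, M < cmod w -> cmod (H w - 1) < e) ->
  (forall x y, Num.max `|x| `|y| = s -> cmod (H (x +i* y)) <= B) -> 1 / 4 <= B.
Proof.
move=> s0 cH Hinf HB.
apply/ler_addgt0Pr => /= e e0.
have [M hM] := Hinf e e0.
pose t := Num.max M s + 1.
have tM : M < t by rewrite /t ltr_pwDr// le_max lexx.
have ts : s < t by rewrite /t ltr_pwDr// le_max lexx orbT.
have t0 : 0 < t by exact: lt_trans ts.
pose q w := H w * w^-1.
have nz x y : s <= Num.max `|x| `|y| -> x +i* y != 0 :> R[i].
  move=> h; rewrite -cmod_gt0; apply: lt_le_trans (max_cm x y); exact: lt_le_trans h.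
have cI x y : s <= Num.max `|x| `|y| -> cdiff (fun w => w^-1) (x +i* y).
  by move=> h; apply: (@cdiffV id); [exact: nz|exact: cdiff_id].
have cq x y : s <= Num.max `|x| `|y| -> cdiff q (x +i* y).
  by move=> h; apply: cdiffM; [exact: cH|exact: cI].
have EQ := square_annulus s0 ts cq.
have bnd (r : R[i] -> R[i]) (u K : R) : 0 < u -> (forall x y, Num.max `|x| `|y| = u -> {for x +i* y, continuous r}) ->
    (forall x y, Num.max `|x| `|y| = u -> cmod (r (x +i* y)) <= K / u) -> cmod (square_integral r u) <= 16 * K.
  move=> u0 cr hr.
  have uu : - u <= u by clear -u0; lra.
  have mxu1 (x : R) : - u <= x <= u -> Num.max `|x| `|u| = u /\ Num.max `|x| `|- u| = u.
    move=> h; rewrite normrN (gtr0_norm u0).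
    by have /max_idPr -> : `|x| <= u by rewrite ler_norml.
  have mxu2 (x : R) : - u <= x <= u -> Num.max `|u| `|x| = u /\ Num.max `|- u| `|x| = u.
    by move=> h; rewrite ![Num.max _ `|x|]maxC; exact: mxu1.
  have b1 y : (forall x, - u <= x <= u -> Num.max `|x| `|y| = u) -> cmod (cintegral (fun x => r (x +i* y)) (- u) u) <= 4 * K.
    move=> h; have -> : 4 * K = 2 * (K / u * (u - - u)) by field; rewrite gt_eqF.
    by apply: (cintegral_bound uu); [apply: ccont1 => x /h/cr|move=> x /h/hr].
  have b2 x : (forall y, - u <= y <= u -> Num.max `|x| `|y| = u) -> cmod (cintegral (fun y => r (x +i* y)) (- u) u) <= 4 * K.
    move=> h; have -> : 4 * K = 2 * (K / u * (u - - u)) by field; rewrite gt_eqF.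
    by apply: (cintegral_bound uu); [apply: ccont2 => y /h/cr|move=> y /h/hr].
  rewrite /square_integral /rect_integral; apply: le_trans (cmodD _ _) _; rewrite cmodM cmod_i mul1r.
  have k1 := b1 (- u) (fun x h => (mxu1 x h).2); have k2 := b1 u (fun x h => (mxu1 x h).1).
  have k3 := b2 u (fun x h => (mxu2 x h).1); have k4 := b2 (- u) (fun x h => (mxu2 x h).2).
  have k5 := cmodD (cintegral (fun x => r (x +i* (- u))) (- u) u) (- cintegral (fun x => r (x +i* u)) (- u) u).
  have k6 := cmodD (cintegral (fun x => r (u +i* x)) (- u) u) (- cintegral (fun x => r ((- u) +i* x)) (- u) u).
  move: k5 k6; rewrite !cmodN; clear -k1 k2 k3 k4; lra.
have inv (u : R) x y : 0 < u -> Num.max `|x| `|y| = u -> cmod (x +i* y)^-1 <= u^-1.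
  move=> u0 h; rewrite cmodV lef_pV2 ?posrE//.
    by rewrite -h; exact: max_cm.
  by apply: lt_le_trans (max_cm x y); rewrite h.
have b1 : cmod (square_integral q s) <= 16 * B.
  apply: (bnd _ _ _ s0) => x y h; first by apply: cdiff_cont; apply: cq; rewrite h.
  by rewrite cmodM ler_pM ?cmod_ge0 ?HB// inv.
have b2 : cmod (square_integral (fun w => q w - w^-1) t) <= 16 * e.
  apply: (bnd _ _ _ t0) => x y h.
    apply: cdiff_cont; have hs : s <= Num.max `|x| `|y| by rewrite h ltW.
    rewrite (_ : (fun w => _) = (fun w => q w + (-1) * w^-1)); last by apply/funext => w; rewrite mulN1r.
    apply: cdiffD; first exact: cq.
    by apply: cdiffM; [exact: cdiff_cst|exact: cI].
  have -> : q (x +i* y) - (x +i* y)^-1 = (H (x +i* y) - 1) * (x +i* y)^-1 by rewrite mulrBl mul1r.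
  rewrite cmodM ler_pM ?cmod_ge0 ?inv//; apply: ltW; apply: hM; apply: lt_le_trans tM _.
  by rewrite -h; exact: max_cm.
have sqB : square_integral (fun w => q w - w^-1) t = square_integral q t - square_integral (fun w => w^-1) t.
  have ht : s <= `|t| by rewrite (gtr0_norm t0) ltW.
  have ht' : s <= `|- t| by rewrite normrN.
  have m1 (x y : R) : s <= `|y| -> s <= Num.max `|x| `|y| by rewrite le_max orbC => ->.
  have m2 (x y : R) : s <= `|x| -> s <= Num.max `|x| `|y| by rewrite le_max => ->.
  have ce1 (r : R[i] -> R[i]) y : (forall x y, s <= Num.max `|x| `|y| -> cdiff r (x +i* y)) ->
     s <= `|y| -> ccont (fun x => r (x +i* y)) (- t) t.
    by move=> cr hy; apply: ccont1 => x _; apply: cdiff_cont; apply: cr; exact: m1.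
  have ce2 (r : R[i] -> R[i]) x : (forall x y, s <= Num.max `|x| `|y| -> cdiff r (x +i* y)) ->
     s <= `|x| -> ccont (fun y => r (x +i* y)) (- t) t.
    by move=> cr hy; apply: ccont2 => y _; apply: cdiff_cont; apply: cr; exact: m2.
  rewrite /square_integral /rect_integral (cintegral_B (ce1 _ _ cq ht') (ce1 _ _ cI ht')) (cintegral_B (ce1 _ _ cq ht) (ce1 _ _ cI ht)).
  rewrite (cintegral_B (ce2 _ _ cq ht) (ce2 _ _ cI ht)) (cintegral_B (ce2 _ _ cq ht') (ce2 _ _ cI ht')).
  ring.
have h4 := square_inv t0.
have l1 : complex.Im (square_integral q t) <= 16 * B.
  by rewrite -EQ; apply: le_trans b1; apply: le_trans (Im_cm _); exact: ler_norm.
have l2 : - complex.Im (square_integral (fun w => q w - w^-1) t) <= 16 * e.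
  by apply: le_trans b2; apply: le_trans (Im_cm _); rewrite -normrN; exact: ler_norm.
move: l2; rewrite sqB ImB; move: h4 l1; clear; move: (complex.Im _) (complex.Im _) => *; lra.
Qed.

End Contour.

(** * Holomorphic square roots near infinity *)

Section SquareRoot.
Context {R : realType}.
Implicit Types (q r g E : R[i] -> R[i]) (z w k : R[i]) (x y e M : R).

(** The sign selects the principal branch, which is holomorphic on Re z > 0. [locked] keeps
    simplification from exposing the case distinction. *)
Definition psqrt z : R[i] := locked (if 0 <= complex.Re (sqrtc z) then sqrtc z else - sqrtc z).

Lemma psqrt_sq z : psqrt z ^+ 2 = z.
Proof. by rewrite /psqrt -lock; case: ifP => _; rewrite ?sqrrN sqr_sqrtc. Qed.

Lemma psqrt_Re z : 0 < complex.Re z -> 0 < complex.Re (psqrt z).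
Proof.
move=> z0; have h0 : 0 <= complex.Re (psqrt z).
  by rewrite /psqrt -lock; case: ifP => // /negbT; rewrite -ltNge raddfN oppr_ge0 => /ltW.
rewrite lt0r h0 andbT; apply/negP => /eqP h1.
move: z0; rewrite -{1}(psqrt_sq z) expr2 ReM h1 mul0r sub0r -expr2.
by rewrite oppr_gt0 ltNge sqr_ge0.
Qed.

(** The roots a and b satisfy (a - b)(a + b) = z - w, and a + b has real part at least Re b > 0. The
    equation serves for the derivative, the inequality for continuity. *)
Lemma psqrt_sub z w : 0 < complex.Re z -> 0 < complex.Re w ->
  psqrt z - psqrt w = (psqrt z + psqrt w)^-1 * (z - w) /\ psqrt z + psqrt w != 0 /\
  cmod (psqrt z - psqrt w) <= (complex.Re (psqrt w))^-1 * cmod (z - w).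
Proof.
move=> /psqrt_Re pz /psqrt_Re pw.
have Rp : complex.Re (psqrt w) <= complex.Re (psqrt z + psqrt w).
  by rewrite raddfD lerDr ltW.
have n0 : psqrt z + psqrt w != 0.
  by apply/negP => /eqP h; move: Rp; rewrite h leNgt pw.
have e1 : psqrt z - psqrt w = (psqrt z + psqrt w)^-1 * (z - w).
  have h : (psqrt z + psqrt w) * (psqrt z - psqrt w) = z - w by rewrite mulrC -subr_sqr !psqrt_sq.
  by rewrite -h mulrA mulVf// mul1r.
split=> //; split=> //; rewrite {1}e1 cmodM cmodV ler_wpM2r ?cmod_ge0//.
rewrite lef_pV2 ?posrE ?cmod_gt0//; apply: le_trans Rp _.
by apply: le_trans (ler_norm _) _; exact: Re_cm.
Qed.

Lemma Re1_gt0 z : cmod (z - 1) < 1 -> 0 < complex.Re z.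
Proof.
move=> h; have := le_lt_trans (Re_cm (z - 1)) h; rewrite raddfB /= ltr_norml => /andP[+ _].
lra.
Qed.

Lemma psqrt1 : psqrt 1 = 1.
Proof.
have p1 : 0 < complex.Re (psqrt 1) by apply: psqrt_Re; rewrite /= ltr01.
have := psqrt_sq 1; rewrite -[RHS](expr1n _ 2) => /eqP; rewrite eqf_sqr => /orP[/eqP//|/eqP h].
by move: p1; rewrite h raddfN /= oppr_gt0 ltr10.
Qed.

Lemma psqrt_near1 z : cmod (z - 1) < 1 -> cmod (psqrt z - 1) <= cmod (z - 1).
Proof.
move=> h; have R1 : 0 < complex.Re (1 : R[i]) by rewrite /= ltr01.
by have [_ [_ +]] := psqrt_sub (Re1_gt0 h) R1; rewrite psqrt1 /= invr1 mul1r.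
Qed.

Lemma near_Re_gt0 g w : {for w, continuous g} -> 0 < complex.Re (g w) -> \forall z \near nbhs w, 0 < complex.Re (g z).
Proof.
move=> cg g0; have FF : Filter (nbhs w) by exact: nbhs_filter.
have := (@cvg_cmP _ _ (nbhs w) FF g (g w)).1 cg _ g0; apply: filterS => z h.
have := le_lt_trans (Re_cm _) h; rewrite raddfB ltr_norml => /andP[_]; lra.
Qed.

Lemma cdiff_psq g w : cdiff g w -> 0 < complex.Re (g w) -> cdiff (fun z => psqrt (g z)) w.
Proof.
move=> cg g0; have cg' := cdiff_cont cg; have [h [ch hg]] := cg.
have FF : Filter (nbhs w) by exact: nbhs_filter.
have pw0 := psqrt_Re g0.
have cp : {for w, continuous (fun z => psqrt (g z))}.
  apply: (@cvg_cmP _ _ (nbhs w) FF (fun z => psqrt (g z)) _).2 => e e0.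
  have e1 : 0 < e * complex.Re (psqrt (g w)) by rewrite mulr_gt0.
  have := (@cvg_cmP _ _ (nbhs w) FF g (g w)).1 cg' _ e1.
  apply: filterS2 (near_Re_gt0 cg' g0) => z gz hz.
  have [_ [_ h3]] := psqrt_sub gz g0.
  by rewrite cmodB; apply: le_lt_trans h3 _; rewrite mulrC ltr_pdivrMr// cmodB.
exists (fun z => (psqrt (g z) + psqrt (g w))^-1 * h z); split.
  have n0 : psqrt (g w) + psqrt (g w) != 0 by have [_ []] := psqrt_sub g0 g0.
  exact: (ctM (ctV (q := fun z => psqrt (g z) + psqrt (g w)) n0 (ctD cp (@ctcst _ w (psqrt (g w))))) ch).
apply: filterS2 hg (near_Re_gt0 cg' g0) => z hz gz.
by have [-> _] := psqrt_sub gz g0; rewrite hz mulrA.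
Qed.

Lemma cdiff_scale q k w : cdiff q (k * w) -> cdiff (fun z => q (k * z)) w.
Proof.
move=> [h [ch hq]].
have FF : Filter (nbhs w) by exact: nbhs_filter.
have ck : (fun z => k * z) @ nbhs w --> k * w by exact: (ctM (@ctcst _ w k) (@ctid _ w)).
exists (fun z => h (k * z) * k); split.
  apply: (ctM (q := fun z => h (k * z))); last exact: ctcst.
  by apply: (cvg_comp (fun z => k * z) h ck); exact: ch.
apply: (@filterS _ (nbhs w) FF _ _ _ (ck _ hq)) => z /= ->.
by rewrite -mulrA -mulrBr.
Qed.

Definition lim_oo q (l : R[i]) := forall e, 0 < e -> exists M, forall w, M < cmod w -> cmod (q w - l) < e.

Lemma lim_ooD q r k l : lim_oo q k -> lim_oo r l -> lim_oo (fun w => q w + r w) (k + l).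
Proof.
move=> hq hr e e0; have e2 : 0 < e / 2 by rewrite divr_gt0.
have [M hM] := hq _ e2; have [N hN] := hr _ e2.
exists (Num.max M N) => w; rewrite gt_max => /andP[/hM h1 /hN h2].
rewrite opprD addrACA; apply: le_lt_trans (cmodD _ _) _.
by rewrite (splitr e) ltrD.
Qed.

Lemma lim_ooZ q k l : lim_oo q l -> lim_oo (fun w => k * q w) (k * l).
Proof.
move=> hq e e0; have c0 : 0 < cmod k + 1 by rewrite ltr_wpDl ?cmod_ge0.
have e2 : 0 < e / (cmod k + 1) by rewrite divr_gt0.
have [M hM] := hq _ e2; exists M => w /hM h; rewrite -mulrBr cmodM.
apply: (@le_lt_trans _ _ ((cmod k + 1) * cmod (q w - l))).
  by rewrite ler_wpM2r ?cmod_ge0// lerDl.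
by rewrite mulrC -ltr_pdivlMr.
Qed.

Lemma lim_oo1M q r : lim_oo q 1 -> lim_oo r 1 -> lim_oo (fun w => q w * r w) 1.
Proof.
move=> hq hr e e0; pose e2 := Num.min 1 (e / 3).
have e20 : 0 < e2 by rewrite lt_min ltr01 divr_gt0.
have [M hM] := hq _ e20; have [N hN] := hr _ e20.
exists (Num.max M N) => w; rewrite gt_max => /andP[/hM h1 /hN h2].
have -> : q w * r w - 1 = (q w - 1) * (r w - 1) + ((q w - 1) + (r w - 1)) by ring.
have k1 : cmod ((q w - 1) * (r w - 1)) <= cmod (q w - 1).
  by rewrite cmodM ler_piMr ?cmod_ge0// ltW// (lt_le_trans h2)// ge_min lexx.
have l1 : cmod (q w - 1) < e / 3 by apply: lt_le_trans h1 _; rewrite ge_min lexx orbT.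
have l2 : cmod (r w - 1) < e / 3 by apply: lt_le_trans h2 _; rewrite ge_min lexx orbT.
have := cmodD ((q w - 1) * (r w - 1)) ((q w - 1) + (r w - 1)); have := cmodD (q w - 1) (r w - 1).
move: k1 l1 l2; clear; lra.
Qed.

Lemma lim_oo1V q : lim_oo q 1 -> lim_oo (fun w => (q w)^-1) 1.
Proof.
move=> hq e e0; pose e2 := Num.min (1 / 2) (e / 2).
have e20 : 0 < e2 by rewrite lt_min !divr_gt0.
have [M hM] := hq _ e20; exists M => w /hM h.
have l1 : cmod (q w - 1) < 1 / 2 by apply: lt_le_trans h _; rewrite ge_min lexx.
have l2 : cmod (q w - 1) < e / 2 by apply: lt_le_trans h _; rewrite ge_min lexx orbT.
have q2 : 1 / 2 < cmod (q w).
  have := cmod_lower 1 (q w - 1); rewrite addrCA subrr addr0 cmod1; move: l1; clear; lra.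
have q0 : q w != 0 by rewrite -cmod_gt0; apply: lt_trans q2; rewrite divr_gt0.
have -> : (q w)^-1 - 1 = - (q w)^-1 * (q w - 1) by field.
rewrite cmodM cmodN cmodV mulrC ltr_pdivrMr ?cmod_gt0//.
apply: lt_trans l2 _; rewrite ltr_pM2l//; move: q2; clear; lra.
Qed.

Lemma lim_oo_scale q k l : 1 <= cmod k -> lim_oo q l -> lim_oo (fun w => q (k * w)) l.
Proof.
move=> k1 hq e e0; have [M hM] := hq e e0; exists M => w h; apply: hM.
by rewrite cmodM; apply: lt_le_trans h _; rewrite ler_peMl// cmod_ge0.
Qed.

Lemma lim_oo_psq q : lim_oo q 1 -> lim_oo (fun w => psqrt (q w)) 1.
Proof.
move=> hq e e0; have e20 : 0 < Num.min 1 e by rewrite lt_min ltr01.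
have [M hM] := hq _ e20; exists M => w /hM; rewrite lt_min => /andP[h1 h2].
by apply: le_lt_trans h2; exact: psqrt_near1.
Qed.

(** Indeed |b| > 3 eta while |a - b| < 2 eta. *)
Lemma ratio_bound (u a b : R[i]) (eta : R) : 4 * eta <= cmod u -> cmod (u - a) < eta -> cmod (u - b) < eta -> cmod (a / b - 1) < 1.
Proof.
move=> hu ha hb.
have b0 : 3 * eta < cmod b.
  have := cmod_lower u (b - u); rewrite addrCA subrr addr0 (cmodB b u); move: hu hb; clear; lra.
have eta0 : 0 < eta by apply: le_lt_trans ha; exact: cmod_ge0.
have bn : b != 0 by rewrite -cmod_gt0; apply: lt_trans b0; rewrite mulr_gt0.
have -> : a / b - 1 = (a - b) / b by field.
rewrite cmodM cmodV ltr_pdivrMr ?cmod_gt0// mul1r; apply: le_lt_trans b0.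
have := cmodD (a - u) (u - b); rewrite addrA subrK (cmodB a u); move: ha hb eta0; clear; lra.
Qed.

(** On a compact square compactness provides a common neighbourhood of the dilation factor 1; for
    |w| > |M| both values are within 1/5 of 1 and [ratio_bound] applies. The condition is void below
    [rho], which allows the compact set to be a full square. *)
Lemma small_dilation (g : R[i] -> R[i]) (rho0 rho : R) :
  0 < rho0 -> rho0 < rho -> (forall w, rho0 < cmod w -> cdiff g w) -> (forall w, rho0 < cmod w -> g w != 0) ->
  lim_oo g 1 ->
  exists2 lam : R, 1 < lam & forall w, rho <= cmod w -> cmod (g w / g (lam%:C * w) - 1) < 1.
Proof.
move=> rho00 rr cg gn0 ginf.
have e5 : 0 < (1 / 5 : R) by rewrite divr_gt0.
have [M hM] := ginf _ e5.
pose toC (p : R * R) : R[i] := p.1 +i* p.2.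
have toCB p p' : cmod (toC p - toC p') <= 2 * `|p - p'|.
  apply: le_trans (cmod_ReIm _) _; rewrite /= mulr_natl mulr2n; apply: lerD.
    by rewrite prod_normE/= le_max lexx.
  by rewrite prod_normE/= le_max lexx orbT.
pose K : set (R * R) := `[- `|M|, `|M|] `*` `[- `|M|, `|M|].
have cK : compact K by apply: compact_setX; exact: segment_compact.
pose P (lam : R) (p : R * R) := rho <= cmod (toC p) -> cmod (g (toC p) / g (lam%:C * toC p) - 1) < 1.
have : \forall lam \near nbhs (1 : R), K `<=` P lam.
  move/compact_near_coveringP : cK; apply => p _.
  set w := toC p.
  have [wr|wr] := ltP (cmod w) rho.
    pose d := (rho - cmod w) / 2.
    have d0 : 0 < d by rewrite divr_gt0// subr_gt0.
    exists ([set p' | `|p - p'| < d], setT); first split => /=.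
    - apply/nbhs_ballP; exists d => // p' [h1 h2] /=.
      by rewrite prod_normE/= gt_max h1 h2.
    - exact: filterT.
    - move=> [p' lam] [/= h _]; rewrite /P /= => h2.
      have := toCB p' p; rewrite -normrN opprB => h3.
      have := cmodD (toC p' - w) w; rewrite subrK.
      by move: h h2 h3 wr; rewrite /d -/w; clear; lra.
  have w0 : rho0 < cmod w by exact: lt_le_trans wr.
  pose eta := cmod (g w) / 4.
  have eta0 : 0 < eta by rewrite divr_gt0// cmod_gt0 gn0.
  have cgw := cdiff_cont (cg _ w0).
  have FF : Filter (nbhs w) by exact: nbhs_filter.
  have [del del0 hdel] := (nbhs_cmP _ _).1 ((@cvg_cmP _ _ (nbhs w) FF g (g w)).1 cgw _ eta0).
  pose d1 := del / 4.
  have d10 : 0 < d1 by rewrite divr_gt0.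
  pose d2 := d1 / (cmod w + del).
  have wd : 0 < cmod w + del by rewrite ltr_wpDl ?cmod_ge0.
  have d20 : 0 < d2 by rewrite divr_gt0.
  exists ([set p' | `|p - p'| < d1], [set lam : R | `|1 - lam| < d2]); first split => /=.
  - apply/nbhs_ballP; exists d1 => // p' [h1 h2] /=.
    by rewrite prod_normE/= gt_max h1 h2.
  - by apply/nbhs_ballP; exists d2.
  - move=> [p' lam] [/= h1 h2]; rewrite /P /= => _.
    have k1 : cmod (w - toC p') < del / 2.
      by have := toCB p p'; move: h1; rewrite /d1 -/w; clear; lra.
    have k2 : cmod (w - lam%:C * toC p') < del.
      have -> : w - lam%:C * toC p' = (w - toC p') + (1 - lam)%:C * toC p'.
        by rewrite rmorphB rmorph1; ring.
      apply: le_lt_trans (cmodD _ _) _; rewrite (splitr del) ltr_leD// cmodM cmod_real.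
      have k3 : cmod (toC p') <= cmod w + del.
        have := cmodD w (toC p' - w); rewrite addrCA subrr addr0 (cmodB (toC p') w).
        by move: k1 del0; clear; lra.
      apply: (@le_trans _ _ (d2 * (cmod w + del))).
        by apply: ler_pM => //; [exact: cmod_ge0|exact: ltW].
      by rewrite /d2 divfK ?gt_eqF// /d1; move: del0; clear; lra.
    apply: (@ratio_bound (g w) _ _ eta); first by rewrite /eta mulrC divfK.
      by apply: hdel; move: k1 del0; clear; lra.
    exact: hdel.
move=> /nbhs_ballP[e /= e0 he].
exists (1 + e / 2); first by rewrite ltrDl divr_gt0.
move=> w wr; have [wM|wM] := leP (cmod w) `|M|.
  have : P (1 + e / 2) (complex.Re w, complex.Im w).
    apply: he.
      by rewrite /ball/= opprD addrA subrr add0r normrN gtr0_norm ?divr_gt0// gtr_pMr// invf_lt1// (ltr_nat _ 1 2).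
    by split; rewrite /= in_itv/= -ler_norml; [exact: le_trans (Re_cm w) wM|exact: le_trans (Im_cm w) wM].
  by rewrite /P /toC /=; case: w {wM} wr => a b /= wr; exact.
have Mw : M < cmod w by apply: le_lt_trans wM; exact: ler_norm.
have l1 : 1 <= 1 + e / 2 by rewrite lerDl divr_ge0// ltW.
have Mw2 : M < cmod ((1 + e / 2)%:C * w).
  rewrite cmodM cmod_real ger0_norm; last exact: le_trans l1.
  by apply: lt_le_trans Mw _; rewrite ler_peMl// cmod_ge0.
apply: (@ratio_bound 1 _ _ (1 / 5)); first by rewrite cmod1; lra.
  by rewrite cmodB; exact: hM.
by rewrite cmodB; exact: hM.
Qed.

(* Near infinity take the principal root; if lam is close to 1, then g(w)/g(lam w) has a
   principal root as well, which carries a root on |w| > r to one on |w| > r/lam. *)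
Lemma sqrt_exists (g : R[i] -> R[i]) (rho0 rho : R) :
  0 < rho0 -> rho0 < rho -> (forall w, rho0 < cmod w -> cdiff g w) -> (forall w, rho0 < cmod w -> g w != 0) ->
  lim_oo g 1 ->
  exists E, (forall w, rho < cmod w -> cdiff E w /\ E w ^+ 2 = g w) /\ lim_oo E 1.
Proof.
move=> rho00 rr cg gn0 ginf.
have [lam lam1 hlam] := small_dilation rho00 rr cg gn0 ginf.
have lam0 : 0 < lam by exact: lt_trans lam1.
have cl : cmod lam%:C = lam by rewrite cmod_real gtr0_norm.
have [M0 hM0] := ginf _ ltr01.
pose M := Num.max 1 M0.
have M1 : 0 < M by rewrite lt_max ltr01.
have ind n : exists E, (forall w, rho < cmod w -> M / lam ^+ n < cmod w -> cdiff E w /\ E w ^+ 2 = g w) /\ lim_oo E 1.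
  elim: n => [|n [E [hE Einf]]].
    exists (fun w => psqrt (g w)); split; last exact: lim_oo_psq.
    move=> w wr; rewrite expr0 divr1 => Mw; split; last exact: psqrt_sq.
    apply: cdiff_psq; first by apply: cg; exact: lt_trans wr.
    apply: Re1_gt0; apply: hM0; apply: le_lt_trans Mw; by rewrite le_max lexx orbT.
  exists (fun w => psqrt (g w * (g (lam%:C * w))^-1) * E (lam%:C * w)); split.
    move=> w wr Mw; have w0 : rho0 < cmod w by exact: lt_trans wr.
    have cw : cmod w <= cmod (lam%:C * w) by rewrite cmodM cl ler_peMl ?cmod_ge0// ltW.
    have wr' : rho < cmod (lam%:C * w) by exact: lt_le_trans cw.
    have w0' : rho0 < cmod (lam%:C * w) by exact: lt_le_trans cw.
    have [|cE E2] := hE _ wr'.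
      by rewrite cmodM cl -ltr_pdivrMl//; move: Mw; rewrite exprS invfM mulrCA.
    split.
      apply: cdiffM; last exact: cdiff_scale.
      apply: cdiff_psq; last by apply: Re1_gt0; apply: hlam; exact: ltW.
      apply: cdiffM; first exact: cg.
      apply: cdiffV; first exact: gn0.
      by apply: cdiff_scale; exact: cg.
    by rewrite exprMn psqrt_sq E2 divfK// gn0.
  apply: lim_oo1M; last by apply: lim_oo_scale => //; rewrite cl ltW.
  apply: lim_oo_psq; apply: lim_oo1M => //; apply: lim_oo1V.
  by apply: lim_oo_scale => //; rewrite cl ltW.
have [n hn] : exists n, M / lam ^+ n < rho.
  have : (lam^-1 ^+ n) @[n --> \oo] --> (0 : R).
    by apply: cvg_expr; rewrite gtr0_norm ?invr_gt0// invf_lt1.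
  have rho1 : 0 < rho by exact: lt_trans rr.
  move=> /cvgrPdist_lt/(_ (rho / M)); rewrite divr_gt0// => /(_ isT)[n _ /(_ n (leqnn n))].
  rewrite /= sub0r normrN gtr0_norm ?exprn_gt0 ?invr_gt0// ltr_pdivlMr// => h; exists n.
  by rewrite mulrC -exprVn.
have [E [hE Einf]] := ind n; exists E; split=> // w wr; apply: hE => //.
exact: lt_trans wr.
Qed.

Lemma cdiff_sum (I : Type) (s : seq I) (F : I -> R[i] -> R[i]) w : (forall i, cdiff (F i) w) ->
  cdiff (fun z => \sum_(i <- s) F i z) w.
Proof.
move=> cF; elim: s => [|i s IH].
  by rewrite (_ : (fun z => _) = fun=> 0); [exact: cdiff_cst|apply/funext => z; rewrite big_nil].
rewrite (_ : (fun z => _) = fun z => F i z + \sum_(j <- s) F j z); last by apply/funext => z; rewrite big_cons.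
exact: cdiffD.
Qed.

Lemma lim_oo_sum (I : Type) (s : seq I) (F : I -> R[i] -> R[i]) : (forall i, lim_oo (F i) 1) ->
  lim_oo (fun z => \sum_(i <- s) F i z) (size s)%:R.
Proof.
move=> cF; elim: s => [|i s IH].
  by move=> e e0; exists 0 => z _; rewrite big_nil subr0 cmod0.
rewrite (_ : (fun z => _) = fun z => F i z + \sum_(j <- s) F j z); last by apply/funext => z; rewrite big_cons.
by rewrite /= -natr1 addrC; exact: lim_ooD.
Qed.

Lemma cmod_sum (I : Type) (s : seq I) (F : I -> R[i]) : cmod (\sum_(i <- s) F i) <= \sum_(i <- s) cmod (F i).
Proof.
elim: s => [|i s IH]; first by rewrite !big_nil cmod0.
by rewrite !big_cons; apply: le_trans (cmodD _ _) _; rewrite lerD2l.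
Qed.
End SquareRoot.

(** * Sums over evenly spaced points *)

Section Spread.
Context {R : rcfType}.
Implicit Types (x h d M : R).

(** Induction by 1 / sqrt(n+1) <= 2 (sqrt(n+1) - sqrt n). *)
Lemma sum_inv_sqrt n : \sum_(1 <= i < n.+1) (Num.sqrt (i%:R : R))^-1 <= 2 * Num.sqrt n%:R.
Proof.
elim: n => [|n IH]; first by rewrite big_nil sqrtr0 mulr0.
rewrite big_nat_recr//=; apply: le_trans (lerD IH (lexx _)) _.
set a : R := Num.sqrt n%:R; set b : R := Num.sqrt n.+1%:R.
have a0 : 0 <= a by exact: sqrtr_ge0.
have b0 : 0 < b by rewrite sqrtr_gt0.
have ab : a <= b by rewrite ler_wsqrtr// ler_nat.
have e : b ^+ 2 = a ^+ 2 + 1 by rewrite !sqr_sqrtr// natr1.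
have : b^-1 * (2 * b * (b - a)) >= b^-1 * 1.
  rewrite ler_pM2l ?invr_gt0//.
  have h : b ^+ 2 - a ^+ 2 = (b - a) * (b + a) by rewrite subr_sqr.
  have h2 : (b - a) * (b + a) <= (b - a) * (2 * b) by rewrite ler_wpM2l ?subr_ge0//; lra.
  by move: h h2; rewrite e; lra.
have -> : b^-1 * (2 * b * (b - a)) = 2 * (b - a) by field; rewrite gt_eqF.
by rewrite mulr1; lra.
Qed.

(** The grid is split at [x]. On either side the i-th nearest grid point, counted from 0, has
    distance at least i h from [x]; the two sides account for the factor 2. *)
Lemma spread_sum (b : nat -> R) (phi : R -> R) x h n : 0 < h ->
  (forall i t, i%:R * h <= `|t| -> phi t <= b i) -> (forall i, 0 <= b i) ->
  \sum_(0 <= j < n) phi (x - j.+1%:R * h) <= 2 * \sum_(0 <= i < n) b i.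
Proof.
move=> h0 hb b0.
have [m [mn hm1 hm2]] : exists m, [/\ (m <= n)%N, forall j, (j < m)%N -> j.+1%:R * h <= x &
    forall j, (m <= j)%N -> (j < n)%N -> x <= j.+1%:R * h].
  elim: n => [|n [m [mn h1 h2]]]; first by exists 0%N; split.
  have [nx|xn] := leP (n.+1%:R * h) x; last first.
    exists m; split; [exact: leqW|exact: h1|move=> j mj].
    by rewrite ltnS leq_eqVlt => /orP[/eqP ->|jn]; [exact: ltW|exact: h2].
  exists n.+1; split=> // [j jn|j nj]; last by rewrite ltnNge nj.
  apply: le_trans nx; rewrite ler_pM2r// ler_nat; exact: jn.
rewrite (big_cat_nat (leq0n m) mn)/= mulr_natl mulr2n; apply: lerD.
  apply: (@le_trans _ _ (\sum_(0 <= i < m) b i)); last first.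
    by rewrite [leRHS](big_cat_nat (leq0n m) mn)/= lerDl sumr_ge0.
  rewrite big_nat_rev/= big_nat_cond [leRHS]big_nat_cond; apply: ler_sum => i; rewrite andbT => /andP[_ im].
  apply: hb; rewrite add0n -subSn// subSS.
  have m0 : (0 < m)%N by exact: leq_ltn_trans im.
  have := hm1 m.-1; rewrite prednK// => /(_ (leqnn _)) hx.
  apply: le_trans (ler_norm _); rewrite natrB ?(ltnW im)// mulrBl; lra.
have := @big_addn _ _ _ 0 n m predT (fun j => phi (x - j.+1%:R * h)); rewrite add0n => ->.
apply: (@le_trans _ _ (\sum_(0 <= i < n - m) b i)); last first.
  by rewrite [leRHS](big_cat_nat (leq0n _) (leq_subr m n))/= lerDl sumr_ge0.
rewrite big_nat_cond [leRHS]big_nat_cond; apply: ler_sum => i; rewrite andbT => /andP[_ im].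
apply: hb; have mn' : (m < n)%N by rewrite -subn_gt0; exact: leq_ltn_trans im.
have hx := hm2 m (leqnn _) mn'.
rewrite -normrN; apply: le_trans (ler_norm _); move: hx; rewrite -addSn -!natr1 natrD.
lra.
Qed.
End Spread.

(** * The diameter bound *)

Section Diameter.
Context {R : realType}.
Implicit Types (q : R[i] -> R[i]) (z w : R[i]) (x y e : R).

(** The difference quotient, completed at [w] by its limit, is Caratheodory's factor. *)
Lemma derivable_cd q w : derivable q w 1 -> cdiff q w.
Proof.
move=> /cvg_ex[/= l hl].
have FF : Filter (nbhs w) by exact: nbhs_filter.
pose h z := if z == w then l else (q z - q w) / (z - w).
exists h; split; last first.
  apply: nearW => z; rewrite /h; have [->|zw] := eqVneq z w; first by rewrite !subrr mulr0.
  by rewrite divfK// subr_eq0.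
have hw : h w = l by rewrite /h eqxx.
apply: (@cvg_cmP _ _ (nbhs w) FF h (h w)).2 => e e0; rewrite hw.
have F0 : Filter (0 : R[i])^' by exact: dnbhs_filter.
have := (@cvg_cmP _ _ _ F0 _ l).1 hl e e0.
rewrite near_withinE => /(nbhs_cmP _ _).1[d d0 hd].
apply/nbhs_cmP; exists d => // z zd.
have [zw|zw] := eqVneq z w; first by rewrite zw hw subrr cmod0.
have zw0 : z - w != 0 by rewrite subr_eq0.
have := hd (z - w); rewrite sub0r cmodN cmodB => /(_ zd zw0).
by rewrite /h (negbTE zw) /GRing.scale/= mulr1 subrK mulrC.
Qed.

Definition toC (p : R * R) : R[i] := p.1 +i* p.2.
Lemma toCK p : plane_of_C (toC p) = p. Proof. by case: p. Qed.
Lemma plane_of_CK z : toC (plane_of_C z) = z. Proof. by case: z. Qed.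
Lemma toC_norm (p p' : R * R) : cmod (toC p - toC p') <= 2 * `|p - p'|.
Proof.
apply: le_trans (cmod_ReIm _) _; rewrite /= mulr_natl mulr2n; apply: lerD.
  by rewrite prod_normE/= le_max lexx.
by rewrite prod_normE/= le_max lexx orbT.
Qed.
Lemma norm_toC (p p' : R * R) : `|p - p'| <= cmod (toC p - toC p').
Proof.
rewrite prod_normE/= ge_max; apply/andP; split.
  exact: (Re_cm (toC p - toC p')).
exact: (Im_cm (toC p - toC p')).
Qed.
Lemma near_norm (p : R * R) e : 0 < e -> \forall p' \near nbhs p, `|p - p'| < e.
Proof.
move=> e0; apply/nbhs_ballP; exists e => // p' [h1 h2] /=.
by rewrite prod_normE/= gt_max h1 h2.
Qed.

Variables (D : set (R * R)) (Phi : R[i] -> R[i]).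
Hypothesis hPhi : exterior_conformal_map D Phi.
Hypothesis cD : connected D.

Let cdiffPhi w : 1 < cmod w -> cdiff Phi w.
Proof. by case: hPhi => _ h _ _ w1; apply: derivable_cd; apply: h; exact/exterior_cm. Qed.

Let Phi_out w : 1 < cmod w -> ~ closure D (plane_of_C (Phi w)).
Proof. by case: hPhi => -[fu _ _] _ _ _ w1; apply: fu; exact/exterior_cm. Qed.

Let Phi_neq w z : 1 < cmod w -> D (plane_of_C z) -> Phi w - z != 0.
Proof.
move=> w1 Dz; rewrite subr_eq0; apply/negP => /eqP h; apply: (Phi_out w1).
by rewrite h; exact: subset_closure.
Qed.

(** w / (Phi w - z) is holomorphic without zeros for |w| > 1 and tends to 1 since Phi(w) / w does.
    The radius 3/2 leaves room between the unit disk and the later contour max(|x|, |y|) = 2. *)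
Lemma root_of_inverse z : D (plane_of_C z) ->
  exists E, (forall w, 3 / 2 < cmod w -> cdiff E w /\ E w ^+ 2 = w * (Phi w - z)^-1) /\ lim_oo E 1.
Proof.
move=> Dz; apply: (@sqrt_exists _ _ 1) => //; first by lra.
- move=> w w1; apply: cdiffM; first exact: cdiff_id.
  apply: cdiffV; first exact: Phi_neq.
  exact: (cdiffD (q := Phi) (r := fun=> - z) (cdiffPhi w1) (cdiff_cst (- z) w)).
- move=> w w1; rewrite mulf_neq0 ?invr_eq0 ?Phi_neq//.
  by rewrite -cmod_gt0; exact: lt_trans w1.
- have [_ _ _ lim1] := hPhi.
  have FF : Filter (infty_nbhs R[i]).
    apply: filter_from_filter; first by exists 1; exact: ltr01.
    move=> a b /= a0 b0; exists (a + b); first by exact: addr_gt0.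
    move=> v /= h; split; apply: le_lt_trans h; rewrite ?lerDl ?lerDr; exact: ltW.
  have l1 : lim_oo (fun w => (Phi w - z) * w^-1) 1.
    move=> e e0; have e2 : 0 < e / 2 by rewrite divr_gt0.
    have /infty_cmP[M M0 hM] := (@cvg_cmP _ _ _ FF _ _).1 lim1 _ e2.
    exists (Num.max M (2 * (cmod z + 1) / e)) => w; rewrite gt_max => /andP[wM wz].
    have w0 : 0 < cmod w by exact: lt_trans wM.
    rewrite mulrBl -addrA [- _ - _]addrC addrA.
    apply: le_lt_trans (cmodD _ _) _; rewrite (splitr e) ltrD//.
      by rewrite cmodB; exact: hM.
    rewrite cmodN cmodM cmodV ltr_pdivrMr//.
    move: wz; rewrite ltr_pdivrMr// => h.
    have -> : e / 2 * cmod w = cmod w * e / 2 by ring.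
    by rewrite ltr_pdivlMr//; move: h; lra.
  rewrite (_ : (fun w => w / (Phi w - z)) = (fun w => ((Phi w - z) * w^-1)^-1)); first exact: lim_oo1V.
  by apply/funext => w; rewrite invfM invrK mulrC.
Qed.

Lemma spheres_met (z0 p : R[i]) x : D (plane_of_C z0) -> D (plane_of_C p) -> 0 <= x <= cmod (p - z0) ->
  exists2 z, D (plane_of_C z) & cmod (z - z0) = x.
Proof.
move=> D0 Dp hx.
pose F (v : R * R) := cmod (toC v - z0).
have cF : continuous F.
  move=> v; apply/cvgrPdist_lt => /= e e0.
  have e2 : 0 < e / 2 by rewrite divr_gt0.
  apply: filterS (near_norm v e2) => v' h.
  have h1 := toC_norm v v'.
  have h2 := cmodD (toC v - toC v') (toC v' - z0); rewrite addrA subrK in h2.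
  have h3 := cmodD (toC v' - toC v) (toC v - z0); rewrite addrA subrK cmodB in h3.
  rewrite ltr_norml /F; move: h h1 h2 h3 => h h1 h2 h3.
  by apply/andP; split; lra.
have : is_interval [set F v | v in D].
  apply/connected_intervalP; apply: connected_continuous_connected => //.
  exact: continuous_subspaceT.
move=> /(_ 0 (cmod (p - z0))).
have i0 : [set F v | v in D] 0.
  by exists (plane_of_C z0) => //; rewrite /F plane_of_CK subrr cmod0.
have ip : [set F v | v in D] (cmod (p - z0)).
  by exists (plane_of_C p) => //; rewrite /F plane_of_CK.
move=> /(_ i0 ip x hx)[v Dv Fv]; exists (toC v) => //; by rewrite toCK.
Qed.

(** Compactness: near each point of the contour the image stays away from the closure of D. The
    predicate [P] is void inside the square, so the compact set may be the full square. The value of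
    [d] depends on D and [Phi]. *)
Lemma square_distance : exists2 d, 0 < d & forall w z, Num.max `|complex.Re w| `|complex.Im w| = 2 ->
  D (plane_of_C z) -> d <= cmod (Phi w - z).
Proof.
pose K : set (R * R) := `[- 2, 2] `*` `[- 2, 2].
have cK : compact K by apply: compact_setX; exact: segment_compact.
pose P (d : R) (p : R * R) := 2 <= Num.max `|p.1| `|p.2| -> forall z, D (plane_of_C z) -> d <= cmod (Phi (toC p) - z).
have : \forall d \near (0 : R)^'+, K `<=` P d.
  move/compact_near_coveringP : cK; apply => p _.
  have [pl|pg] := ltP (Num.max `|p.1| `|p.2|) 2.
    have d0 : 0 < 2 - `|p| by rewrite subr_gt0 prod_normE.
    exists ([set p' | `|p - p'| < 2 - `|p|], setT); first split => /=.
    - exact: near_norm.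
    - exact: filterT.
    - move=> [p' d] [/= h _]; rewrite /P -[Num.max _ _]/(`|p'|) => h2; exfalso.
      have := ler_normB p (p - p'); rewrite opprB addrC subrK.
      by move: h h2; lra.
  have w1 : 1 < cmod (toC p) by apply: lt_le_trans (max_cm p.1 p.2); apply: lt_le_trans pg; lra.
  have : nbhs (plane_of_C (Phi (toC p))) (~` closure D).
    by apply: open_nbhs_nbhs; split; [apply: closed_openC; exact: closed_closure|exact: Phi_out].
  move=> /nbhs_ballP[r /= r0 hr].
  have FF : Filter (nbhs (toC p)) by exact: nbhs_filter.
  have r2 : 0 < r / 2 by rewrite divr_gt0.
  have := (@cvg_cmP _ _ (nbhs (toC p)) FF Phi _).1 (cdiff_cont (cdiffPhi w1)) _ r2.
  move=> /(nbhs_cmP _ _).1[e e0 he].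
  have e2 : 0 < e / 2 by rewrite divr_gt0.
  exists ([set p' | `|p - p'| < e / 2], [set d : R | d < r / 2]); first split => /=.
  - exact: near_norm.
  - exact: nbhs_right_lt.
  - move=> [p' d] [/= h1 h2]; rewrite /P => _ z Dz.
    have h3 : cmod (Phi (toC p) - Phi (toC p')) < r / 2.
      by apply: he; have := toC_norm p p'; move: h1; lra.
    have h4 : r <= cmod (Phi (toC p) - z).
      rewrite leNgt; apply/negP => h.
      suff : (~` closure D) (plane_of_C z) by apply; exact: subset_closure.
      apply: hr; have := norm_toC (plane_of_C (Phi (toC p))) (plane_of_C z).
      rewrite !plane_of_CK => h5; have := le_lt_trans h5 h.
      by rewrite prod_normE/= gt_max => /andP[].
    have := cmodD (Phi (toC p) - Phi (toC p')) (Phi (toC p') - z); rewrite addrA subrK.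
    by move: h2 h3 h4; lra.
move=> hK.
near (0 : R)^'+ => d.
have hd : K `<=` P d by near: d.
have d0 : 0 < d by near: d; exact: nbhs_right_gt.
exists d => // w z wm Dz.
have := hd (plane_of_C w); rewrite /P plane_of_CK; apply => //; last by rewrite wm.
rewrite /K /= !in_itv/= -!ler_norml; split; rewrite -wm le_max lexx ?orbT//.
Unshelve. all: by end_near.
Qed.

(* Along a circle |Phi - z_j| >= ||Phi - z0| - r_j| for points z_j of D at evenly spaced
   distances r_j from z0, and r |-> r^(-1/2) is integrable: the average of the roots E_j of
   w / (Phi - z_j) would be small if D were long, although its mean value is 1. *)
Lemma diameter_bound (z0 p : R[i]) : D (plane_of_C z0) -> D (plane_of_C p) -> cmod (p - z0) <= 1024.
Proof.
move=> D0 Dp; rewrite leNgt; apply/negP => Mbig; set M := cmod (p - z0) in Mbig.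
have M0 : 0 < M by apply: lt_trans Mbig; rewrite ltr0n.
have [d d0 hd] := square_distance.
have sM : 32 < Num.sqrt M.
  have -> : 32 = Num.sqrt (32 ^+ 2) :> R by rewrite sqrtr_sqr ger0_norm.
  rewrite ltr_sqrt//; apply: le_lt_trans Mbig; rewrite -natrX ler_nat//.
have sM0 : 0 < Num.sqrt M by rewrite sqrtr_gt0.
have sd0 : 0 < Num.sqrt d by rewrite sqrtr_gt0.
(* 1024 = 32^2, so 8 / sqrt M < 1/4; this is the share of all but the nearest points. The choice of
   [n] fits the share of the nearest ones, 4 / (n sqrt d), into the remaining gap. *)
have c0 : 0 < 1 / 4 - 8 / Num.sqrt M.
  rewrite subr_gt0 ltr_pdivrMr//; move: sM; lra.
pose n := (Num.Def.archi_bound ((4 / Num.sqrt d) / (1 / 4 - 8 / Num.sqrt M))).+1.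
have n0 : (0 : R) < n%:R by rewrite ltr0n.
have hn : 4 / Num.sqrt d < n%:R * (1 / 4 - 8 / Num.sqrt M).
  rewrite -ltr_pdivrMr//; apply: lt_le_trans (archi_boundP _) _; last by rewrite ler_nat.
  by rewrite !divr_ge0// ltW.
pose h := M / n%:R; have h0 : 0 < h by rewrite divr_gt0.
have hz (j : nat) : exists z, (j < n)%N -> D (plane_of_C z) /\ cmod (z - z0) = j.+1%:R * h.
  have [jn|nj] := ltnP j n; last by exists 0.
  have [|z Dz cz] := @spheres_met z0 p (j.+1%:R * h) D0 Dp.
    rewrite mulr_ge0 ?(ltW h0)//= /h -/M mulrCA ler_piMr ?(ltW M0)// ler_pdivrMr// mul1r ler_nat//.
  by exists z.
have [Z hZ] := choice hz.
have hE (j : nat) : exists E, (j < n)%N -> (forall w, 3 / 2 < cmod w -> cdiff E w /\ E w ^+ 2 = w * (Phi w - Z j)^-1) /\ lim_oo E 1.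
  have [jn|nj] := ltnP j n; last by exists id.
  have [Dz _] := hZ j jn; have [E HE] := root_of_inverse Dz; by exists E.
have [E HE] := choice hE.
pose H w := n%:R^-1 * \sum_(j < n) E j w.
have cdH x y : 2 <= Num.max `|x| `|y| -> cdiff H (x +i* y).
  move=> h2; apply: cdiffM; first exact: cdiff_cst.
  apply: cdiff_sum => j; have [+ _] := HE j (ltn_ord j).
  move=> /(_ (x +i* y))[]//.
  by apply: lt_le_trans (max_cm x y); apply: lt_le_trans h2; lra.
have limH : lim_oo H 1.
  have := lim_ooZ (n%:R^-1) (lim_oo_sum (index_enum 'I_n) (F := fun j => E j) (fun j => (HE j (ltn_ord j)).2)).
  rewrite (_ : n%:R^-1 * _ = 1)//.
  have -> : size (index_enum 'I_n) = n by rewrite -sum1_size big_const_ord iter_addn_0 mul1n.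
  by rewrite mulVf// pnatr_eq0.
(* The bound for the root at the i-th nearest distance: |E_j|^2 = |w| / |Phi w - z_j| with |w| <= 4
   and denominator at least i h; for i = 0 only the distance [d] is at hand. *)
pose b (i : nat) : R := if i is k.+1 then 2 / Num.sqrt h * (Num.sqrt k.+1%:R)^-1 else 2 / Num.sqrt d.
pose phi (t : R) : R := 2 / Num.sqrt (Num.max d `|t|).
have sh0 : 0 < Num.sqrt h by rewrite sqrtr_gt0.
have hb i t : i%:R * h <= `|t| -> phi t <= b i.
  move=> ht; rewrite /phi /b; case: i ht => [_|i ht].
    rewrite ler_pM2l// lef_pV2 ?posrE ?sqrtr_gt0 ?lt_max ?d0//.
    by rewrite ler_wsqrtr// le_max lexx.
  have hi0 : 0 < h * i.+1%:R by apply: mulr_gt0.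
  rewrite -mulrA -invfM -sqrtrM ?(ltW h0)// ler_pM2l// lef_pV2 ?posrE ?sqrtr_gt0 ?lt_max ?d0//.
  by rewrite ler_wsqrtr// mulrC (le_trans ht)// le_max lexx orbT.
have b0 i : 0 <= b i.
  by rewrite /b; case: i => [|i]; rewrite ?mulr_ge0 ?invr_ge0 ?sqrtr_ge0.
have sb : \sum_(0 <= i < n) b i <= 2 / Num.sqrt d + 4 * (n%:R / Num.sqrt M).
  rewrite big_nat_recl//= lerD2l.
  rewrite -big_distrr/= -(big_add1 _ _ 0 n (fun _ => true) (fun i => (Num.sqrt i%:R)^-1)).
  have h1 := sum_inv_sqrt (R := R) n.-1; rewrite prednK// in h1.
  apply: (@le_trans _ _ (2 / Num.sqrt h * (2 * Num.sqrt n%:R))).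
    rewrite ler_wpM2l ?divr_ge0 ?sqrtr_ge0//; apply: le_trans h1 _.
    by rewrite ler_pM2l// ler_wsqrtr// ler_nat leq_pred.
  have -> : Num.sqrt h = Num.sqrt M / Num.sqrt n%:R.
    by rewrite /h sqrtrM ?(ltW M0)// sqrtrV// ltW.
  have sn0 : 0 < Num.sqrt (n%:R : R) by rewrite sqrtr_gt0.
  have e1 : (n%:R : R) = Num.sqrt n%:R ^+ 2 by rewrite sqr_sqrtr// ltW.
  rewrite [in leRHS]e1 le_eqVlt; apply/orP; left; apply/eqP.
  by field; rewrite !gt_eqF.
pose B := n%:R^-1 * (2 * (2 / Num.sqrt d + 4 * (n%:R / Num.sqrt M))).
have HB x y : Num.max `|x| `|y| = 2 -> cmod (H (x +i* y)) <= B.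
  move=> m2; rewrite /H cmodM cmodV; have -> : cmod (n%:R : R[i]) = n%:R.
    by rewrite -[n%:R]/((n%:R : R[i])) -(rmorph_nat (real_complex R)) cmod_real ger0_norm ?ltW.
  rewrite /B ler_pM2l ?invr_gt0//; apply: le_trans (cmod_sum _ _) _.
  apply: (@le_trans _ _ (2 * \sum_(0 <= i < n) b i)); last by rewrite ler_pM2l.
  apply: le_trans (spread_sum (cmod (Phi (x +i* y) - z0)) n h0 hb b0).
  rewrite big_mkord; apply: ler_sum => j _.
  have [Dz cz] := hZ j (ltn_ord j).
  have w32 : 3 / 2 < cmod (x +i* y) by apply: lt_le_trans (max_cm x y); rewrite m2; lra.
  have [+ _] := HE j (ltn_ord j); move=> /(_ _ w32)[_ E2].
  have dj : Num.max d `|cmod (Phi (x +i* y) - z0) - j.+1%:R * h| <= cmod (Phi (x +i* y) - Z j).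
    rewrite ge_max; apply/andP; split; first exact: hd.
    rewrite -cz; have k1 := cmodD (Phi (x +i* y) - Z j) (Z j - z0); rewrite addrA subrK in k1.
    have k2 := cmodD (Z j - Phi (x +i* y)) (Phi (x +i* y) - z0); rewrite addrA subrK cmodB in k2.
    by rewrite ler_norml; apply/andP; split; move: k1 k2; lra.
  rewrite /phi; set m := Num.max d _ in dj *.
  have m0 : 0 < m by rewrite /m lt_max d0.
  rewrite -[leLHS]ger0_norm ?cmod_ge0// -sqrtr_sqr -cmodX E2 cmodM cmodV.
  have -> : 2 / Num.sqrt m = Num.sqrt (4 / m).
    rewrite sqrtrM// sqrtrV ?(ltW m0)//; congr (_ / _).
    have -> : (4 : R) = 2 ^+ 2 by ring.
    by rewrite sqrtr_sqr ger0_norm.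
  rewrite ler_wsqrtr//; apply: ler_pM; rewrite ?invr_ge0 ?cmod_ge0//.
    apply: le_trans (cmod_ReIm _) _ => /=.
    have : `|x| <= 2 by rewrite -m2 le_max lexx.
    have : `|y| <= 2 by rewrite -m2 le_max lexx orbT.
    by lra.
  by rewrite lef_pV2 ?posrE//; exact: lt_le_trans dj.
have := square_mean (_ : 0 < 2) cdH limH HB; move=> /(_ (ltr0n _ _)).
rewrite /B leNgt => /negP; apply.
rewrite mulrC ltr_pdivrMr//; move: hn; rewrite mulrBr.
have -> : n%:R * (8 / Num.sqrt M) = 8 * (n%:R / Num.sqrt M) by rewrite mulrCA.
have -> : 4 / Num.sqrt d = 2 * (2 / Num.sqrt d) by ring.
by move: (_ / Num.sqrt d) (_ / Num.sqrt M) => t1 t2; lra.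
Qed.
End Diameter.

(** * Localization of the shape *)

Section Localization.
Context {R : realType}.
Implicit Types (l eps t : R) (D : set (R * R)).

Lemma expiX t n : (expi t : R[i]) ^+ n = expi (n%:R * t).
Proof.
elim: n => [|n IH]; first by rewrite expr0 mul0r /expi cos0 sin0.
rewrite exprS IH -natr1 mulrDl mul1r addrC /expi cosD sinD.
by apply: eqC_ReIm; rewrite ?ReM ?ImM /=; ring.
Qed.

Lemma Re_term (a : nat -> R) t n :
  complex.Re ((a n)%:C * (expi t : R[i]) ^- n) = a n * cos (n%:R * t).
Proof.
rewrite ReM /= mul0r subr0 expiX; congr (_ * _).
by rewrite invC_ReIm /= cos2Dsin2 divr1.
Qed.

Lemma trace_Re (a : nat -> R) (f : R[i] -> R[i]) t : negative_power_series a f ->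
  \sum_(1 <= n < N.+1) a n * cos (n%:R * t) @[N --> \oo] --> complex.Re (f (expi t)).
Proof.
move=> hf; have /cvg_ReIm[h _] := hf _ (circle_expi t).
have h1 : (fun N => complex.Re (\sum_(1 <= n < N) (a n)%:C * (expi t : R[i]) ^- n)) N.+1 @[N --> \oo] -->
    complex.Re (f (expi t)).
  by have := h; rewrite -cvg_shiftS.
apply: cvg_trans h1; apply: near_eq_cvg; apply: nearW => N /=.
elim: N.+1 => [|n IH]; first by rewrite !big_geq.
case: n IH => [|n IH]; first by rewrite !big_geq.
by rewrite !(big_nat_recr n.+1)//= raddfD /= IH Re_term.
Qed.

(** The diameter bound reaches boundary points at the price of 1, as these are limits of points of
    D; where Re f <= 0 or Re f >= 0 the boundary point has first coordinate at most 1 or at least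
    -1. So 1026 = 1024 + 1 + 1. *)
Lemma shape_box eps D : 0 < eps -> connected D -> open D -> normalized_shape eps D ->
  forall p q, D p -> D q -> `|p.1| <= 1026 /\ `|p - q| <= 1024.
Proof.
move=> e0 cD oD [Phi [f [a [k [al [hPhi _ hf _ hbd]]]]]].
have diam p q : D p -> D q -> `|p - q| <= 1024.
  move=> Dp Dq; have := diameter_bound hPhi cD (z0 := toC q) (p := toC p).
  by rewrite !toCK => /(_ Dq Dp); apply: le_trans; exact: norm_toC.
move=> p q Dp Dq; split; last exact: diam.
have bd t : closure D (plane_of_C (expi t + eps%:C * f (expi t))).
  have [+ _] : boundary D (plane_of_C (expi t + eps%:C * f (expi t))).
    by rewrite -hbd; exists (expi t) => //; exact: circle_expi.
  exact.
have bound t : `|p.1 - (cos t + eps * complex.Re (f (expi t)))| <= 1025.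
  have : nbhs (plane_of_C (expi t + eps%:C * f (expi t))) (ball (plane_of_C (expi t + eps%:C * f (expi t))) (1 : R)).
    exact: nbhsx_ballx.
  move=> /(bd t)[v [Dv [/= v1 _]]].
  have /(le_trans _) := diam _ _ Dp Dv.
  move=> /(_ `|p.1 - v.1|); rewrite prod_normE/= le_max lexx => /(_ isT) h.
  have e1 : complex.Re (expi t + eps%:C * f (expi t)) = cos t + eps * complex.Re (f (expi t)).
    by rewrite raddfD /= ReM /= mul0r subr0.
  rewrite e1 /ball/= in v1.
  have := ler_normD (p.1 - v.1) (v.1 - (cos t + eps * complex.Re (f (expi t)))).
  rewrite addrA subrK; move: v1; rewrite distrC => v1.
  by move: h v1; lra.
have [t1 ht1] := trig_series_sign (fun t => trace_Re (t := t) hf).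
have [t2 ht2] : exists t, - complex.Re (f (expi t)) <= 0.
  apply: (trig_series_sign (a := fun n => - a n)) => t.
  apply: (@cvg_seq_ext R _ _ _ _ (cvgN (trace_Re (t := t) hf))) => N /=.
  by rewrite -sumrN; apply: eq_bigr => n _; rewrite mulNr.
have b1 := bound t1; have b2 := bound t2.
have c1 := cos_le1 t1; have c2 := cos_geN1 t2.
have d1 : eps * complex.Re (f (expi t1)) <= 0 by rewrite pmulr_rle0.
have d2 : 0 <= eps * complex.Re (f (expi t2)) by rewrite pmulr_rge0// -oppr_le0.
move: b1 b2; rewrite !ler_norml => /andP[_ b1] /andP[b2 _].
by apply/andP; split; move: b1 b2 c1 c2 d1 d2; lra.
Qed.

Lemma I2_box_le (A : set (R * R)) (x0 y0 r : R) : open A -> bounded_set A -> 0 <= r ->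
  (forall p, A p -> `|p.1 - x0| <= r /\ `|p.2 - y0| <= r) -> I2 \1_A <= (2 * r) ^+ 2.
Proof.
move=> oA bA r0 hA.
pose V : set (R * R) := `[x0 - r, x0 + r] `*` `[y0 - r, y0 + r].
have AV : A `<=` V.
  move=> [x y] /hA /= [h1 h2]; move: h1 h2; rewrite !ler_norml => /andP[a1 a2] /andP[b1 b2].
  split; rewrite /= in_itv/=; apply/andP; clear -a1 a2 b1 b2; lra.
have mA : measurable (A : set (measurableTypeR R * measurableTypeR R)) by exact: open_measurable2.
have mV : measurable (V : set (measurableTypeR R * measurableTypeR R)).
  by apply: measurableX; exact: measurable_itv.
have AVm := le_measure (@plane_measure R) (mem_set mA) (mem_set mV) AV.
have pV : plane_measure V = ((x0 + r - (x0 - r)) * (y0 + r - (y0 - r)))%:E.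
  by apply: plane_box; clear -r0; lra.
have le : (plane_measure A <= ((x0 + r - (x0 - r)) * (y0 + r - (y0 - r)))%:E)%E by rewrite -pV; exact: AVm.
have -> : I2 \1_A = fine (plane_measure A) by rewrite /I2 /Rintegral integral_indic// setIT.
have -> : (2 * r) ^+ 2 = (x0 + r - (x0 - r)) * (y0 + r - (y0 - r)) by ring.
have ge0 : (0 <= plane_measure A)%E by exact: measure_ge0.
by move: le ge0; case: (plane_measure A) => [v| |]//=; rewrite lee_fin.
Qed.
End Localization.

(** * The two bounds on Omega *)

Section Corotating.
Context {R : realType}.
Variables (l eps Omega : R) (D : set (R * R)).
Hypotheses (e0 : 0 < eps) (adm : admissible_pair l eps D).
Let D1 := vortex_patch l eps D.
Let D2 := opp_set D1.
Hypothesis cor : corotating eps Omega D1 D2.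
Let s : R := (pi * eps ^+ 2)^-1.

Let s0 : 0 < s. Proof. by rewrite invr_gt0 mulr_gt0 ?exprn_gt0// pi_gt0. Qed.

Let oppE : D2 = [set x | D1 (- x)].
Proof.
apply/seteqP; split=> [_ [x Dx <-]|x Dx]; first by rewrite /= opprK.
by exists (- x) => //; rewrite opprK.
Qed.

Let oD2 : open D2.
Proof.
have [[oD1 _ _ _] _] := patch_shape e0 adm.
rewrite oppE; apply: (open_comp (f := fun x : R * R => - x)) => // x _.
by apply: cvgN; exact: cvg_id.
Qed.

Let bD2 : bounded_set D2.
Proof.
have [[_ bD1 _ _] _] := patch_shape e0 adm.
have [N N0 hN] := bounded_setP bD1.
exists N; split; first exact: num_real.
by move=> M NM x; rewrite oppE /= => /hN; rewrite normrN => h; rewrite ltW// (le_lt_trans h).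
Qed.

Lemma Omega_bounds : 0 < Omega <= s / 2.
Proof.
have [[oD1 bD1 cD1 [x0 Dx0]] _] := patch_shape e0 adm.
have [_ _ dis _] := adm.
have [sg sg1 hsg] := patch_half_plane e0 adm.
have [Psi [c1 [c2 [wl far cPsi bc1 bc2]]]] := cor.
have bc1' p : closure D1 p -> ~ D1 p -> Psi p = c1.
  by move=> h1 h2; apply: bc1; split=> //; rewrite ((interior_id D1).1 oD1).
have bc2' p : closure D2 p -> ~ D2 p -> Psi p = c2.
  by move=> h1 h2; apply: bc2; split=> //; rewrite ((interior_id D2).1 oD2).
have h2 y : D2 y -> sg * coor false y < 0.
  by rewrite oppE => /hsg /=; rewrite mulrN oppr_gt0.
have ne1 : D1 !=set0 by exists x0.
have ne2 : D2 !=set0 by exists (- x0); exists x0.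
apply/andP; split.
  exact: (Omega_gt0 oD1 oD2 bD1 bD2 cPsi wl far bc1' s0 hsg h2 ne1 ne2 sg1).
exact: (Omega_le oD1 oD2 bD1 bD2 cPsi wl far bc1' bc2' s0 hsg h2 ne1 ne2 dis).
Qed.

(** If |l| <= 2052 eps, the bound Omega <= s / 2 already has the order l^-2, as s (2052 eps)^2 =
    2052^2 / pi. For larger |l| the patch stays at distance at least |l| / 2 from the y-axis and has
    area at most (2048 eps)^2, so that [Omega_far] applies with L = |l|. *)
Lemma Omega_decay : l != 0 -> Omega <= 2052 ^+ 2 * l ^- 2.
Proof.
move=> l0; have l2 : 0 < l ^+ 2 by rewrite exprn_even_gt0.
have pi2 := pi_ge2 R; have pi0 := pi_gt0 R.
have [[oD1 bD1 cD1 [x0 Dx0]] [oD bD cD [p0 Dp0]]] := patch_shape e0 adm.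
have [_ _ dis shp] := adm.
have sb := shape_box e0 cD oD shp.
(* [K] abstracts the numeral; the two inequalities record its uses, half of it bounding the position
   of the shape and half of it the diameter. *)
have [K [KE K0 K1 K2]] : exists K : R, [/\ K = 2052, 0 < K, 2 * 1026 <= K & 2 * 1024 <= K].
  by exists 2052; split; lra.
rewrite -KE ler_pdivlMr//; have KK : 0 < K ^+ 2 by exact: exprn_gt0.
have sE : s * (K * eps) ^+ 2 = K ^+ 2 * pi^-1.
  rewrite /s; move: (lt0r_neq0 pi0); generalize (@pi R) => P P0.
  by field; rewrite P0 gt_eqF.
have pi21 : pi^-1 <= 1 :> R by rewrite invf_le1//; move: pi2; lra.
have hK : s * (K * eps) ^+ 2 <= K ^+ 2 by rewrite sE ler_piMr// ltW.
have [small|big] := ltP (K * eps) `|l|; last first.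
  have /andP[/ltW O0 hO] := Omega_bounds.
  have l2e : l ^+ 2 <= (K * eps) ^+ 2.
    by rewrite -(real_normK (num_real l)) ler_pXn2r ?nnegrE// mulr_ge0// ltW.
  apply: le_trans hK; apply: ler_pM => //; first exact: ltW.
  by apply: le_trans hO _; move: s0; lra.
have D1E := vortex_patchE l D e0.
have inD x : D1 x -> exists2 p, D p & x = (l + eps * p.1, eps * p.2).
  by move=> [p Dp <-]; exists p.
pose sg : R := Num.sg l.
have sgl : sg * l = `|l| by rewrite /sg normrEsg.
have sg1 : sg ^+ 2 = 1 by rewrite /sg sqr_sg l0.
have nsg : `|sg| = 1 by rewrite /sg normr_sg l0.
have loc x : D1 x -> `|l| / 2 <= sg * coor false x.
  move=> /inD[p Dp ->] /=; rewrite mulrDr sgl.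
  have [hp _] := sb _ _ Dp Dp0.
  have : `|sg * (eps * p.1)| <= eps * 1026 by rewrite !normrM nsg mul1r gtr0_norm// ler_pM2l.
  by rewrite ler_norml => /andP[+ _]; move: small (ler_wpM2r (ltW e0) K1); lra.
have nl : 0 < `|l| by rewrite normr_gt0.
have hsg x : D1 x -> 0 < sg * coor false x.
  by move=> /loc; apply: lt_le_trans; rewrite divr_gt0.
have loc2 y : D2 y -> sg * coor false y <= - (`|l| / 2).
  by rewrite oppE => /loc /=; rewrite mulrN lerNr.
have hsg2 y : D2 y -> sg * coor false y < 0.
  by move=> /loc2 h; apply: le_lt_trans h _; rewrite oppr_lt0 divr_gt0.
have ne1 : D1 !=set0 by exists x0.
have ne2 : D2 !=set0 by exists (- x0); exists x0.
have [Psi [c1 [c2 [wl far cPsi bc1 bc2]]]] := cor.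
have bc1' p : closure D1 p -> ~ D1 p -> Psi p = c1.
  by move=> h1 h2; apply: bc1; split=> //; rewrite ((interior_id D1).1 oD1).
have := Omega_far oD1 oD2 bD1 bD2 cPsi wl far bc1' s0 hsg hsg2 ne1 ne2 sg1 nl loc loc2.
rewrite real_normK ?num_real// => /le_trans; apply.
have [r rE r0] : exists2 r : R, r = eps * 1024 & 0 <= r
  by exists (eps * 1024); [reflexivity|apply: mulr_ge0; [exact: ltW|exact: ler0n]].
have A2 : I2 \1_D2 <= (2 * r) ^+ 2.
  apply: (I2_box_le (x0 := - (l + eps * p0.1)) (y0 := - (eps * p0.2)) oD2 bD2 r0).
  move=> x; rewrite oppE => /inD[p Dp xp]; have [_] := sb _ _ Dp Dp0.
  rewrite prod_normE/= ge_max => /andP[h1 h2].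
  have -> : x.1 = - (l + eps * p.1) by rewrite -[x]opprK xp.
  have -> : x.2 = - (eps * p.2) by rewrite -[x]opprK xp.
  split.
    have -> : - (l + eps * p.1) - - (l + eps * p0.1) = - (eps * (p.1 - p0.1)) by ring.
    by rewrite rE normrN normrM gtr0_norm// ler_pM2l.
  have -> : - (eps * p.2) - - (eps * p0.2) = - (eps * (p.2 - p0.2)) by ring.
  by rewrite rE normrN normrM gtr0_norm// ler_pM2l.
rewrite ler_pdivrMr//; apply: (@le_trans _ _ (s * (2 * r) ^+ 2)).
  by rewrite ler_pM2l.
apply: (@le_trans _ _ (s * (K * eps) ^+ 2)).
  have h : 2 * r <= K * eps by rewrite rE; have := ler_wpM2r (ltW e0) K2; lra.
  have h0 : 0 <= 2 * r by rewrite mulr_ge0.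
  by rewrite ler_pM2l// ler_pXn2r// nnegrE// (le_trans h0).
apply: le_trans hK _; rewrite ler_peMr ?ltW//; move: pi2; lra.
Qed.
End Corotating.

Theorem theorem3p1 (R : realType) :
  (forall (l eps Omega : R) (D : set (R * R)),
     0 < eps -> admissible_pair l eps D ->
     corotating eps Omega (vortex_patch l eps D) (opp_set (vortex_patch l eps D)) ->
     0 < Omega <= (2 * pi * eps ^+ 2)^-1)
  /\
  (exists C : R, forall (l eps Omega : R) (D : set (R * R)),
     0 < eps -> admissible_pair l eps D ->
     corotating eps Omega (vortex_patch l eps D) (opp_set (vortex_patch l eps D)) ->
     eps <= `|l| / 10 -> `|Omega| <= C * `|l| ^- 2).
Proof.
split=> [l eps Omega D e0 adm cor|].
  have := Omega_bounds e0 adm cor.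
  have -> : (2 * pi * eps ^+ 2)^-1 = (pi * eps ^+ 2)^-1 / 2 by rewrite -(mulrA 2 pi) invfM mulrC.
  exact.
exists (2052 ^+ 2) => l eps Omega D e0 adm cor el.
have l0 : l != 0.
  by apply/negP => /eqP h; move: el; rewrite h normr0 mul0r leNgt e0.
have /andP[Op _] := Omega_bounds e0 adm cor.
by rewrite (gtr0_norm Op) real_normK ?num_real//; exact: (Omega_decay e0 adm cor).
Qed.
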